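(* Let $G$ be a locally finite acyclic Borel graph on a standard Borel space $X$ such that no connected component of $G$ has exactly $0$ or exactly $2$ ends. (1) Let $\mu$ be a Borel probability measure on $X$. Then there is a $\mu$-conull Borel set $B \subseteq X$ and a one-ended Borel function $f \colon B \to X$ whose graph is contained in $G$. (2) Let $\tau$ be a compatible Polish topology on $X$. Then there is a $\tau$-comeager Borel set $B \subseteq X$ and a one-ended Borel function $f \colon B \to X$ whose graph is contained in $G$.
   Context: A graph on $X$ is a symmetric irreflexive relation on $X$; it is locally finite if every vertex has finitely many neighbors, and acyclic if it has no cycles. A Borel graph on a standard Borel space $X$ is a graph on $X$ that is Borel as a subset of $X \times X$. A Polish topology on $X$ is compatible if it generates the given Borel $\sigma$-algebra. A ray is an infinite sequence $(x_i)_{i \in \mathbb{N}}$ of distinct vertices with $x_i \mathrel{G} x_{i+1}$ for all $i$. Two rays are end-equivalent if for every finite $S \subset X$ they eventually lie in the same connected component of $G \restriction (X \setminus S)$; an end is an end-equivalence class of rays. The ends of a connected component are the ends represented by rays in it. A partial function $f$ from $X$ to $X$ (here $f \colon B \to X$ with $B \subseteq X$) is one-ended if there is no infinite sequence $x_0, x_1, \ldots \in X$ with $f(x_{i+1}) = x_i$ (and $x_{i+1} \in \mathrm{dom}(f)$) for every $i \in \mathbb{N}$. The graph of $f$ is contained in $G$ if $x \mathrel{G} f(x)$ for every $x \in \mathrm{dom}(f)$. *)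

(* Defs.v *)
From HB Require Import structures.
From mathcomp Require Import all_boot all_order all_algebra.
From mathcomp Require Import all_classical all_reals all_analysis.

Set Implicit Arguments.
Unset Strict Implicit.
Unset Printing Implicit Defensive.

Import Order.TTheory GRing.Theory Num.Theory.
Import numFieldNormedType.Exports.

Local Open Scope classical_set_scope.
Local Open Scope ring_scope.

Section Graph.
Context {X : choiceType}.
Implicit Types (G : rel X) (x y : X) (A C S : set X) (u v : nat -> X).

Definition is_graph G := symmetric G /\ irreflexive G.

Definition locally_finite G := forall x, finite_set [set y | G x y].

(* A list of length at most 2 that is a [ucycle] is not a graph cycle: the
   edge x - y read back and forth is the [ucycle] [:: x; y]. *)
Definition acyclic G := forall c : seq X, (2 < size c)%N -> ~ ucycle G c.

Definition reachable G x y := exists2 p : seq X, path G x p & y = last x p.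

Definition component G x : set X := [set y | reachable G x y].

Definition induced G A : rel X :=
  fun x y => [&& x \in A, y \in A & G x y].

Definition same_component_in G A x y :=
  [/\ A x, A y & reachable (induced G A) x y].

Definition ray G u := injective u /\ forall i, G (u i) (u i.+1).

Definition end_equiv G u v :=
  forall S, finite_set S ->
    exists N, forall m n, (N <= m)%N -> (N <= n)%N ->
      same_component_in G (~` S) (u m) (v n).

Definition end_of G u : set (nat -> X) := [set v | ray G v /\ end_equiv G u v].

Definition ends_of G C : set (set (nat -> X)) :=
  [set E | exists u, [/\ ray G u, (forall i, C (u i)) & E = end_of G u]].

(* A partial function on X with domain B is a total f : X -> X whose values
   outside B are never looked at. *)
Definition one_ended (B : set X) (f : X -> X) :=
  ~ exists u, forall i, B (u i.+1) /\ f (u i.+1) = u i.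

Definition graph_contained G (B : set X) (f : X -> X) :=
  forall x, B x -> G x (f x).

End Graph.

Section Topology.

Definition separable (T : topologicalType) :=
  exists2 D : set T, countable D & dense D.

(* A metric structure M on T carries its own topology, which is required to be
   the given one. *)
Definition completely_metrizable (R : realType) (T : topologicalType) :=
  exists M : Metric R T,
    @open (Metric.Pack M) = @open T /\
    (forall F : set_system (Metric.Pack M),
       ProperFilter F -> cauchy F -> exists x : Metric.Pack M, F --> x).

Definition polish (R : realType) (T : topologicalType) :=
  separable T /\ completely_metrizable R T.

Definition nowhere_dense (T : topologicalType) (A : set T) :=
  interior (closure A) = set0.

Definition meager (T : topologicalType) (A : set T) :=
  exists2 F : nat -> set T,
    (forall n, nowhere_dense (F n)) & A = \bigcup_n F n.

Definition comeager (T : topologicalType) (A : set T) := meager (~` A).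

End Topology.

Section StandardBorel.
Context {d : measure_display} (R : realType) (X : measurableType d).

Definition compatible_polish (tau : Topological X) :=
  polish R (Topological.Pack tau) /\
  @measurable d X = <<s @open (Topological.Pack tau) >>.

Definition standard_borel := exists tau : Topological X, compatible_polish tau.

End StandardBorel.

Definition borel_graph {d : measure_display} {X : measurableType d}
    (G : rel X) :=
  is_graph G /\ measurable [set xy : X * X | G xy.1 xy.2].

(* Main.v *)
Require Import Defs.
From HB Require Import structures.
From mathcomp Require Import all_boot all_order all_algebra.
From mathcomp Require Import all_classical all_reals all_analysis.
From mathcomp Require Import zify ring lra.

(**
If [A] is a set of vertices and [A'] meets every component of [G|A], then there is a
one-ended function from [A \ A'] to [A]: a vertex from which the distance to [A'] can
increase forever moves away from [A'], any other vertex moves towards [A'], and only finitely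
many vertices are led to it by such moves.  So it suffices to find decreasing Borel sets [A_n]
with null (meager) intersection, each meeting every component of the previous one.

Replacing a vertex by a path through its incident edges ("corners") makes all degrees at most 3.
Call [A] good if all degrees in [G|A] are at least 2 and every component has a branch vertex.
The branch vertices of a good [A] form a contracted graph of degree at most 3, hence are
covered by a fixed number of Borel sets [D] whose points are at contracted distance at least 4.
Deleting [D] with the segments attached to it, and then the components that became
lines, leaves a good set.  If nothing is left of some component, it contains a single
point of [D], and all its vertices can move away from that point.  Every vertex is deleted
for one of the boundedly many [D], so [D] can be chosen to delete a fixed fraction of the measure,
or a nonmeager part of a given basic open set.

Vertices outside the core (those without two infinite directions) move in their unique
infinite direction; the core is good because no component has exactly 2 ends.  A one-ended
function on corners descends to vertices by leaving each vertex through the corner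
with the longest chain of preimages.

All constructions use countable quantification over edges; this is justified by Borel functions
enumerating the neighbors, that is, by the Lusin-Novikov theorem for finite sections.
*)

Set Implicit Arguments.
Unset Strict Implicit.
Unset Printing Implicit Defensive.

Import Order.TTheory GRing.Theory Num.Theory.
Import numFieldNormedType.Exports.

Local Open Scope classical_set_scope.

(** * Reduced walks and forests *)

(** Degree at most 3 makes the number of sparse sets uniform: it depends only on the number of words
    of one to three moves, so each deletion can claim the same fraction of the measure. Local
    finiteness alone gives no such constant, whence the corners. Contracted distance 4 comes from
    two requirements. Distance 3 keeps degrees at least 2: a branch vertex outside [D] loses at most
    one side. Distance 4 controls the components where nothing survives: if such a component had a
    second point of [D], the second branch vertex on a shortest walk to it would keep all three
    sides and hence survive. Such components do occur, for instance three rays issuing from one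
    branch vertex, and this is why distances are measured to [W] rather than to [A1]. *)

Lemma ex_least (P : nat -> Prop) : (exists n, P n) ->
  exists n, P n /\ forall m, P m -> n <= m.
Proof.
move=> [n]; elim/ltn_ind: n => n IH Pn.
have [[m [mn Pm]]|h] := EM (exists m, m < n /\ P m); first exact: (IH m).
by exists n; split=> // m Pm; rewrite leqNgt; apply/negP => mn; apply: h; exists m.
Qed.

Section Walk.
Variables (T : Type) (E : T -> T -> Prop).
Implicit Types (u v : nat -> T) (n m i j : nat).

Definition walk u n := forall i, i < n -> E (u i) (u i.+1).
Definition reduced u n := forall i, i.+1 < n -> u i <> u i.+2.
(** Acyclicity in the form used throughout, where it yields uniqueness of reduced walks. The case
    [n = 1] contains irreflexivity. *)
Definition forest := forall u n, 0 < n -> walk u n -> reduced u n -> u 0 <> u n.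

(** Backtrackings [u i = u i.+2] are cut out one at a time. The last clause traces interior vertices
    to interior vertices, so that lying in a given set is inherited. *)
Lemma walk_reduce u n : walk u n -> exists v m, m <= n /\
  [/\ walk v m, reduced v m, v 0 = u 0, v m = u n &
      forall i, 0 < i < m -> exists2 j, 0 < j < n & v i = u j].
Proof.
elim/ltn_ind: n u => n IH u wu.
have [ru|] := EM (reduced u n).
  by exists u, n; split=> //; split=> // i hi; exists i.
move=> /existsNP[i] /not_implyP[hi] /contrapT e.
pose u' j := if j <= i then u j else u j.+2.
have [||v [m [mn [wv rv v0 vm vi]]]] := IH (n - 2) _ u'; first by lia.
- move=> j hj; rewrite /u'; case: (leqP j i) => h1; case: (leqP j.+1 i) => h2; try lia.
  + by apply: wu; lia.
  + have -> : j = i by lia.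
    by rewrite e; apply: wu; lia.
  + by apply: wu; lia.
exists v, m; split; first lia.
split=> //.
  rewrite vm /u'; case: leqP => h.
    have -> : n - 2 = i by lia.
    by rewrite e; congr u; lia.
  by congr u; lia.
move=> k /vi[j hj ->]; rewrite /u'; case: leqP => h; first by exists j => //; lia.
by exists j.+2 => //; lia.
Qed.

Hypothesis symE : forall x y, E x y -> E y x.

Lemma reduced_walk_unique u v n m : forest ->
  walk u n -> reduced u n -> walk v m -> reduced v m ->
  u 0 = v 0 -> u n = v m -> n = m /\ forall i, i <= n -> u i = v i.
Proof.
move=> F; elim: n m => [|n IH] [|m] wu ru wv rv e0 en.
- by split=> // -[].
- by case: (F v m.+1) => //; rewrite -e0 en.
- by case: (F u n.+1) => //; rewrite e0 en.
have [e|ne] := EM (u n = v m).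
  case: (IH m) => // [i hi|i hi|i hi|i hi|em h].
  - by apply: wu; lia.
  - by apply: ru; lia.
  - by apply: wv; lia.
  - by apply: rv; lia.
  subst m; split=> // i; rewrite leq_eqVlt => /orP[/eqP->//|hi].
  exact: h.
exfalso.
(* Follow [u] to its end and return along [v]: a closed walk, reduced at the turn because the
   penultimate vertices differ. *)
pose w i := if i <= n.+1 then u i else v (n + m + 2 - i).
apply: (F w (n + m + 2)); first by lia.
- move=> i hi; rewrite /w; case: (leqP i n.+1) => h1; case: (leqP i.+1 n.+1) => h2; try lia.
  + by apply: wu; lia.
  + have -> : i = n.+1 by lia.
    rewrite en; have -> : n + m + 2 - n.+2 = m by lia.
    by apply/symE/wv.
  + have -> : n + m + 2 - i = (n + m + 2 - i.+1).+1 by lia.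
    by apply/symE/wv; lia.
- move=> i hi; rewrite /w; case: (leqP i n.+1) => h1; case: (leqP i.+2 n.+1) => h2; try lia.
  + by apply: ru; lia.
  + have [?|?] : i = n \/ i = n.+1 by lia.
      by subst i; have -> : n + m + 2 - n.+2 = m by lia.
    subst i; rewrite en; have -> : m.+1 = (n + m + 2 - n.+3).+2 by lia.
    by apply/nesym/rv; lia.
  + have -> : n + m + 2 - i = (n + m + 2 - i.+2).+2 by lia.
    by apply/nesym/rv; lia.
by rewrite /w leq0n ifN ?subnn //; lia.
Qed.

Lemma reduced_walk_inj u n i j : forest -> walk u n -> reduced u n ->
  i <= n -> j <= n -> u i = u j -> i = j.
Proof.
move=> F wu ru.
wlog hij : i j / i <= j.
  by move=> H hi hj e; case: (leqP i j) => h; [exact: H|apply/esym/H => //; lia].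
move=> hi hj e; case: (ltngtP i j) => h //; first last. by lia.
case: (F (fun k => u (i + k)) (j - i)); first by lia.
- by move=> k hk; rewrite addnS; apply: wu; lia.
- by move=> k hk; rewrite !addnS; apply: ru; lia.
by rewrite addn0 subnKC.
Qed.

End Walk.

Section AcyclicForest.
Variables (X : choiceType) (G : rel X).

Lemma path_map_iota (w : nat -> X) s k :
  (forall i, s <= i < s + k -> G (w i) (w i.+1)) -> path G (w s) (map w (iota s.+1 k)).
Proof.
elim: k s => //= k IH s h; rewrite h ?leqnn ?addnS ?leq_addr//=.
by apply: IH => i hi; apply: h; lia.
Qed.

(** A shortest return inside the walk is an injective cycle; irreflexivity excludes length 1 and
    reducedness length 2, so [acyclic] applies. *)
Lemma acyclic_forest : is_graph G -> acyclic G -> forest G.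
Proof.
move=> [sG iG] aG u n n0 wu ru e.
have [k0 [[k00 [i [hi ei]]] mink]] : exists k,
    (0 < k /\ exists i, i + k <= n /\ u i = u (i + k)) /\
    forall m, 0 < m /\ (exists i, i + m <= n /\ u i = u (i + m)) -> k <= m.
  by apply: ex_least; exists n; split=> //; exists 0.
pose w l := u (i + l).
have winj a b : a < k0 -> b < k0 -> w a = w b -> a = b.
  wlog hab : a b / a <= b.
    by move=> H ha hb h; case: (leqP a b) => ?; [exact: H|apply/esym/H => //; lia].
  move=> ha hb h; case: (ltngtP a b) => // h'; last lia.
  have := mink (b - a); have hb' : 0 < b - a /\ exists i, i + (b - a) <= n /\ u i = u (i + (b - a)).
    split; first lia.
    by exists (i + a); split; [lia|rewrite -/(w a) h /w; congr u; lia].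
  by move/(_ hb'); lia.
case: k0 k00 hi ei mink winj => // k' _ hi ei mink winj.
have k2 : 1 < k'.
  case: k' hi ei {mink winj} => [|[|//]] hi ei.
    by have := wu i; rewrite ei addn1 iG => /(_ ltac:(lia)).
  by case: (ru i); [lia|rewrite ei; congr u; lia].
apply: (aG (mkseq w k'.+1)); first by rewrite size_mkseq.
rewrite /ucycle; apply/andP; split; last first.
  by apply/mkseq_uniqP => a b ha hb; exact: winj.
rewrite /mkseq /=; have -> : rcons (map w (iota 1 k')) (w 0) = map w (iota 1 k'.+1).
  by rewrite -(addn1 k') iotaD map_cat cats1 /= {2}/w add1n addn0 ei /w.
by apply: path_map_iota => a ha; rewrite /w addnS; apply: wu; lia.
Qed.

End AcyclicForest.

(** * Thinning out a cubic forest *)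

Section MeasurablePredicates.
Context {d : measure_display} {T : measurableType d}.
Implicit Types (P Q : T -> Prop).

(** Borel sets as predicates: with closure under connectives and countable quantifiers, Borelness is
    proved by following the shape of a formula. *)
Definition mpred P := measurable (P : set T).

Lemma mpred_ext P Q : (forall x, P x <-> Q x) -> mpred P -> mpred Q.
Proof. by move=> h; have -> : P = Q by apply/funext => x; apply/propext. Qed.

Lemma mpred_const (p : Prop) : mpred (fun=> p).
Proof.
have [hp|hp] := EM p.
  by apply: (@mpred_ext setT) => //; exact: measurableT.
by apply: (@mpred_ext set0) => //; exact: measurable0.
Qed.

Lemma mpred_not P : mpred P -> mpred (fun x => ~ P x).
Proof. exact: measurableC. Qed.

Lemma mpred_and P Q : mpred P -> mpred Q -> mpred (fun x => P x /\ Q x).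
Proof. exact: measurableI. Qed.

Lemma mpred_or P Q : mpred P -> mpred Q -> mpred (fun x => P x \/ Q x).
Proof. exact: measurableU. Qed.

Lemma mpred_imp P Q : mpred P -> mpred Q -> mpred (fun x => P x -> Q x).
Proof.
move=> mP mQ; apply: (@mpred_ext (fun x => ~ P x \/ Q x)) => [x|].
  by split=> [[]//|h]; have [/h|] := EM (P x); [right|left].
by apply: mpred_or => //; apply: mpred_not.
Qed.

Lemma mpred_ex (I : countType) (P : I -> T -> Prop) :
  (forall i, mpred (P i)) -> mpred (fun x => exists i, P i x).
Proof.
move=> mP; pose F n : set T := if unpickle n is Some i then P i else set0.
have -> : (fun x => exists i, P i x) = \bigcup_n F n.
  apply/seteqP; split=> [x [i Px]|x [n _]].
    by exists (pickle i) => //; rewrite /F pickleK.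
  by rewrite /F; case: (unpickle n) => // i Px; exists i.
apply: bigcupT_measurable => n; rewrite /F; case: unpickle => [i|//].
exact: mP.
Qed.

Lemma mpred_all (I : countType) (P : I -> T -> Prop) :
  (forall i, mpred (P i)) -> mpred (fun x => forall i, P i x).
Proof.
move=> mP; apply: (@mpred_ext (fun x => ~ exists i, ~ P i x)) => [x|].
  split=> [h i|h [i]//]; apply: contrapT => h'; apply: h; by exists i.
by apply: mpred_not; apply: mpred_ex => i; apply: mpred_not.
Qed.

End MeasurablePredicates.

Definition bfun d d' (S : measurableType d) (T : measurableType d') (f : S -> T) :=
  forall P : T -> Prop, mpred P -> mpred (fun x => P (f x)).

Lemma bfun_comp d d' d'' (S : measurableType d) (T : measurableType d')
    (U : measurableType d'') (f : S -> T) (g : T -> U) :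
  bfun f -> bfun g -> bfun (g \o f).
Proof. by move=> mf mg P mP; apply: (mf (P \o g)); apply: mg. Qed.

(** Makes equality of Borel functions a countable condition; the graph constructions use the
    topology in this form only. *)
Definition separating d (T : measurableType d) (O : nat -> set T) :=
  (forall k, mpred (O k)) /\ forall x y, x <> y -> exists k, O k x /\ ~ O k y.

(** The index with the least code is chosen. The default [i0] makes [R] a total functional relation,
    so the level sets of [J] are given by formulas. *)
Lemma mselect d (T : measurableType d) (I : countType) (i0 : I) (P : I -> T -> Prop) :
  (forall i, mpred (P i)) -> exists J : T -> I,
    (forall i, mpred (fun x => J x = i)) /\ forall x, (exists i, P i x) -> P (J x) x.
Proof.
move=> mP.
pose R i x := (P i x /\ forall k, P k x -> pickle i <= pickle k) \/
  ((forall k, ~ P k x) /\ i = i0).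
have /choice[J hJ] : forall x, exists i, R i x.
  move=> x; have [[i Pi]|h] := EM (exists i, P i x); last first.
    by exists i0; right; split=> // k Pk; apply: h; exists k.
  have [|n [[k Pk <-] mn]] := @ex_least (fun n => exists2 k, P k x & pickle k = n).
    by exists (pickle i), i.
  by exists k; left; split=> // l Pl; apply: mn; exists l.
have uR i k x : R i x -> R k x -> i = k.
  case=> [[Pi hi]|[nP ->]]; case=> [[Pk hk]|[nP' ->]] //.
  - have /eqP : pickle i = pickle k by apply/eqP; rewrite eqn_leq hi// hk.
    by move=> /eqP /(pcan_inj pickleK).
  - by case: (nP' i).
  - by case: (nP k).
exists J; split=> [i|x [i Pi]]; last first.
  by case: (hJ x) => [[]//|[/(_ i)]].
apply: (@mpred_ext _ _ (R i)) => [x|]; first by split=> [h|<-//]; exact: uR (hJ x) h.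
apply: mpred_or; apply: mpred_and => //; last exact: mpred_const.
  by apply: mpred_all => k; apply: mpred_imp => //; exact: mpred_const.
by apply: mpred_all => k; apply: mpred_not.
Qed.

Lemma mpred_eq d d' (S : measurableType d) (T : measurableType d') (O : nat -> set T)
    (f g : S -> T) : separating O -> bfun f -> bfun g -> mpred (fun x => f x = g x).
Proof.
move=> [mO sO] mf mg.
apply: (@mpred_ext _ _ (fun x => forall k, O k (f x) -> O k (g x))) => [x|].
  split=> [h|-> //]; apply: contrapT => /sO[k [h1 h2]]; exact/h2/h.
by apply: mpred_all => k; apply: mpred_imp; [exact: mf|exact: mg].
Qed.

Section CubicForest.
Context {d : measure_display} {Y : measurableType d} (e : 'I_3 -> Y -> Y).

(** A fixed point of [e j] stands for an absent edge, so three functions describe a graph of degree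
    at most 3. *)
Definition adj x y := x <> y /\ exists j, e j x = y.

(** Recursion over the three moves, instead of an existential over walks, keeps this Borel. [P] is
    required of every vertex of the walk but the last. *)
Fixpoint rch n (P Q : Y -> Prop) x : Prop := match n with
  | 0 => Q x
  | n.+1 => P x /\ exists j, e j x <> x /\ rch n P Q (e j x)
  end.

Definition branch (A : Y -> Prop) x :=
  [/\ A x, forall j, A (e j x) /\ e j x <> x & forall i j, i <> j -> e i x <> e j x].

Definition good (A : Y -> Prop) :=
  [/\ mpred A,
      forall x, A x -> exists y z, [/\ y <> z, adj x y, adj x z, A y & A z] &
      forall x, A x -> exists n, rch n A (branch A) x].

Context (O : nat -> set Y).
Hypothesis me : forall j, bfun (e j).
Hypothesis sepO : separating O.
Hypothesis symadj : forall x y, adj x y -> adj y x.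
Hypothesis fadj : forest adj.

Lemma adj_e j x : e j x <> x -> adj x (e j x).
Proof. by move=> h; split; [exact: nesym|exists j]. Qed.

Lemma rchP n P Q x : rch n P Q x <->
  exists u, [/\ u 0 = x, walk adj u n, forall i, i < n -> P (u i) & Q (u n)].
Proof.
elim: n x => [|n IH] x /=.
  split=> [Qx|[u [<- //]]]; by exists (fun=> x).
split=> [[Px [j [hj /IH[u [u0 wu Pu Qu]]]]]|[u [<- wu Pu Qu]]].
  exists (fun i => if i is i'.+1 then u i' else x); split=> // -[|i] hi //.
  - by rewrite u0; exact: adj_e.
  - exact: wu.
  - exact: Pu.
split; first exact: Pu.
have [ne [j hj]] := wu 0 isT; exists j; rewrite hj; split; first exact: nesym.
apply/IH; exists (u \o S); split=> // i hi; [exact: wu|exact: Pu].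
Qed.

Lemma mpred_ne_e j k : mpred (fun x => e j x <> e k x).
Proof. by apply: mpred_not; apply: (mpred_eq sepO). Qed.

Lemma mpred_move j : mpred (fun x => e j x <> x).
Proof. apply: mpred_not; exact: (mpred_eq sepO). Qed.

Lemma mpred_rch n P Q : mpred P -> mpred Q -> mpred (rch n P Q).
Proof.
move=> mP mQ; elim: n => [//|n IH] /=.
apply: mpred_and => //; apply: mpred_ex => j.
by apply: mpred_and; [exact: mpred_move|exact: me].
Qed.

Lemma mpred_branch A : mpred A -> mpred (branch A).
Proof.
move=> mA; apply: (@mpred_ext _ _ (fun x => A x /\ ((forall j, A (e j x) /\ e j x <> x)
   /\ forall i j, i <> j -> e i x <> e j x))) => [x|].
  by split=> [[? []]|[]].
apply: mpred_and => //; apply: mpred_and; apply: mpred_all => j.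
  by apply: mpred_and; [exact: me|exact: mpred_move].
apply: mpred_all => k; apply: mpred_imp; [exact: mpred_const|exact: mpred_ne_e].
Qed.

Lemma ord3_cover (i j k l : 'I_3) : i <> j -> i <> k -> j <> k -> [\/ l = i, l = j | l = k].
Proof.
move=> hij hik hjk.
have h (a b : 'I_3) : a <> b -> (a : nat) <> b by move=> ne /ord_inj.
move: (h _ _ hij) (h _ _ hik) (h _ _ hjk) (ltn_ord i) (ltn_ord j) (ltn_ord k) (ltn_ord l).
move=> h1 h2 h3 h4 h5 h6 h7.
have [?|[?|?]] : (l : nat) = i \/ (l : nat) = j \/ (l : nat) = k by lia.
- by apply: Or31; apply: ord_inj.
- by apply: Or32; apply: ord_inj.
- by apply: Or33; apply: ord_inj.
Qed.

Lemma three_branch A x y z w : A x -> adj x y -> adj x z -> adj x w -> A y -> A z -> A w ->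
  y <> z -> y <> w -> z <> w -> branch A x.
Proof.
move=> Ax [xy [i hi]] [xz [j hj]] [xw [k hk]] Ay Az Aw yz yw zw.
have ij : i <> j by move=> h; apply: yz; rewrite -hi -hj h.
have ik : i <> k by move=> h; apply: yw; rewrite -hi -hk h.
have jk : j <> k by move=> h; apply: zw; rewrite -hk -hj h.
split=> // [l|a b].
  by case: (ord3_cover l ij ik jk) => ->; rewrite ?hi ?hj ?hk; split=> //; exact: nesym.
by case: (ord3_cover a ij ik jk) => ->; case: (ord3_cover b ij ik jk) => ->; rewrite ?hi ?hj ?hk
   => // _; exact: nesym.
Qed.

(** * The contracted graph on branch vertices and its sparse sets *)

Section Hops.
Variable A : Y -> Prop.
Hypothesis mA : mpred A.
Let B := branch A.

(** [x] is the vertex just left and [y] the current one: the walk never turns back, and before its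
    end it meets no branch vertex, so it has no choice ([trk_det]). *)
Fixpoint trk n (Q : Y -> Prop) x y : Prop := match n with
  | 0 => B y /\ Q y
  | n.+1 => ~ B y /\ exists j, [/\ e j y <> y, A (e j y), e j y <> x & trk n Q y (e j y)]
  end.

(* One edge of the contracted graph: leave [b] by the move [j] and walk straight on to the
   next branch vertex, which must satisfy [Q]. *)
Definition hopj j Q b := [/\ e j b <> b, A (e j b) & exists n, trk n Q b (e j b)].

(** Stated for general [f] and [g] because the induction replaces them by [g] and [e j \o g]. *)
Lemma mpred_trk n Q (f g : Y -> Y) : mpred Q -> bfun f -> bfun g -> mpred (fun x => trk n Q (f x) (g x)).
Proof.
move=> mQ; have mB : mpred B by exact: mpred_branch.
elim: n f g => [|n IH] f g mf mg /=.
  by apply: (mg (fun y => B y /\ Q y)); apply: mpred_and.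
apply: mpred_and; first by apply: (mg (fun y => ~ B y)); apply: mpred_not.
apply: mpred_ex => j.
apply: (@mpred_ext _ _ (fun x => (e j (g x) <> g x /\ A (e j (g x))) /\ (e j (g x) <> f x /\
   trk n Q (g x) (e j (g x))))) => [x|].
  by split=> [[[? ?] []]|[? ? ? ?]].
have mjg : bfun (e j \o g) := bfun_comp mg (me j).
apply: mpred_and; apply: mpred_and.
- exact: (mg _ (mpred_move j)).
- exact: mjg.
- by apply: mpred_not; apply: (mpred_eq sepO).
- exact: IH.
Qed.

Lemma mpred_hopj j Q : mpred Q -> mpred (hopj j Q).
Proof.
move=> mQ; apply: (@mpred_ext _ _ (fun b => (e j b <> b /\ A (e j b)) /\
   exists n, trk n Q b (e j b))) => [x|].
  by split=> [[[? ?] ?]|[? ? ?]].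
apply: mpred_and; first by apply: mpred_and; [exact: mpred_move|exact: me].
by apply: mpred_ex => n; apply: mpred_trk.
Qed.

(** Two different continuations at [y], together with the vertex it was entered from, would be three
    neighbors in [A] and make [y] a branch vertex. *)
Lemma trk_det n m Q Q' x y : A x -> A y -> adj y x -> trk n Q x y -> trk m Q' x y ->
  exists z, [/\ B z, Q z & Q' z].
Proof.
elim: n m x y => [|n IH] [|m] x y Ax Ay yx /=.
- by move=> [? ?] [? ?]; exists y.
- by move=> [? ?] [].
- by move=> [? ?] [].
move=> [nB [j [h1 h2 h3 h4]]] [_ [k [h1' h2' h3' h4']]].
have ejk : e j y = e k y.
  apply: contrapT => ne; apply: nB.
  by apply: (three_branch Ay yx (adj_e h1) (adj_e h1')) => //; exact: nesym.
rewrite -ejk in h4'; apply: (IH m y (e j y)) => //.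
exact/symadj/adj_e.
Qed.

Lemma hopj_det j Q Q' x : A x -> hopj j Q x -> hopj j Q' x -> exists z, [/\ B z, Q z & Q' z].
Proof.
move=> Ax [h1 h2 [n hn]] [_ _ [m hm]]; apply: trk_det hn hm => //.
exact/symadj/adj_e.
Qed.

(** Together with [trk_det] this lets [trk] and [hopj] act on predicates like preimages under a
    partial function, whose value [z] is recovered here. *)
Lemma trk_sub n Q x y : trk n Q x y -> exists z, [/\ B z, Q z & forall Q' : Y -> Prop, Q' z -> trk n Q' x y].
Proof.
elim: n x y => [|n IH] x y /= => [[By Qy]|[nB [j [h1 h2 h3 /IH[z [Bz Qz hz]]]]]].
  by exists y; split.
by exists z; split=> // Q' Q'z; split=> //; exists j; split=> //; exact: hz.
Qed.

Lemma hopj_sub j Q x : hopj j Q x ->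
  exists z, [/\ B z, Q z & forall Q' : Y -> Prop, Q' z -> hopj j Q' x].
Proof.
move=> [h1 h2 [n /trk_sub[z [Bz Qz hz]]]]; exists z; split=> // Q' /hz h.
by split=> //; exists n.
Qed.

Lemma hopj_mono j (Q Q' : Y -> Prop) a : (forall b, Q b -> Q' b) -> hopj j Q a -> hopj j Q' a.
Proof. by move=> h /hopj_sub[z [_ /h Qz]]; apply. Qed.

Definition hop x y := exists j, hopj j (eq y) x.

(** The contracted edge in a form that is visibly symmetric. *)
Definition direct x y := exists u n, [/\ 0 < n, u 0 = x, u n = y, walk adj u n & reduced u n]
  /\ (forall i, i <= n -> A (u i)) /\ (forall i, 0 < i < n -> ~ B (u i)).

Lemma trkP n y x z : trk n (eq z) x y <-> exists u, [/\ u 0 = x, u 1 = y, u n.+1 = z, B z &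
  [/\ forall i, 0 < i < n.+1 -> adj (u i) (u i.+1), reduced u n.+1,
   forall i, 1 < i < n.+2 -> A (u i) & forall i, 0 < i < n.+1 -> ~ B (u i)]].
Proof.
elim: n x y => [|n IH] x y.
  split=> [[By zy]|[u [<- <- <- ? [_ ? ? ?]]]]; last by split.
  subst z.
  exists (fun i => if i is 0 then x else y); split=> //; split=> // i hi; exfalso; lia.
split=> [[nB [j [h1 h2 h3 /IH[u [u0 u1 un Bz [wu ru Au Bu]]]]]]|[u [u0 u1 un Bz [wu ru Au Bu]]]].
  exists (fun i => if i is i'.+1 then u i' else x); split=> //; split.
  - by move=> [|[|i]] //= hi; [rewrite u0 u1; exact: adj_e|apply: wu].
  - by move=> [|i] //= hi; [rewrite u1; exact: nesym|apply: ru].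
  - by move=> [|[|[|i]]] //= hi; [rewrite u1|apply: Au].
  - by move=> [|[|i]] //= hi; [rewrite u0|apply: Bu].
have [a [j ej]] := wu 1 isT; rewrite /= -/B; split; first by rewrite -u1; apply: Bu.
exists j; rewrite -u1 -u0 ej; split; [exact: nesym|exact: Au|by apply/nesym/ru|].
rewrite u1; apply/IH; exists (u \o S); split=> //=; split=> i hi.
- by apply: wu; lia.
- by apply: ru.
- by apply: Au; lia.
- by apply: Bu; lia.
Qed.

Lemma hopP x y : A x -> (hop x y <-> B y /\ direct x y).
Proof.
move=> Ax; split=> [[j [h1 h2 [n /trkP[u [u0 u1 un By [wu ru Au Bu]]]]]]|].
  split=> //; exists u, n.+1; split; last split=> //.
    split=> // -[|i] hi; last exact: wu.
    by rewrite u0 u1; exact: adj_e.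
  by move=> [|[|i]] hi; [rewrite u0|rewrite u1|apply: Au].
move=> [By [u [n [[n0 u0 un wu ru] [Au Bu]]]]].
case: n n0 un wu ru Au Bu => // n _ un wu ru Au Bu.
have [a [j ej]] := wu 0 isT.
exists j; rewrite u0 in ej a; rewrite /hopj ej; split; [exact: nesym|exact: Au|].
exists n; apply/trkP; exists u; split=> //; split=> // i hi; [apply: wu|apply: Au]; lia.
Qed.

Lemma direct_sym x y : direct x y -> direct y x.
Proof.
move=> [u [n [[n0 u0 un wu ru] [Au Bu]]]]; exists (fun i => u (n - i)), n; split; split.
- by [].
- by rewrite subn0.
- by rewrite subnn.
- move=> i hi; have -> : n - i = (n - i.+1).+1 by lia.
  by apply/symadj/wu; lia.
- move=> i hi; have -> : n - i = (n - i.+2).+2 by lia.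
  by apply/nesym/ru; lia.
- by move=> i hi; apply: Au; lia.
- by move=> i hi; apply: Bu; lia.
Qed.

Lemma hop_sym x y : B x -> hop x y -> hop y x.
Proof.
move=> Bx; have [Ax _ _] := Bx; move/(hopP _ Ax) => [By /direct_sym xy].
by have [Ay _ _] := By; apply/hopP.
Qed.

Lemma hop_branch x y : hop x y -> B y.
Proof. by move=> [j [_ _ [n /trkP[u []]]]]. Qed.

(** One to three moves of the contracted graph. There are finitely many words, and each leads from a
    vertex to at most one endpoint ([hopw_det]). *)
Definition word := ('I_3 * option 'I_3 * option 'I_3)%type.
Definition hopo (o : option 'I_3) Q := if o is Some j then hopj j Q else Q.
Definition hopw (w : word) Q := hopj w.1.1 (hopo w.1.2 (hopo w.2 Q)).

Lemma mpred_hopw w Q : mpred Q -> mpred (hopw w Q).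
Proof.
move=> mQ; apply: mpred_hopj; case: w.1.2 => [j|/=]; first apply: mpred_hopj;
 case: w.2 => [k|//]; exact: mpred_hopj.
Qed.

Lemma hopo_sub o Q x : B x -> hopo o Q x ->
  exists z, [/\ B z, Q z & forall Q' : Y -> Prop, Q' z -> hopo o Q' x].
Proof. by case: o => [j _|Bx Qx] /=; [exact: hopj_sub|exists x]. Qed.

Lemma hopw_sub w Q x : hopw w Q x ->
  exists z, [/\ B z, Q z & forall Q' : Y -> Prop, Q' z -> hopw w Q' x].
Proof.
move=> /hopj_sub[y [By /(hopo_sub By)[z [Bz /(hopo_sub Bz)[t [Bt Qt ht]] hz]] hy]].
exists t; split=> // Q' Q't; apply: hy; apply: hz; exact: ht.
Qed.

Lemma hopo_det o Q Q' x : B x -> hopo o Q x -> hopo o Q' x -> exists z, [/\ B z, Q z & Q' z].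
Proof.
case: o => [j|] /= Bx; last by exists x.
by apply: hopj_det; case: Bx.
Qed.

Lemma hopw_det w Q Q' x : A x -> hopw w Q x -> hopw w Q' x -> exists z, [/\ B z, Q z & Q' z].
Proof.
move=> Ax h h'; have [y [By hy hy']] := hopj_det Ax h h'.
have [z [Bz hz hz']] := hopo_det By hy hy'; exact: (hopo_det Bz hz hz').
Qed.

Definition conf x y := exists w, hopw w (eq y) x.

Lemma confP x y : conf x y <-> [\/ hop x y, exists2 z, hop x z & hop z y |
  exists z t, [/\ hop x z, hop z t & hop t y]].
Proof.
split=> [[[[j [k|]] [l|]]]|]; rewrite /hopw /=.
- move=> /hopj_sub[z [_ /hopj_sub[t [_ ht ht']] hz]].
  by apply: Or33; exists z, t; split; [exists j; exact: hz|exists k; exact: ht'|exists l].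
- by move=> /hopj_sub[z [_ hz hz']]; apply: Or32; exists z; [exists j; exact: hz'|exists k].
- by move=> /hopj_sub[z [_ hz hz']]; apply: Or32; exists z; [exists j; exact: hz'|exists l].
- by move=> h; apply: Or31; exists j.
case=> [[j h]|[z [j hj] [k hk]]|[z [t [[j hj] [k hk] [l hl]]]]].
- by exists (j, None, None).
- by exists (j, Some k, None); apply: hopj_mono hj => _ <-.
- by exists (j, Some k, Some l); apply: hopj_mono hj => _ <-; apply: hopj_mono hk => _ <-.
Qed.

Lemma conf_sym x y : B x -> conf x y -> conf y x.
Proof.
move=> Bx /confP h; apply/confP; case: h => [h|[z h1 h2]|[z [t [h1 h2 h3]]]].
- by apply: Or31; exact: hop_sym.
- by apply: Or32; exists z; apply: hop_sym => //; exact: hop_branch h1.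
- apply: Or33; exists t, z; split; apply: hop_sym => //.
  + exact: hop_branch h2.
  + exact: hop_branch h1.
Qed.

Definition Os (s : seq nat) x := forall k, k \in s -> O k x.

(** Countably many Borel classes, each sparse: two conflicting points of one class both lie in
    [Os s], hence are equal. *)
Definition Cl (s : seq nat) x :=
  [/\ B x, Os s x & forall w y, Os s y -> hopw w (eq y) x -> y = x].

Lemma mpred_Os s : mpred (Os s).
Proof.
apply: mpred_all => k; apply: mpred_imp; [exact: mpred_const|by case: sepO].
Qed.

Lemma mpred_Cl s : mpred (Cl s).
Proof.
apply: (@mpred_ext _ _ (fun x => B x /\ (Os s x /\ forall w k,
   (hopw w (fun y => Os s y /\ O k y) x -> O k x)))) => [x|].
  split=> [[Bx [Ox h]]|[Bx Ox h]].
    split=> // w y Oy hw; apply: contrapT => ne.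
    have [k [Oky nO]] := sepO.2 _ _ ne; apply: nO; apply: (h w).
    by have [z [_ <-]] := hopw_sub hw; apply.
  split=> //; split=> // w k /hopw_sub[z [_ [Oz Okz] hz]].
  by have <- : z = x by apply: (h w) => //; exact: hz.
have [mO _] := sepO.
apply: mpred_and; first exact: mpred_branch.
apply: mpred_and; first exact: mpred_Os.
apply: mpred_all => w; apply: mpred_all => k; apply: mpred_imp => //.
by apply: mpred_hopw; apply: mpred_and => //; exact: mpred_Os.
Qed.

(** Each of the finitely many words has at most one endpoint, which a single [O k] containing [x]
    excludes unless it is [x] itself. *)
Lemma Cl_cover x : B x -> exists s, Cl s x.
Proof.
move=> Bx; have /choice[K hK] : forall w : word, exists k,
    O k x /\ forall y, hopw w (eq y) x -> O k y -> y = x.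
  move=> w; have [[y [hy ne]]|h] := EM (exists y, hopw w (eq y) x /\ y <> x).
    have [k [h1 h2]] := sepO.2 _ _ (nesym ne); exists k; split=> // z hz Oz.
    have [Ax _ _] := Bx; have [t [_ ty tz]] := hopw_det Ax hy hz.
    by case: h2; rewrite ty -tz.
  have [_ hB _] := Bx; have [_ ne] := hB ord0.
  have [k [h1 _]] := sepO.2 _ _ (nesym ne); exists k; split=> // y hy _.
  by apply: contrapT => ne'; apply: h; exists y.
exists [seq K w | w <- enum {: word}]; split=> //.
  by move=> k /mapP[w _ ->]; have [] := hK w.
move=> w y Oy hw; have [_ h] := hK w; apply: h => //; apply: Oy.
by apply: map_f; rewrite mem_enum.
Qed.


Definition sparse (D : Y -> Prop) := forall x y, D x -> D y -> x <> y -> ~ conf x y.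

Lemma hopw_mono w (Q Q' : Y -> Prop) a : (forall b, Q b -> Q' b) -> hopw w Q a -> hopw w Q' a.
Proof. by move=> h /hopw_sub[z [_ /h Qz]]; apply. Qed.

Lemma maximal_sparse B' : mpred B' -> (forall x, B' x -> B x) -> exists D,
  [/\ mpred D, forall x, D x -> B' x, sparse D &
      forall x, B' x -> D x \/ exists w, hopw w D x].
Proof.
move=> mB' sB'.
pose C k x := exists s, unpickle k = Some s /\ Cl s x.
pose L := fix L k : Y -> Prop := if k is k'.+1 then
   (fun x => L k' x \/ (B' x /\ (C k' x /\ (~ L k' x /\ ~ exists w, hopw w (L k') x))))
   else (fun=> False).
have mL k : mpred (L k).
  elim: k => [|k IH] /=; first exact: mpred_const.
  apply: mpred_or => //; apply: mpred_and => //; apply: mpred_and.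
    by apply: mpred_ex => s; apply: mpred_and; [exact: mpred_const|exact: mpred_Cl].
  apply: mpred_and; apply: mpred_not => //; apply: mpred_ex => w; exact: mpred_hopw.
have Lmono i k x : L i x -> i <= k -> L k x.
  by move=> Li /subnK <-; elim: (k - i) => //= n IH; left.
have LB k x : L k x -> B' x by elim: k => //= k IH [/IH|[]].
have indep k x y : L k x -> L k y -> x <> y -> ~ conf x y.
  elim: k x y => //= k IH x y [Lx|[Bx [Cx [nLx hx]]]] [Ly|[By [Cy [nLy hy]]]] ne.
  - exact: IH.
  - move=> /(conf_sym (sB' _ (LB _ _ Lx)))[w hw]; apply: hy; exists w.
    by apply: hopw_mono hw => _ <-.
  - by move=> [w hw]; apply: hx; exists w; apply: hopw_mono hw => _ <-.
  - move=> [w hw]; move: Cx Cy => [s [e1 [_ _ h]]] [t [e2 [_ Oy _]]].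
    by apply/ne/esym/(h w) => //; move: e2; rewrite e1 => -[->].
exists (fun x => exists k, L k x); split.
- exact: mpred_ex.
- by move=> x [k /LB].
- move=> x y [i Li] [k Lk]; apply: (indep (maxn i k)).
    by apply: Lmono Li _; exact: leq_maxl.
  by apply: Lmono Lk _; exact: leq_maxr.
move=> x Bx; have [s Cs] := Cl_cover (sB' _ Bx).
have [[w hw]|h] := EM (exists w, hopw w (L (pickle s)) x).
  by right; exists w; apply: hopw_mono hw => y Ly; exists (pickle s).
have [?|nL] := EM (L (pickle s) x); left; first by exists (pickle s).
exists (pickle s).+1; right; split=> //; split=> //.
by exists s; rewrite pickleK.
Qed.

(** One more than the number of words: a vertex missed by that many disjoint maximal sparse sets
    would have a word into each, and by [hopw_det] these words would be distinct. *)
Definition rounds := #|{: word}|.+1.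

Lemma sparse_cover : exists D : 'I_rounds -> Y -> Prop,
  (forall i, [/\ mpred (D i), forall x, D i x -> B x & sparse (D i)]) /\
  forall x, B x -> exists i, D i x.
Proof.
have mB : mpred B by exact: mpred_branch.
have /choice[F hF] : forall B', exists D, mpred B' -> (forall x, B' x -> B x) ->
    [/\ mpred D, forall x, D x -> B' x, sparse D &
      forall x, B' x -> D x \/ exists w, hopw w D x].
  move=> B'; have [[m s]|h] := EM (mpred B' /\ forall x, B' x -> B x).
    by have [D hD] := maximal_sparse m s; exists D.
  by exists B => ? ?; case: h.
pose U := fix U n : Y -> Prop := if n is n'.+1 then
  (fun x => U n' x \/ F (fun y => B y /\ ~ U n' y) x) else (fun=> False).
pose D n := F (fun y => B y /\ ~ U n y).
have mU n : mpred (U n).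
  elim: n => [|n IH] /=; first exact: mpred_const.
  apply: mpred_or => //; case: (hF (fun y => B y /\ ~ U n y)) => //.
    by apply: mpred_and => //; apply: mpred_not.
  by move=> x [].
have hD n : [/\ mpred (D n), forall x, D n x -> B x /\ ~ U n x, sparse (D n) &
      forall x, B x /\ ~ U n x -> D n x \/ exists w, hopw w (D n) x].
  apply: hF; last by move=> x [].
  by apply: mpred_and => //; apply: mpred_not.
have Umono i k x : U i x -> i <= k -> U k x.
  by move=> Li /subnK <-; elim: (k - i) => //= n IH; left.
exists (fun i => D i); split=> [i|x Bx].
  by have [? h ? _] := hD i; split=> // x /h[].
apply: contrapT => /forallNP h.
have nU i : i <= rounds -> ~ U i x.
  elim: i => [_ []|i IH hi /= [Ui|Di]]; first exact: (IH (ltnW hi)).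
  exact: (h (Ordinal hi)).
have /choice[w hw] : forall i : 'I_rounds, exists w, hopw w (D i) x.
  move=> i; have [_ _ _ /(_ x)[]//] := hD i; last by move/h.
  by split=> //; apply: nU; apply: ltnW.
have winj : injective w.
  move=> i k; wlog ik : i k / i < k.
    move=> H eik; case: (ltngtP i k) => hik; last exact: ord_inj.
      exact: H.
    by apply/esym/H.
  move=> eik; exfalso; have [Ax _ _] := Bx.
  have := hw i; rewrite eik => hwi; have [z [_ Di Dk]] := hopw_det Ax hwi (hw k).
  have [_ /(_ z Dk)[_ nUk] _ _] := hD k; apply: nUk.
  by apply: (Umono i.+1) => //; right.
by have := leq_card w winj; rewrite card_ord /rounds ltnn.
Qed.


(** * Deleting a sparse set, and the one-ended map on what is deleted *)

Section Removal.
Hypothesis gA : good A.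
Variable D : Y -> Prop.
Hypothesis mD : mpred D.
Hypothesis DB : forall x, D x -> B x.
Hypothesis sD : sparse D.

(* [S] is [D] with the segments attached to it; [A1] keeps the components of the rest
   that are not lines. *)
Let N x := A x /\ ~ B x.
Let S x := exists n, rch n N D x.
Let A2 x := A x /\ ~ S x.
Let A1 x := A2 x /\ exists n, rch n A2 (branch A2) x.

Lemma BA x : B x -> A x. Proof. by case. Qed.

Lemma adj_rch n P Q x y : P x -> adj x y -> rch n P Q y -> rch n.+1 P Q x.
Proof. by move=> Px [ne [j ej]] ry; split=> //; exists j; rewrite ej; split=> //; exact: nesym. Qed.

Lemma S_adj x y : N x -> adj x y -> S y -> S x.
Proof. by move=> Nx xy [n ry]; exists n.+1; exact: adj_rch ry. Qed.

(** A deleted neighbor of [b] lies on a segment ending in [D], so [b] is one contracted edge away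
    from [D] in the direction of [p]. *)
Lemma S_direct b p : B b -> ~ D b -> adj b p -> A p -> S p ->
  exists x u n, [/\ [/\ 0 < n, u 0 = b, u 1 = p, u n = x & D x], walk adj u n, reduced u n,
    forall i, i <= n -> A (u i) & forall i, 0 < i < n -> ~ B (u i)].
Proof.
move=> Bb nDb bp Ap [n /rchP[u [u0 wu Nu Dun]]].
have [Dp|nDp] := EM (D p).
  exists p, (fun i => if i is 0 then b else p), 1; split=> //.
  - by move=> [].
  - by move=> [|i] _ //; exact: BA.
  - by move=> i hi; exfalso; lia.
have Np : N p.
  by case: n {wu} Nu Dun => [|n] Nu Dun; [case: nDp; rewrite -u0|rewrite -u0; exact: Nu].
have [v [m [mn [wv rv v0 vm vi]]]] := walk_reduce wu.
have Nv i : i < m -> N (v i).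
  case: i => [|i] hi; first by rewrite v0 u0.
  by have [|j hj ->] := vi i.+1; [lia|apply: Nu; lia].
have Av i : i <= m -> A (v i).
  rewrite leq_eqVlt => /orP[/eqP ->|/Nv[]//].
  by rewrite vm; exact/BA/DB.
exists (v m), (fun i => if i is i'.+1 then v i' else b), m.+1; split=> //.
- by split=> //; rewrite ?v0 ?vm.
- by move=> [_|i hi]; [rewrite v0 u0|exact: wv].
- move=> [hi|i hi]; last exact: rv.
  (* A walk returning to [b] at once would make [b] a non-branch vertex of the segment or its
     endpoint in [D]. *)
  move=> /= eb; have [h|h] := ltnP 1 m; first by case: (Nv _ h) => _; rewrite -eb => /(_ Bb).
  have e1 : m = 1 by lia.
  by apply: nDb; rewrite eb; move: vm Dun; rewrite e1 => ->.
- by move=> [_|i hi]; [exact: BA|exact: Av].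
- by move=> [//|i hi]; have [] := Nv i hi.
Qed.

(** Two different points of [D] on the two sides would be two contracted edges apart, against [sD];
    one and the same point would be joined to [b] by a unique reduced walk, whose first step is both
    [p] and [q]. *)
Lemma S_one b p q : B b -> ~ D b -> adj b p -> adj b q -> A p -> A q -> S p -> S q -> p = q.
Proof.
move=> Bb nDb bp bq Ap Aq Sp Sq.
have [x [u [n [[n0 u0 u1 un Dx] wu ru Au Bu]]]] := S_direct Bb nDb bp Ap Sp.
have [y [v [m [[m0 v0 v1 vm Dy] wv rv Av Bv]]]] := S_direct Bb nDb bq Aq Sq.
have [exy|nxy] := EM (x = y).
  have [||_ h] := reduced_walk_unique symadj fadj wu ru wv rv.
  - by rewrite u0.
  - by rewrite un vm.
  by rewrite -u1 -v1; apply: h.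
exfalso; apply: (sD Dx Dy nxy); apply/confP; apply: Or32; exists b.
  apply: hop_sym => //; apply/hopP; first exact: BA.
  by split; [exact: DB|exists u, n].
by apply/hopP; [exact: BA|split; [exact: DB|exists v, m]].
Qed.

Lemma A2_nonbranch x y : A2 x -> ~ B x -> adj x y -> A y -> A2 y.
Proof. by move=> [Ax nS] nB xy Ay; split=> // Sy; apply: nS; exact: S_adj Sy. Qed.

Lemma A2_two x : A2 x -> exists y z, [/\ y <> z, adj x y, adj x z, A2 y & A2 z].
Proof.
move=> A2x; have [Ax nSx] := A2x; have [Bx|nBx] := EM (B x); last first.
  have [_ /(_ x Ax)[y [z [yz xy xz Ay Az]]] _] := gA.
  by exists y, z; split=> //; [exact: A2_nonbranch xy _|exact: A2_nonbranch xz _].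
have nDx : ~ D x by move=> Dx; apply: nSx; exists 0.
have [_ hB dB] := Bx.
have a j : adj x (e j x) by apply: adj_e; have [] := hB j.
have Ae j : A (e j x) by have [] := hB j.
have one i j : i <> j -> ~ S (e i x) \/ ~ S (e j x).
  move=> ij; have [Si|] := EM (S (e i x)); last by left.
  by right=> Sj; apply: (dB i j ij); exact: (S_one Bx).
pose i0 : 'I_3 := ord0; pose i1 : 'I_3 := lift ord0 ord0; pose i2 : 'I_3 := ord_max.
have n01 : i0 <> i1 by move/(congr1 val).
have n02 : i0 <> i2 by move/(congr1 val).
have n12 : i1 <> i2 by move/(congr1 val).
have [S0|n0] := EM (S (e i0 x)).
  exists (e i1 x), (e i2 x); split=> //; first exact: dB.
    by split=> //; have [|] := one _ _ n01.
  by split=> //; have [|] := one _ _ n02.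
have [n1|n2] := one _ _ n12.
  by exists (e i0 x), (e i1 x); split=> //; exact: dB.
by exists (e i0 x), (e i2 x); split=> //; exact: dB.
Qed.

Lemma mS : mpred S.
Proof.
apply: mpred_ex => n; apply: mpred_rch => //; apply: mpred_and => //.
by apply: mpred_not; exact: mpred_branch.
Qed.

Lemma mA2 : mpred A2.
Proof. by apply: mpred_and => //; apply: mpred_not; exact: mS. Qed.

Lemma mA1 : mpred A1.
Proof.
apply: mpred_and; first exact: mA2.
by apply: mpred_ex => n; apply: mpred_rch; [exact: mA2|apply: mpred_branch; exact: mA2].
Qed.

Lemma A1_adj x y : A1 x -> adj x y -> A2 y -> A1 y.
Proof.
move=> [A2x [n rx]] xy A2y; split=> //; exists n.+1.
by apply: adj_rch rx => //; exact: symadj.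
Qed.

Lemma rch_sub n (P Q P' Q' : Y -> Prop) x : (forall y, P y -> P' y) -> (forall y, Q y -> Q' y) ->
  rch n P Q x -> rch n P' Q' x.
Proof.
by move=> hP hQ; elim: n x => [|n IH] x /=; [exact: hQ|
  move=> [/hP ? [j [? /IH ?]]]; split=> //; exists j].
Qed.

Lemma branch_A1 x : A1 x -> branch A2 x -> branch A1 x.
Proof.
move=> A1x [A2x h dx]; split=> // j; have [A2j ne] := h j; split=> //.
by apply: (A1_adj A1x) => //; exact: adj_e.
Qed.

Lemma good_A1 : good A1.
Proof.
split; first exact: mA1.
  move=> x A1x; have [A2x _] := A1x.
  have [y [z [yz xy xz Ay Az]]] := A2_two A2x.
  by exists y, z; split=> //; exact: (A1_adj A1x).
move=> x A1x; have [A2x [n rx]] := A1x; exists n.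
elim: n x rx A1x {A2x} => [|n IH] x /=; first by move=> bx ?; exact: branch_A1.
move=> [A2x [j [ne rj]]] A1x; split=> //; exists j; split=> //; apply: IH => //.
apply: (A1_adj A1x); first exact: adj_e.
by case: n rj => [|n] /= [].
Qed.

Lemma A1_sub x : A1 x -> A x. Proof. by case=> -[]. Qed.


(* [W] meets every component; it consists of points of [D] where nothing of [A1] is left, and
   then of a single one (lemma [exc_single]), from which everything can move away. *)
Let exc x := D x /\ ~ exists n, rch n A A1 x.
Let W x := A1 x \/ exc x.

Lemma WA x : W x -> A x.
Proof. by move=> [/A1_sub//|[/DB/BA]]. Qed.

Lemma rch_trans n P Q x : rch n P (fun y => exists m, rch m P Q y) x ->
  exists m, rch m P Q x.
Proof.
elim: n x => [//|n IH] x /= [Px [j [ne /IH[m rm]]]]; exists m.+1.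
by split=> //; exists j.
Qed.

Lemma rch_end n P Q x : rch n P Q x -> exists y, Q y /\ rch n P (eq y) x.
Proof.
elim: n x => [|n IH] x /=; first by exists x.
by move=> [Px [j [ne /IH[y [Qy ry]]]]]; exists y; split=> //; split=> //; exists j.
Qed.

Lemma rch_via n P Q x y : rch n P (eq y) x -> (exists m, rch m P Q y) -> exists m, rch m P Q x.
Proof. by move=> ry hy; apply: (@rch_trans n); apply: rch_sub ry => // _ <-. Qed.

(** Suppose a branch vertex [b] of [A] cannot reach [A1]. Then it is no branch vertex of [A2], so
    [b] or a neighbor was deleted, and the segment leads to a point of [D]. That point cannot reach
    [A1] either, hence is in [exc]. *)
Lemma reach_W x : A x -> exists n, rch n A W x.
Proof.
move=> Ax; have [_ _ /(_ x Ax)[n /rch_end[b [Bb rb]]]] := gA.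
have [[m rm]|h] := EM (exists m, rch m A A1 x).
  by exists m; apply: rch_sub rm => // y; left.
have hb : ~ exists m, rch m A A1 b by move=> /(rch_via rb).
have toD y m : rch m A (eq y) b -> S y -> exists k, rch k A W x.
  move=> ry [k rk].
  have [t [Dt rt]] := rch_end rk.
  have rt' : rch k A (eq t) y by apply: rch_sub rt => // z [].
  have Wt : W t.
    right; split=> // ht; apply: hb; apply: (rch_via ry); exact: (rch_via rt').
  apply: (rch_via rb); apply: (rch_via ry); apply: (rch_via rt').
  by exists 0.
apply: contrapT => nW; apply: hb; exists 0.
have Ab := BA Bb.
have A2b : A2 b by split=> // Sb; apply: nW; exact: (toD b 0).
split=> //; exists 0; have [_ hB dB] := Bb; split=> // j; have [Aj ne] := hB j.
split=> //; split=> // Sj; apply: nW; apply: (toD (e j b) 1) => //.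
by split=> //; exists j.
Qed.

Let lv n x := rch n A W x /\ forall m, m < n -> ~ rch m A W x.

Lemma lv_inj n m x : lv n x -> lv m x -> n = m.
Proof.
move=> [rn hn] [rm hm]; case: (ltngtP n m) => // h.
  by case: (hm n h).
by case: (hn m h).
Qed.

Lemma lv_ex x : A x -> exists n, lv n x.
Proof.
move=> /reach_W /ex_least[n [rn h]]; exists n; split=> // m mn rm.
by have := h m rm; rewrite leqNgt mn.
Qed.

Lemma lv_A n x : lv n x -> A x.
Proof. by case: n => [|n] [/=]; [move=> /WA|case]. Qed.

Let climb j x := e j x <> x /\ exists n, lv n x /\ lv n.+1 (e j x).

Let up := fix up k x : Prop := match k with
  | 0 => A x
  | k'.+1 => A x /\ exists j, climb j x /\ up k' (e j x)
  end.

Lemma up_le k m x : up m x -> k <= m -> up k x.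
Proof.
elim: m k x => [|m IH] [|k] x //=; first by move=> [].
by move=> [Ax [j [cj uj]]] km; split=> //; exists j; split=> //; exact: IH uj _.
Qed.

Let away x := forall k, up k x.

(** Compactness with three moves: a move that fails does so at some finite height, and [up] is
    decreasing in the height. *)
Lemma away_climb x : away x -> exists j, climb j x /\ away (e j x).
Proof.
move=> ax; apply: contrapT => /forallNP h.
have /choice[K hK] : forall j, exists k, ~ (climb j x /\ up k (e j x)).
  move=> j; apply: contrapT => /forallNP h'; apply: (h j); split=> [|k].
    by have /contrapT[] := h' 0.
  by have /contrapT[] := h' k.
have /= [_ [j [cj uj]]] := ax (\max_j K j).+1.
by apply: (hK j); split=> //; apply: up_le uj _; exact: leq_bigmax.
Qed.

Lemma walk_rch u n P : walk adj u n -> (forall i, i <= n -> P (u i)) -> rch n P (eq (u n)) (u 0).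
Proof. by move=> wu Pu; apply/rchP; exists u; split=> // i hi; apply: Pu; exact: ltnW. Qed.

Lemma walk_rch_rev u n P : walk adj u n -> (forall i, i <= n -> P (u i)) -> rch n P (eq (u 0)) (u n).
Proof.
move=> wu Pu; apply/rchP; exists (fun i => u (n - i)); rewrite subn0 subnn; split=> // i hi.
  have -> : n - i = (n - i.+1).+1 by lia.
  by apply/symadj/wu; lia.
by apply: Pu; lia.
Qed.

Lemma direct_sub u n i k : walk adj u n -> reduced u n -> (forall l, l <= n -> A (u l)) ->
  i < k <= n -> (forall l, i < l < k -> ~ B (u l)) -> direct (u i) (u k).
Proof.
move=> wu ru Au hik Bu; exists (fun l => u (i + l)), (k - i); split; split.
- by lia.
- by rewrite addn0.
- by congr u; lia.
- by move=> l hl; rewrite addnS; apply: wu; lia.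
- by move=> l hl; rewrite !addnS; apply: ru; lia.
- by move=> l hl; apply: Au; lia.
- by move=> l hl; apply: Bu; lia.
Qed.

(** On a shortest walk from [x] to another point of [D], sparseness provides two branch vertices
    strictly inside. The second, [w i2], is too far from [D] to lose a side, so it is in [A1] and
    reachable from [x], against [exc x]. *)
Lemma exc_single x y u n : exc x -> D y -> walk adj u n -> (forall i, i <= n -> A (u i)) ->
  u 0 = x -> u n = y -> x = y.
Proof.
move=> [Dx nx] Dy wu0 Au0 u00 u0n; apply: contrapT => nxy.
have [m [[v [z [wv Av v0 vm [Dz nz]]]] minm]] : exists m,
   (exists v z, [/\ walk adj v m, forall i, i <= m -> A (v i), v 0 = x, v m = z & D z /\ x <> z])
   /\ forall k, (exists v z, [/\ walk adj v k, forall i, i <= k -> A (v i), v 0 = x, v k = z &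
      D z /\ x <> z]) -> m <= k.
  by apply: ex_least; exists n, u, y.
have {wv} [w [k [km [ww rw w0 wk wi]]]] := walk_reduce wv.
have Aw i : i <= k -> A (w i).
  rewrite leq_eqVlt => /orP[/eqP ->|hi]; first by rewrite wk; exact: Av.
  case: i hi => [|i] hi; first by rewrite w0; exact: Av.
  by have [|j hj ->] := wi i.+1; [lia|apply: Av; lia].
have k0 : 0 < k by case: k wk {km ww rw wi Aw} => [|//] wk; case: nz; rewrite -v0 -vm -wk w0.
have mk : m <= k by apply: minm; exists w, z; split=> //; congruence.
have nD i : 0 < i < k -> ~ D (w i).
  move=> hi Di; have : m <= i; last lia.
  apply: minm; exists w, (w i); split=> //.
  - by move=> l hl; apply: ww; lia.
  - by move=> l hl; apply: Aw; lia.
  - by rewrite w0.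
  split=> // h; have := reduced_walk_inj (i := 0) (j := i) fadj ww rw.
  by rewrite w0 v0 => h'; have := h' isT ltac:(lia) h; lia.
have Bx := DB Dx; have Bz := DB Dz.
have w0x : w 0 = x by rewrite w0.
have wkz : w k = z by rewrite wk vm.
have nconf : ~ conf x z by apply: sD.
have [|i1 [[hi1 Bi1] min1]] := @ex_least (fun i => 0 < i < k /\ B (w i)).
  apply: contrapT => /forallNP h; apply: nconf; apply/confP; apply: Or31.
  apply/hopP; first exact: BA.
  split=> //; rewrite -w0x -wkz; apply: (direct_sub ww rw Aw); first lia.
  by move=> l hl Bl; apply: (h l).
have h01 : hop x (w i1).
  apply/hopP; first exact: BA.
  split=> //; rewrite -w0x; apply: (direct_sub ww rw Aw); first lia.
  move=> l hl Bl; have : i1 <= l by apply: min1; split=> //; lia.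
  by lia.
have [|i2 [[hi2 Bi2] min2]] := @ex_least (fun i => i1 < i < k /\ B (w i)).
  apply: contrapT => /forallNP h; apply: nconf; apply/confP; apply: Or32.
  exists (w i1) => //; apply/hopP; first exact: BA.
  split=> //; rewrite -wkz; apply: (direct_sub ww rw Aw); first lia.
  by move=> l hl Bl; apply: (h l).
have h12 : hop (w i1) (w i2).
  apply/hopP; first exact: BA.
  split=> //; apply: (direct_sub ww rw Aw); first lia.
  move=> l hl Bl; have : i2 <= l by apply: min2; split=> //; lia.
  by lia.
have nD2 : ~ D (w i2) by apply: nD; lia.
(* A point [t] of [D] one contracted edge from [w i2] is at most three from [x], hence is [x]. But
   the reduced walk from [w i2] to [x] passes the branch vertex [w i1]. *)
have nSj p : adj (w i2) p -> A p -> ~ S p.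
  move=> ap Ap Sp.
  have [t [q [l [[l0 q0 q1 ql Dt] wq rq Aq Bq]]]] := S_direct Bi2 nD2 ap Ap Sp.
  have h2t : hop (w i2) t.
    apply/hopP; first exact: BA.
    by split; [exact: DB|exists q, l].
  have ext : x = t.
    apply: contrapT => nxt; apply: (sD Dx Dt nxt); apply/confP; apply: Or33.
    by exists (w i1), (w i2).
  pose r i := w (i2 - i).
  have [||||e1 e2] := @reduced_walk_unique _ adj symadj q r l i2 fadj wq rq.
  - move=> i hi; rewrite /r; have -> : i2 - i = (i2 - i.+1).+1 by lia.
    by apply/symadj/ww; lia.
  - move=> i hi; rewrite /r; have -> : i2 - i = (i2 - i.+2).+2 by lia.
    by apply/nesym/rw; lia.
  - by rewrite q0 /r subn0.
  - by rewrite ql -ext /r subnn.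
  apply: (Bq (i2 - i1)); first lia.
  by rewrite e2 /r; [rewrite subKn //; lia|lia].
have A2h : A2 (w i2).
  split; first exact: BA.
  by move=> [[|q] /= hq]; [apply: nD2|case: hq => -[]].
apply: nx; exists i2; apply/rchP; exists w; split=> //.
- by move=> l hl; apply: ww; lia.
- by move=> l hl; apply: Aw; lia.
split=> //; exists 0; have [_ hB dB] := Bi2; split=> // j; have [Aj ne] := hB j.
by split=> //; split=> //; apply: nSj => //; exact: adj_e.
Qed.

(** In this component [x] is the only point of [W], so the level is the distance to [x], that is,
    the length of the reduced walk. *)
Lemma exc_lv x u n : exc x -> u 0 = x -> walk adj u n -> reduced u n ->
  (forall i, i <= n -> A (u i)) -> lv n (u n).
Proof.
move=> ex u0 wu ru Au; split.
  by apply: rch_sub (walk_rch_rev wu Au) => // _ <-; rewrite u0; right.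
move=> m mn /rchP[v [v0 wv Av Wv]].
have Av' i : i <= m -> A (v i).
  by rewrite leq_eqVlt => /orP[/eqP ->|/Av//]; exact: WA.
pose w i := if i <= n then u i else v (i - n).
have ww : walk adj w (n + m).
  move=> i hi; rewrite /w; case: (leqP i n) => h1; case: (leqP i.+1 n) => h2; try lia.
  - by apply: wu.
  - have ? : i = n by lia.
    by subst i; rewrite -v0 subSnn; apply: wv; lia.
  - rewrite subSn; last exact: ltnW.
    by apply: wv; lia.
have Aw i : i <= n + m -> A (w i).
  by move=> hi; rewrite /w; case: leqP => h; [exact: Au|apply: Av'; lia].
have wx : w 0 = x by rewrite /w.
have wv' : w (n + m) = v m.
  rewrite /w; case: leqP => h; last by congr v; lia.
  have m0 : m = 0 by lia.
  by rewrite m0 addn0 v0.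
have r : rch (n + m) A (eq (v m)) x by rewrite -wx -wv'; exact: walk_rch.
case: Wv => [A1v|[Dv _]].
  by case: ex => _; apply; exists (n + m); apply: rch_sub r => // _ <-.
have ev := exc_single ex Dv ww Aw wx wv'.
have [k_v [k [km [wk rk k0 kk _]]]] := walk_reduce wv.
pose u' i := u (n - i).
have [||||e1 _] := @reduced_walk_unique _ adj symadj k_v u' k n fadj wk rk.
- move=> i hi; rewrite /u'; have -> : n - i = (n - i.+1).+1 by lia.
  by apply/symadj/wu; lia.
- move=> i hi; rewrite /u'; have -> : n - i = (n - i.+2).+2 by lia.
  by apply/nesym/ru; lia.
- by rewrite k0 v0 /u' subn0.
- by rewrite kk -ev /u' subnn.
by lia.
Qed.

(** Degrees in [A] are at least 2, so a reduced walk from [x] extends forever, and it climbs at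
    every step. *)
Lemma exc_away x : exc x -> away x.
Proof.
move=> ex.
suff H k u n : u 0 = x -> walk adj u n -> reduced u n ->
    (forall i, i <= n -> A (u i)) -> up k (u n).
  have Ax : A x by apply: WA; right.
  by move=> k; apply: (H k (fun=> x) 0).
elim: k u n => [|k IH] u n u0 wu ru Au; first exact: Au.
have Aun := Au _ (leqnn n); split=> //.
have [p [ap Ap np]] : exists p, [/\ adj (u n) p, A p & 0 < n -> p <> u n.-1].
  have [_ /(_ _ Aun)[y [z [yz xy xz Ay Az]]] _] := gA.
  have [ey|ny] := EM (y = u n.-1); last by exists y.
  by exists z; split=> // _ ez; apply: yz; rewrite ez.
pose w i := if i <= n then u i else p.
have wn : w n.+1 = p by rewrite /w ltnn.
have ww : walk adj w n.+1.
  move=> i hi; rewrite /w -ltnS hi; case: (ltnP i n) => h; first exact: wu.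
  by have -> : i = n by lia.
have rw : reduced w n.+1.
  move=> i hi; rewrite /w; case: (leqP i n) => h1; case: (leqP i.+2 n) => h2; try lia.
    exact: ru.
  have -> : i = n.-1 by lia.
  by apply/nesym/np; lia.
have Aw i : i <= n.+1 -> A (w i) by move=> _; rewrite /w; case: leqP => // /Au.
have := IH w n.+1 u0 ww rw Aw; rewrite wn => upp.
have [ne [j ej]] := ap; exists j; rewrite /climb ej; split=> //; split; first exact: nesym.
exists n; split; first exact: (exc_lv ex).
by rewrite -wn; apply: (exc_lv ex).
Qed.

Let descend j x := e j x <> x /\ exists n, lv n.+1 x /\ lv n (e j x).
Let flow j x := (away x /\ (climb j x /\ away (e j x))) \/ (~ away x /\ descend j x).

Lemma flow_ex x : A x -> ~ A1 x -> exists j, flow j x.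
Proof.
move=> Ax nA1; have [ax|nax] := EM (away x).
  by have [j [? ?]] := away_climb ax; exists j; left.
have [[|n] [rn mn]] := lv_ex Ax.
  (* Level 0 outside [A1] is exceptional and can move away; every other vertex that cannot move away
     has a lower level to go to. *)
  by case: rn => [//|/exc_away].
have [_ [j [ne rj]]] := rn; exists j; right; split=> //; split=> //; exists n; split=> //.
split=> // m mn' rm; apply: (mn m.+1) => //; split=> //; by exists j.
Qed.

Lemma flow_A j x : flow j x -> e j x <> x /\ A (e j x).
Proof. by case=> [[_ [[ne _] /(_ 0)]]|[_ [ne [n [_ /lv_A]]]]]. Qed.

Lemma mpred_W : mpred W.
Proof.
have h := mA1; apply: mpred_or => //; apply: mpred_and => //; apply: mpred_not.
by apply: mpred_ex => n; apply: mpred_rch.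
Qed.

Lemma mpred_lv n : mpred (lv n).
Proof.
have h := mpred_W; apply: mpred_and; first exact: mpred_rch.
apply: mpred_all => m; apply: mpred_imp; first exact: mpred_const.
by apply: mpred_not; exact: mpred_rch.
Qed.

Lemma mpred_climb j : mpred (climb j).
Proof.
apply: mpred_and; first exact: mpred_move.
apply: mpred_ex => n; apply: mpred_and; first exact: mpred_lv.
by apply: (me j); exact: mpred_lv.
Qed.

Lemma mpred_away : mpred away.
Proof.
apply: mpred_all; elim=> [//|k IH] /=.
apply: mpred_and => //; apply: mpred_ex => j; apply: mpred_and; first exact: mpred_climb.
exact: (me j).
Qed.

Lemma mpred_flow j : mpred (flow j).
Proof.
have h := mpred_away.
apply: mpred_or; apply: mpred_and => //.
- apply: mpred_and; first exact: mpred_climb.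
  exact: (me j h).
- exact: mpred_not.
apply: mpred_and; first exact: mpred_move.
apply: mpred_ex => n; apply: mpred_and; first exact: mpred_lv.
by apply: (me j); exact: mpred_lv.
Qed.

(** The map is given by the index of the move, so that its measurability concerns a function with
    three values. *)
Definition onto A' (J : Y -> 'I_3) := [/\ forall j, mpred (fun x => J x = j),
  forall x, A x -> ~ A' x -> e (J x) x <> x /\ A (e (J x) x) &
  ~ exists u, forall i, (A (u i.+1) /\ ~ A' (u i.+1)) /\ e (J (u i.+1)) (u i.+1) = u i].

(** On a backward orbit of vertices moving away the levels decrease. If one vertex cannot move away,
    neither can its iterated preimages, so they descend to it; read in reverse they form an infinite
    climb from it, a contradiction. *)
Lemma removal_onto : exists J, onto A1 J.
Proof.
have [J [mJ JP]] := mselect ord0 mpred_flow; exists J; split=> //.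
  by move=> x Ax nA1; apply: flow_A; apply: JP; exact: flow_ex.
move=> [u hu].
have fl i : flow (J (u i.+1)) (u i.+1).
  by apply: JP; have [[? ?] _] := hu i; exact: flow_ex.
have [n0 l0] : exists n, lv n (u 1) by apply: lv_ex; have [[]] := hu 0.
have [aall|] := EM (forall i, away (u i.+1)).
  have lvi i : i <= n0 -> lv (n0 - i) (u i.+1).
    elim: i => [|i IH] hi; first by rewrite subn0.
    have [[_ [[_ [n [ln ln1]]] _]]|[]] := fl i.+1; last by case.
    have [_ eu] := hu i.+1; rewrite eu in ln1.
    have := lv_inj (IH (ltnW hi)) ln1 => en.
    by have -> : n0 - i.+1 = n by lia.
  have := lvi n0 (leqnn _); rewrite subnn => l00.
  have [[_ [[_ [n [ln ln1]]] _]]|[]] := fl n0.+1; last by case.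
  have [_ eu] := hu n0.+1; rewrite eu in ln1.
  by have := lv_inj l00 ln1.
move=> /existsNP[i0 nai].
have nall k : ~ away (u (i0 + k).+1).
  elim: k => [|k IH]; first by rewrite addn0.
  move=> aw; have [[_ [_ aw']]|[]] := fl (i0 + k.+1); last by move=> /(_ aw).
  by apply: IH; move: aw'; have [_ ->] := hu (i0 + k.+1); rewrite addnS.
apply: nai => k.
suff H i : up k (u (i0 + i).+1) by have := H 0; rewrite addn0.
elim: k i => [|k IH] i; first by have [[]] := hu (i0 + i).
have [[Au _] _] := hu (i0 + i); split=> //.
have [[aw _]|[_ [ne [n [l1 l2]]]]] := fl (i0 + i).+1.
  by case: (nall i.+1); rewrite addnS.
have [_ eu] := hu (i0 + i).+1; rewrite eu in ne l2.
have [_ [j ej]] : adj (u (i0 + i).+1) (u (i0 + i).+2).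
  by apply: symadj; rewrite -eu; apply: adj_e; rewrite eu.
exists j; rewrite /climb ej; split.
  by split; [exact: nesym|exists n].
by have := IH i.+1; rewrite addnS.
Qed.

Lemma removal_cover x : A x -> (exists n, rch n N D x) -> ~ A1 x.
Proof. by move=> Ax Sx [[_ nS] _]. Qed.

End Removal.




Lemma good_removal : good A -> exists (A' : 'I_rounds -> Y -> Prop) (J : 'I_rounds -> Y -> 'I_3),
  (forall i, [/\ good (A' i), forall x, A' i x -> A x & onto (A' i) (J i)]) /\
  forall x, A x -> exists i, ~ A' i x.
Proof.
move=> gA; have [D [hD covD]] := sparse_cover.
pose A2 i x := A x /\ ~ exists n, rch n (fun x => A x /\ ~ B x) (D i) x.
pose A1 i x := A2 i x /\ exists n, rch n (A2 i) (branch (A2 i)) x.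
have /choice[J hJ] : forall i, exists J, onto (A1 i) J.
  by move=> i; have [mD DB sD] := hD i; exact: removal_onto.
exists A1, J; split=> [i|x Ax].
  have [mD DB sD] := hD i; split=> //; first exact: good_A1.
  by move=> x [[]].
(* A nearest branch vertex: by minimality no earlier vertex of the walk is one, so [x] is on a
   segment attached to it and is deleted with it. *)
have [_ _ /(_ x Ax) /ex_least[n [/rchP[u [u0 wu Au Bu]] minn]]] := gA.
have [i Di] := covD _ Bu; exists i; apply: removal_cover => //.
exists n; apply/rchP; exists u; split=> // k kn; split; first exact: Au.
move=> Bk; have : n <= k; last by rewrite leqNgt kn.
by apply: minn; apply/rchP; exists u; split=> // l hl; [apply: wu|apply: Au]; lia.
Qed.

End Hops.
End CubicForest.

(** * Injective codes and Novikov separation *)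

Record polish_metric (R : realType) (Z : Type) (dist : Z -> Z -> R) (q : nat -> Z) : Prop := PolishMetric {
  dist_ge0 : forall x y, (0 <= dist x y)%R;
  dist_xx : forall x, dist x x = 0%R;
  dist_eq0 : forall x y, dist x y = 0%R -> x = y;
  dist_sym : forall x y, dist x y = dist y x;
  dist_triangle : forall x y z, (dist x z <= dist x y + dist y z)%R;
  dist_complete : forall u : nat -> Z,
    (forall e, (0 < e)%R -> exists N, forall m n, N <= m -> N <= n -> (dist (u m) (u n) < e)%R) ->
    exists z, forall e, (0 < e)%R -> exists N, forall n, N <= n -> (dist z (u n) < e)%R;
  dist_dense : forall z e, (0 < e)%R -> exists j, (dist z (q j) < e)%R }.

Definition agree n (f g : nat -> nat) := forall i, i < n -> f i = g i.

Section RealCode.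
Context {R : realType}.
Local Open Scope ring_scope.
Implicit Types (a : R) (t : rat) (c : nat).

Definition below t c : rat := t - c.+1%:R^-1.

Lemma below_lt t c : (ratr (below t c) : R) < ratr t.
Proof. by rewrite ltr_rat /below ltrBlDr ltrDl invr_gt0. Qed.

(* The code [c.+1] of [a < t] says that [c] is least with [a < t - 1/(c+1)]; that
   strict bound is itself recorded by the code of [a] relative to [t - 1/(c+1)],
   so codes pass to limits. *)
Definition rcode a t c : Prop := match c with
  | 0%N => ratr t <= a
  | c.+1 => a < ratr (below t c) /\ forall l, (l < c)%N -> ratr (below t l) <= a
  end.

Lemma rcode_ex a t : exists c, rcode a t c.
Proof.
have [h|h] := leP (ratr t) a; first by exists 0%N.
have [|m [hm minm]] := @ex_least (fun m => a < ratr (below t m)).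
  have h0 : 0 < ratr t - a by rewrite subr_gt0.
  exists (Num.truncn (ratr t - a)^-1); rewrite /below rmorphB /= fmorphV /= ratr_nat.
  rewrite ltrBrDr -ltrBrDl invf_plt ?posrE//.
  by have /andP[] := Num.Theory.truncn_itv (ltW (etrans (invr_gt0 _) h0)).
exists m.+1; split=> // l lm; rewrite leNgt; apply/negP => /minm; rewrite leqNgt lm.
by [].
Qed.

Lemma rcode_uniq a t c c' : rcode a t c -> rcode a t c' -> c = c'.
Proof.
case: c c' => [|c] [|c'] //= h h'.
- by have [h1 _] := h'; have := lt_trans h1 (below_lt t c'); rewrite ltNge h.
- by have [h1 _] := h; have := lt_trans h1 (below_lt t c); rewrite ltNge h'.
have [h1 h2] := h; have [h1' h2'] := h'; congr S.
case: (ltngtP c c') => // k.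
- by have := h2' _ k; rewrite leNgt h1.
- by have := h2 _ k; rewrite leNgt h1'.
Qed.

Lemma rcode_lim (u : nat -> R) a (f : rat -> nat) :
  (forall e, 0 < e -> exists N, forall n, (N <= n)%N -> `|a - u n| < e) ->
  (forall t, exists N, forall n, (N <= n)%N -> rcode (u n) t (f t)) ->
  forall t, rcode a t (f t).
Proof.
move=> lim cf.
have ge t : f t = 0%N -> ratr t <= a.
  move=> ft; rewrite leNgt; apply/negP => lt.
  have [|N hN] := lim (ratr t - a); first by rewrite subr_gt0.
  have [M hM] := cf t; have := hM (maxn N M) (leq_maxr _ _); rewrite ft /= => h1.
  have := hN (maxn N M) (leq_maxl _ _); rewrite ltr_norml; lra.
have lt' t c : f t = c.+1 -> a <= ratr (below t c).
  move=> ft; rewrite leNgt; apply/negP => lt.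
  have [|N hN] := lim (a - ratr (below t c)); first by rewrite subr_gt0.
  have [M hM] := cf t; have := hM (maxn N M) (leq_maxr _ _); rewrite ft /= => -[h1 _].
  have := hN (maxn N M) (leq_maxl _ _); rewrite ltr_norml; lra.
move=> t; case ft: (f t) => [|c] /=; first exact: ge.
have [M hM] := cf t.
split.
  (* The limit only gives [a <= below t c]. The code at [below t c] cannot be 0, so the same bound
     applied there is smaller and restores strictness. *)
  have [M' hM'] := cf (below t c).
  case fb: (f (below t c)) => [|c'].
    have := hM (maxn M M') (leq_maxl _ _); rewrite ft /= => -[h1 _].
    by have := hM' (maxn M M') (leq_maxr _ _); rewrite fb /= leNgt h1.
  exact: le_lt_trans (lt' _ _ fb) (below_lt _ _).
move=> l lc; apply: ge; have [M' hM'] := cf (below t l).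
have := hM (maxn M M') (leq_maxl _ _); rewrite ft /= => -[_ /(_ l lc) h1].
have := hM' (maxn M M') (leq_maxr _ _); case: (f _) => [|c'] //= [h2 _].
by have := lt_trans h2 (below_lt _ _); rewrite ltNge h1.
Qed.

End RealCode.

Section Coding.
Context {R : realType} {Z : Type} (dist : Z -> Z -> R) (q : nat -> Z).
Hypothesis pm : polish_metric dist q.

(* [h] is injective on [A], and its inverse is continuous on its range, which is closed in
   Baire space. *)
Definition coded_by (h : Z -> nat -> nat) (A : Z -> Prop) := forall f : nat -> nat,
  (forall n, exists z, A z /\ agree n (h z) f) -> exists z, [/\ A z, forall i, h z i = f i &
    forall e, (0 < e)%R -> exists n, forall w, A w -> agree n (h w) f -> (dist z w < e)%R].

Definition coded A := exists h, coded_by h A.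

Lemma near_uniq x y : (forall e, (0 < e)%R -> exists z, (dist x z < e)%R /\ (dist y z < e)%R) -> x = y.
Proof.
move=> h; apply: (dist_eq0 pm); apply/eqP; rewrite eq_le (dist_ge0 pm) andbT.
rewrite leNgt; apply/negP => d0; have [|z [h1 h2]] := h (dist x y / 2)%R; first lra.
by have := dist_triangle pm x z y; rewrite (dist_sym pm z y); lra.
Qed.

Lemma agreeW n m f g : n <= m -> agree m f g -> agree n f g.
Proof. by move=> nm h i hi; apply: h; apply: leq_trans nm. Qed.

Definition tol n : rat := (n.+1%:R^-1)%R.

(** The coordinates [inr n] name the first dense point within [tol n], so close codes mean close
    points. The coordinates [inl (j, t)] compare the distance to [q j] with [t] and make the [inr]
    coordinates stable under limits of codes. *)
Definition bcode z (i : nat) c : Prop := match pickle_inv i : option ((nat * rat) + nat) with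
  | Some (inl jt) => rcode (dist z (q jt.1)) jt.2 c
  | Some (inr n) => (dist z (q c) < ratr (tol n))%R /\
      forall l, l < c -> (ratr (tol n) <= dist z (q l))%R
  | None => c = 0
  end.

Lemma bcode_ex z i : exists c, bcode z i c.
Proof.
rewrite /bcode; case: pickle_inv => [[jt|n]|]; [exact: rcode_ex| |by exists 0].
have [|c [h1 h2]] := @ex_least (fun c => (dist z (q c) < ratr (tol n))%R).
  by apply: (dist_dense pm); rewrite ltr0q invr_gt0.
by exists c; split=> // l lc; rewrite leNgt; apply/negP => /h2; rewrite leqNgt lc.
Qed.

Lemma bcode_uniq z i c c' : bcode z i c -> bcode z i c' -> c = c'.
Proof.
rewrite /bcode; case: pickle_inv => [[jt|n]|]; [exact: rcode_uniq| |by move=> -> ->].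
move=> [h1 h2] [h1' h2']; case: (ltngtP c c') => // k.
- by have := h2' _ k; rewrite leNgt h1.
- by have := h2 _ k; rewrite leNgt h1'.
Qed.

Lemma tol_lt (e : R) : (0 < e)%R -> exists n, (ratr (tol n) < e)%R.
Proof.
move=> e0; exists (Num.truncn e^-1); rewrite /tol fmorphV /= ratr_nat.
rewrite invf_plt ?posrE//.
have /andP[] := Num.Theory.truncn_itv (ltW (etrans (invr_gt0 _) e0)) => //.
Qed.

Lemma base_code : exists h : Z -> nat -> nat, forall z i, bcode z i (h z i).
Proof.
have /choice[h hh] : forall zi : Z * nat, exists c, bcode zi.1 zi.2 c.
  by move=> [z i]; exact: bcode_ex.
by exists (fun z i => h (z, i)) => z i; exact: (hh (z, i)).
Qed.

Section Base.
Variable h0 : Z -> nat -> nat.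
Hypothesis bh0 : forall z i, bcode z i (h0 z i).

Lemma h0_close e : (0 < e)%R -> exists n, forall z w, agree n (h0 z) (h0 w) -> (dist z w < e)%R.
Proof.
move=> e0; have [|m hm] := @tol_lt (e / 2)%R; first lra.
exists (pickle (inr m : (nat * rat) + nat)).+1 => z w /(_ _ (ltnSn _)) ezw.
have := bh0 z (pickle (inr m : (nat * rat) + nat)).
have := bh0 w (pickle (inr m : (nat * rat) + nat)).
rewrite /bcode pickleK_inv ezw => -[h1 _] [h2 _].
have := dist_triangle pm z (q (h0 w (pickle (inr m : (nat * rat) + nat)))) w.
by rewrite (dist_sym pm (q _) w); lra.
Qed.

(** Closed in the finer topology pulled back from Baire space along [h0]. *)
Definition hclosed (A : Z -> Prop) := forall z, (forall n, exists w, A w /\ agree n (h0 w) (h0 z)) -> A z.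

Lemma coded_hclosed A : hclosed A -> coded_by h0 A.
Proof.
move=> hA f /choice[w hw].
have wf n m : n <= m -> agree n (h0 (w m)) f by move=> nm; apply: agreeW nm _; have [] := hw m.
have [z lim] : exists z, forall e, (0 < e)%R -> exists N, forall n, N <= n -> (dist z (w n) < e)%R.
  apply: (dist_complete pm) => e e0; have [N hN] := h0_close e0.
  by exists N => m n hm hn; apply: hN => i iN; rewrite (wf N m)// (wf N n).
have zf i : h0 z i = f i.
  suff : bcode z i (f i) by apply: bcode_uniq.
  have wi n : i < n -> bcode (w n) i (f i).
    by move=> ni; rewrite -(wf n n (leqnn n) i ni).
  have rz (jt : nat * rat) : rcode (dist z (q jt.1)) jt.2 (f (pickle (inl jt : (nat * rat) + nat))).
    case: jt => j t /=.
    apply: (@rcode_lim _ (fun n => dist (w n) (q j)) _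
        (fun t => f (pickle (inl (j, t) : (nat * rat) + nat)))) => [e e0|t'].
      have [N hN] := lim e e0; exists N => n nN; have := hN n nN; rewrite ltr_norml.
      have := dist_triangle pm z (w n) (q j); have := dist_triangle pm (w n) z (q j).
      by rewrite (dist_sym pm (w n) z); lra.
    exists (pickle (inl (j, t') : (nat * rat) + nat)).+1 => n hn.
    have := bh0 (w n) (pickle (inl (j, t') : (nat * rat) + nat)).
    by rewrite /bcode pickleK_inv (wf n n).
  case ui: (pickle_inv i : option ((nat * rat) + nat)) => [[jt|n]|]; rewrite /bcode ui.
  - by have := rz jt; have := @pickle_invK ((nat * rat) + nat)%type i; rewrite ui /= => ->.
  (* Whether [q j] is within [tol n] is told by whether the coordinate [I j] is nonzero, both for
     [z] and for late [w m]. *)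
  - have near j := rz (j, tol n).
    pose I j := pickle (inl (j, tol n) : (nat * rat) + nat).
    have key j : (dist z (q j) < ratr (tol n))%R <-> f (I j) <> 0.
      have /= := near j; rewrite -/(I j); case: (f (I j)) => [|c] /=.
        by rewrite leNgt => /negP; split.
      by move=> [hz _]; split=> // _; exact: lt_trans hz (below_lt _ _).
    have keyw j : exists2 m, i < m & ((dist (w m) (q j) < ratr (tol n))%R <-> f (I j) <> 0).
      exists (maxn i.+1 (I j).+1); first exact: leq_maxl.
      have := bh0 (w (maxn i.+1 (I j).+1)) (I j); rewrite /bcode pickleK_inv /=.
      rewrite (wf _ _ (leqnn _)) ?leq_maxr//; case: (f (I j)) => [|c] /=.
        by rewrite leNgt => /negP; split.
      by move=> [hz _]; split=> // _; exact: lt_trans hz (below_lt _ _).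
    split.
      have [m im km] := keyw (f i); apply/key/km.
      by have := wi m im; rewrite /bcode ui => -[].
    move=> l lf; rewrite leNgt; apply/negP => /key hl.
    have [m im km] := keyw l; have := wi m im; rewrite /bcode ui => -[_ /(_ l lf)].
    by rewrite leNgt => /negP; apply; apply/km.
  - by have := wi i.+1 (ltnSn i); rewrite /bcode ui.
exists z; split=> //.
  apply: hA => n; exists (w n); split; first by have [] := hw n.
  by move=> i hi; rewrite (wf n n).
move=> e e0; have [n hn] := h0_close e0; exists n => v _ hv; apply: hn => i hi.
by rewrite zf hv.
Qed.

Definition bball k z : Prop := match pickle_inv k : option (nat * rat) with
  | Some jt => (dist z (q jt.1) < ratr jt.2)%R
  | None => False
  end.

Lemma bball_dec k : exists n, forall z w, agree n (h0 z) (h0 w) -> bball k z -> bball k w.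
Proof.
rewrite /bball; case: pickle_inv => [jt|]; last by exists 0.
exists (pickle (inl jt : (nat * rat) + nat)).+1 => z w /(_ _ (ltnSn _)) e.
have := bh0 z (pickle (inl jt : (nat * rat) + nat)).
have := bh0 w (pickle (inl jt : (nat * rat) + nat)).
rewrite /bcode pickleK_inv e; case: (h0 w _) => [|c] /=; first by move=> _; rewrite leNgt => /negP.
by move=> [hw _] _ _; exact: lt_trans hw (below_lt _ _).
Qed.

End Base.

Definition mopen (U : Z -> Prop) := forall z, U z -> exists2 e, (0 < e)%R & forall w, (dist z w < e)%R -> U w.

Lemma coded_closed U : mopen U -> coded (fun z => ~ U z).
Proof.
have [h0 bh0] := base_code; move=> oU; exists h0; apply: coded_hclosed => // z hz Uz.
have [e e0 he] := oU z Uz; have [n hn] := h0_close bh0 e0.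
have [w [nU hw]] := hz n; apply/nU/he/hn => i hi; by rewrite hw.
Qed.

(** The codes are interleaved. The limits obtained for the separate sets coincide because one and
    the same [w] approximates any two of them. *)
Lemma coded_cap (A : nat -> Z -> Prop) : (forall n, coded (A n)) -> coded (fun z => forall n, A n z).
Proof.
move=> /choice[h hA].
pose g z (i : nat) : nat := if pickle_inv i is Some nm then h (nm : nat * nat).1 z nm.2 else 0.
exists g => f fa.
pose F (n m : nat) := f (pickle (n, m)).
have ga n N : exists M, forall z, agree M (g z) f -> agree N (h n z) (F n).
  exists (\max_(m < N) pickle (n, val m)).+1 => z zf m mN.
  have := zf (pickle (n, m)); rewrite ltnS (@leq_bigmax _ (fun m : 'I_N => pickle (n, val m)) (Ordinal mN))//.
  by rewrite /g pickleK_inv /= => /(_ isT).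
have /choice[z hz] : forall n, exists z, [/\ A n z, forall i, h n z i = F n i & forall e, (0 < e)%R ->
    exists N, forall w, A n w -> agree N (h n w) (F n) -> (dist z w < e)%R].
  move=> n; apply: (hA n) => N; have [M hM] := ga n N; have [w [Aw wf]] := fa M.
  by exists w; split=> //; exact: hM.
have ez n : z n = z 0.
  apply: near_uniq => e e0.
  have [_ _ /(_ e e0)[N1 h1]] := hz n; have [_ _ /(_ e e0)[N2 h2]] := hz 0.
  have [M1 g1] := ga n N1; have [M2 g2] := ga 0 N2.
  have [w [Aw wf]] := fa (maxn M1 M2); exists w; split.
    by apply: h1 => //; apply: g1; apply: agreeW wf; exact: leq_maxl.
  by apply: h2 => //; apply: g2; apply: agreeW wf; exact: leq_maxr.
exists (z 0); split.
- by move=> n; rewrite -(ez n); have [] := hz n.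
- move=> i; rewrite /g; case ui: (pickle_inv i : option (nat * nat)) => [[n m]|] /=.
    rewrite -(ez n); have [_ -> _] := hz n; rewrite /F.
    by congr f; have := @pickle_invK (nat * nat)%type i; rewrite ui.
  have [w [_ /(_ i (ltnSn i))]] := fa i.+1; by rewrite /g ui.
- move=> e e0; have [_ _ /(_ e e0)[N hN]] := hz 0; have [M hM] := ga 0 N.
  by exists M => w Aw wf; apply: hN => //; exact: hM.
Qed.


Lemma coded_ext A B : (forall z, A z <-> B z) -> coded A -> coded B.
Proof. by move=> h; have -> : A = B by apply/funext => z; apply/propext. Qed.

(** The code starts with the index of the piece, which disjointness lets one read off from the
    point. *)
Lemma coded_dcup (A : nat -> Z -> Prop) : (forall n, coded (A n)) ->
  (forall n m z, A n z -> A m z -> n = m) -> coded (fun z => exists n, A n z).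
Proof.
move=> /choice[h hA] dA.
have /choice[idx hidx] : forall z, exists n, (exists n, A n z) -> A n z.
  by move=> z; have [[n An]|h'] := EM (exists n, A n z); [exists n|exists 0].
exists (fun z i => if i is i'.+1 then h (idx z) z i' else idx z) => f fa.
have key n w : (exists n, A n w) ->
    agree n.+1 (fun i => if i is i'.+1 then h (idx w) w i' else idx w) f ->
    A (f 0) w /\ agree n (h (f 0) w) (f \o S).
  move=> ew wf; have e0 : idx w = f 0 := wf 0 isT.
  split; first by rewrite -e0; apply: hidx.
  by move=> i hi; have := wf i.+1 hi; rewrite /= e0.
have [n|z [Az zf zn]] := hA (f 0) (f \o S).
  by have [w [ew wf]] := fa n.+1; exists w; apply: key.
have ez : idx z = f 0 by apply: (dA _ _ z) => //; apply: hidx; exists (f 0).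
exists z; split; first by exists (f 0).
  by case=> [|i] //=; rewrite ez zf.
move=> e e0; have [n hn] := zn e e0; exists n.+1 => w ew wf.
by have [Aw wf'] := key n w ew wf; exact: hn.
Qed.

(** [U] is split by the first basic ball inside [U] containing the point; by [bball_dec] balls are
    clopen in the topology of [h0], so the pieces are closed there. *)
Lemma coded_open U : mopen U -> coded U.
Proof.
have [h0 bh0] := base_code; move=> oU.
pose sb k := forall z, bball k z -> U z.
pose E k z := bball k z /\ (sb k /\ forall l, l < k -> sb l -> ~ bball l z).
apply: (@coded_ext (fun z => exists k, E k z)) => [z|].
  split=> [[k [bz [sk _]]]|Uz]; first exact: sk.
  have [|k [[bk sk] mk]] := @ex_least (fun k => bball k z /\ sb k).
    have [e e0 he] := oU z Uz; have [|n hn] := @tol_lt (e / 2)%R; first lra.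
    have [|j hj] := dist_dense pm z (e := ratr (tol n)); first by rewrite ltr0q invr_gt0.
    exists (pickle (j, tol n)); rewrite /sb /bball pickleK_inv; split=> // w /= hw.
    by apply: he; have := dist_triangle pm z (q j) w; rewrite (dist_sym pm (q j) w); lra.
  exists k; split=> //; split=> // l lk sl bl; have := mk l (conj bl sl); lia.
apply: coded_dcup => [k|n m z [bn [sn hn]] [bm [sm hm]]]; last first.
  case: (ltngtP n m) => // l.
    by case: (hm _ l sn).
  by case: (hn _ l sm).
exists h0; apply: coded_hclosed => // z hz; split.
  have [n hn] := bball_dec bh0 k; have [w [[bw _] wz]] := hz n; exact: hn wz bw.
have [w [[_ [sk _]] _]] := hz 0; split=> // l lk sl bl.
have [n hn] := bball_dec bh0 l; have [v [[_ [_ hv]] vz]] := hz n.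
by apply: (hv l) => //; apply: hn bl => i hi; rewrite vz.
Qed.

(** Codes pass to countable intersections and disjoint unions; carrying the complement along turns
    this into a sigma-algebra, so all Borel sets are coded. *)
Definition bicoded (A : set Z) := coded A /\ coded (fun z => ~ A z).

Lemma coded0 : coded (fun _ : Z => False).
Proof. by exists (fun _ _ => 0) => f /(_ 0)[z []]. Qed.

Lemma sigma_algebra_bicoded : sigma_algebra setT bicoded.
Proof.
split.
- split; first exact: coded0.
  by apply: (@coded_closed (fun _ => False)) => z [].
- move=> A [cA cnA]; rewrite setTD; split=> //.
  by apply: (@coded_ext A) => // z; split=> [? //|/contrapT].
- move=> A bA; split.
    apply: (@coded_ext (fun z => exists n, A n z /\ forall m, m < n -> ~ A m z)) => [z|].
      split=> [[n [An _]]|[n _ An]]; first by exists n.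
      have [|k [Ak mk]] := @ex_least (fun k => A k z); first by exists n.
      by exists k; split=> // m mk' Am; have := mk m Am; rewrite leqNgt mk'.
    apply: coded_dcup => [n|n m z [An hn] [Am hm]]; last first.
      case: (ltngtP n m) => // l.
        by case: (hm _ l An).
      by case: (hn _ l Am).
    pose C m := if m is m'.+1 then (fun z => if m' < n then ~ A m' z else True) else A n.
    apply: (@coded_ext (fun z => forall m, C m z)) => [z|].
      split=> [h|[An h] [|m] //=]; first (split; first exact: (h 0)).
        by move=> m mn; have := h m.+1; rewrite /= mn.
      by case: ifP => // mn; exact: h.
    apply: coded_cap => -[|m] /=; first by have [] := bA n.
    case: (m < n); first by have [] := bA m.
    apply: (@coded_ext (fun _ => ~ False)) => [z|]; first by split=> // _ [].
    by apply: (@coded_closed (fun _ => False)) => z [].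
  apply: (@coded_ext (fun z => forall n, ~ A n z)) => [z|].
    by split=> [h [n _ An]|h n An]; [exact: (h n)|apply: h; exists n].
  by apply: coded_cap => n; have [] := bA n.
Qed.

Lemma bicoded_open U : mopen U -> bicoded U.
Proof. by move=> oU; split; [exact: coded_open|exact: coded_closed]. Qed.

End Coding.

Section ProductMetric.
Context {R : realType} {Z : Type} (dist : Z -> Z -> R) (q : nat -> Z).
Hypothesis pm : polish_metric dist q.
Local Open Scope ring_scope.

Definition dist2 (x y : Z * Z) : R := Num.max (dist x.1 y.1) (dist x.2 y.2).
Definition q2 (n : nat) : Z * Z :=
  if (pickle_inv n : option (nat * nat)) is Some ij then (q ij.1, q ij.2) else (q 0%N, q 0%N).

Lemma polish_metric2 : polish_metric dist2 q2.
Proof.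
split.
- by move=> x y; rewrite le_max (dist_ge0 pm).
- by move=> x; rewrite /dist2 !(dist_xx pm) maxxx.
- move=> [x1 x2] [y1 y2] /= h.
  have h1 : dist x1 y1 <= 0 by rewrite -h le_max lexx.
  have h2 : dist x2 y2 <= 0 by rewrite -h le_max lexx orbT.
  by congr pair; apply: (dist_eq0 pm); apply/eqP; rewrite eq_le (dist_ge0 pm) andbT.
- by move=> x y; rewrite /dist2 !(dist_sym pm y.1, dist_sym pm y.2) /=
    (dist_sym pm x.1) (dist_sym pm x.2).
- move=> x y z; rewrite /dist2 ge_max; apply/andP; split.
    by apply: (le_trans (dist_triangle pm _ y.1 _)); apply: lerD; rewrite le_max lexx.
  by apply: (le_trans (dist_triangle pm _ y.2 _)); apply: lerD; rewrite le_max lexx orbT.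
- move=> u cu.
  have [z1 h1] : exists z, forall e, 0 < e -> exists N, forall n, (N <= n)%N -> dist z (u n).1 < e.
    apply: (dist_complete pm (u := fun n => (u n).1)) => e /cu[N hN]; exists N => m n hm hn.
    by have := hN m n hm hn; rewrite gt_max => /andP[].
  have [z2 h2] : exists z, forall e, 0 < e -> exists N, forall n, (N <= n)%N -> dist z (u n).2 < e.
    apply: (dist_complete pm (u := fun n => (u n).2)) => e /cu[N hN]; exists N => m n hm hn.
    by have := hN m n hm hn; rewrite gt_max => /andP[].
  exists (z1, z2) => e e0; have [N1 k1] := h1 e e0; have [N2 k2] := h2 e e0.
  exists (maxn N1 N2) => n; rewrite geq_max => /andP[n1 n2].
  by rewrite gt_max k1 ?k2.
- move=> [x y] e e0; have [i hi] := dist_dense pm x e0; have [j hj] := dist_dense pm y e0.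
  by exists (pickle (i, j)); rewrite /q2 pickleK_inv gt_max hi hj.
Qed.

End ProductMetric.

(** * Novikov's separation theorem for projections of coded sets *)

Section Projection.
Context {R : realType} {d : measure_display} {X : measurableType d} (dX : X -> X -> R) (qX : nat -> X).
Hypothesis pX : polish_metric dX qX.
Hypothesis mopenX : forall U, mopen dX U -> mpred U.
Context {Z : Type} (dZ : Z -> Z -> R) (pr : Z -> X).
Hypothesis pr_lip : forall z w, (dX (pr z) (pr w) <= dZ z w)%R.

Definition im (A : Z -> Prop) x := exists2 z, A z & pr z = x.

Definition separated (A : nat -> X -> Prop) := exists C : nat -> X -> Prop,
  (forall k, mpred (C k) /\ forall x, A k x -> C k x) /\ forall x, exists k, ~ C k x.

(** Used in contrapositive form: a family that is not separated stays so when one member is replaced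
    by a suitable piece of it. *)
Lemma separated_split (A : nat -> X -> Prop) (B : nat -> X -> Prop) j :
  (forall x, A j x -> exists i, B i x) ->
  (forall i, separated (fun k => if k == j then B i else A k)) -> separated A.
Proof.
move=> AB /choice[C hC].
exists (fun k x => if k == j then exists i, C i j x else forall i, C i k x); split=> [k|x].
  case E : (k == j); [rewrite (eqP E)|]; split.
  - by apply: mpred_ex => i; have [/(_ j)[]] := hC i.
  - move=> x /AB[i Bi]; exists i; have [/(_ j)[_ h] _] := hC i.
    by apply: h; rewrite eqxx.
  - by apply: mpred_all => i; have [/(_ k)[]] := hC i.
  - move=> x Ax i; have [/(_ k)[_ h] _] := hC i.
    by apply: h; rewrite E.
have [[i [k [kj nC]]]|h] := EM (exists i k, k <> j /\ ~ C i k x).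
  by exists k; rewrite ifN; [move/(_ i)|exact/eqP].
exists j; rewrite eqxx => -[i Ci]; have [_ /(_ x)[k nk]] := hC i.
by apply: h; exists i, k; split=> // kj; apply: nk; rewrite kj.
Qed.

Lemma ball_mopen x e : mopen dX (fun y => (dX x y < e)%R).
Proof.
move=> y hy; exists (e - dX x y)%R; first by rewrite subr_gt0.
by move=> w hw; have := dist_triangle pX x y w; lra.
Qed.

Lemma separated_ball (A : nat -> X -> Prop) j k x y e : j <> k ->
  (e + e <= dX x y)%R -> (forall z, A j z -> (dX x z < e)%R) -> (forall z, A k z -> (dX y z < e)%R) ->
  separated A.
Proof.
move=> jk exy hj hk.
exists (fun l z => (l = j -> (dX x z < e)%R) /\ (l = k -> (dX y z < e)%R)); split=> [l|z].
  split.
    apply: mpred_and; apply: mpred_imp; try exact: mpred_const; exact/mopenX/ball_mopen.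
  by move=> z Az; split=> el; [apply: hj|apply: hk]; rewrite -el.
have [h|h] := EM (dX x z < e)%R; last by exists j => -[/(_ erefl)].
exists k => -[_ /(_ erefl) h']; have := dist_triangle pX x z y.
by rewrite (dist_sym pX z y); lra.
Qed.

(** The index is read off the 2-adic valuation of [n.+1], and each valuation recurs on odd
    multiples. *)
Lemma schedule (I : countType) (i0 : I) : exists phi : nat -> I, forall i N, exists2 n, N <= n & phi n = i.
Proof.
exists (fun n => odflt i0 (unpickle (logn 2 n.+1))) => i N.
exists (2 ^ pickle i * N.*2.+1).-1.
  rewrite -ltnS prednK ?muln_gt0 ?expn_gt0//.
  by apply: leq_trans (leq_pmull _ _); [lia|rewrite expn_gt0].
rewrite prednK ?muln_gt0 ?expn_gt0// lognM ?expn_gt0// pfactorK//.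
rewrite (_ : logn 2 N.*2.+1 = 0) ?addn0 ?pickleK//.
by apply/eqP; rewrite -leqn0 leqNgt logn_gt0 mem_primes /= dvdn2 /= odd_double.
Qed.

Section Novikov.
Variables (h : nat -> Z -> nat -> nat) (H : nat -> Z -> Prop).
Hypothesis cH : forall k, coded_by dZ (h k) (H k).

Let pre (s : seq nat) (f : nat -> nat) := forall i, i < size s -> nth 0 s i = f i.
Let P k s := im (fun z => H k z /\ pre s (h k z)).

(** If the images are not separated, prefixes of codes are extended one entry at a time, each [k]
    infinitely often, keeping the family non-separated. The prefixes for [k] converge to the code of
    a point [z k]. If [z k] and [z 0] had different projections, small balls around these would
    separate the family at a finite stage; so [pr (z 0)] is in every image. *)
Lemma novikov : (forall x, exists k, ~ im (H k) x) -> separated (fun k => im (H k)).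
Proof.
move=> cap0; apply: contrapT => ns.
pose upd (s : nat -> seq nat) j i k := if k == j then rcons (s j) i else s k.
have /choice[F hF] : forall sj : (nat -> seq nat) * nat, exists i,
    ~ separated (fun k => P k (sj.1 k)) -> ~ separated (fun k => P k (upd sj.1 sj.2 i k)).
  move=> [s j] /=; have [n|] := EM (separated (fun k => P k (s k))).
    by exists 0.
  move=> nsep; apply: contrapT => /forallNP all; apply: nsep.
  apply: (@separated_split _ (fun i => P j (rcons (s j) i)) j).
    move=> x [z [Hz pz] <-]; exists (h j z (size (s j))); exists z => //; split=> // i.
    rewrite size_rcons nth_rcons => hi; case: ltngtP => [hl|hl|->//]; first exact: pz.
    by move: hl hi; rewrite ltnS ltnNge => /negP.
  move=> i; have /not_implyP[_ /contrapT[C [h1 h2]]] := all i.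
  exists C; split=> // k; have [mC sC] := h1 k; split=> // x hx; apply: sC.
  by rewrite /upd; move: hx; case: eqP => [->|].
have [phi hphi] := schedule 0.
pose S := fix S n := if n is n'.+1 then upd (S n') (phi n') (F (S n', phi n')) else (fun=> [::]).
have nS n : ~ separated (fun k => P k (S n k)).
  elim: n => [|n IH] /=; last exact: (hF (S n, phi n)).
  move=> [C [h1 h2]]; apply: ns; exists C; split=> // k; have [mC sC] := h1 k; split=> // x hx.
  by apply: sC; case: hx => z Hz <-; exists z => //; split=> // -[].
have Sstep n k : exists t, S n.+1 k = S n k ++ t.
  rewrite /= /upd; case: eqP => [->|_]; last by exists [::]; rewrite cats0.
  by exists [:: F (S n, phi n)]; rewrite cats1.
have Smono n m k : n <= m -> exists t, S m k = S n k ++ t.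
  move=> /subnK <-; elim: (m - n) => [|l [t IH]]; first by exists [::]; rewrite cats0.
  by have [t' e] := Sstep (l + n) k; exists (t ++ t'); rewrite addSn e IH catA.
have Slong k L : exists n, L <= size (S n k).
  elim: L => [|L [n hn]]; first by exists 0.
  have [m nm em] := hphi k n; exists m.+1; rewrite /= /upd em eqxx size_rcons ltnS.
  by apply: leq_trans hn _; have [t ->] := Smono n m k nm; rewrite size_cat leq_addr.
have /choice[T hT] : forall kL : nat * nat, exists n, kL.2 <= size (S n kL.1).
  by move=> [k L]; exact: Slong.
pose f k i := nth 0 (S (T (k, i.+1)) k) i.
have Sf n k i : i < size (S n k) -> nth 0 (S n k) i = f k i.
  move=> hi; have hi' := hT (k, i.+1); rewrite /= in hi'; rewrite /f.
  case/orP: (leq_total n (T (k, i.+1))) => hm.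
    by have [t ->] := Smono _ _ k hm; rewrite nth_cat hi.
  by have [t ->] := Smono _ _ k hm; rewrite nth_cat hi'.
have alive k n : exists z, H k z /\ agree n (h k z) (f k).
  have [x [z [Hz pz] _]] : exists x, P k (S (T (k, n)) k) x.
    apply: contrapT => /forallNP e; apply: (nS (T (k, n))).
    exists (fun l _ => l <> k); split=> [l|x]; last by exists k.
    by split=> [|x hx el]; [exact: mpred_const|rewrite el in hx; exact: e hx].
  exists z; split=> // i hi.
  have hi' : i < size (S (T (k, n)) k) by apply: leq_trans hi _; exact: (hT (k, n)).
  by rewrite -(pz i hi') Sf.
have /choice[z hz] : forall k, exists z, [/\ H k z, forall i, h k z i = f k i &
    forall e, (0 < e)%R -> exists n, forall w, H k w -> agree n (h k w) (f k) -> (dZ z w < e)%R].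
  by move=> k; apply: cH; exact: alive.
have [k nk] := cap0 (pr (z 0)); apply: nk.
have [ek|nek] := EM (pr (z k) = pr (z 0)); first by exists (z k) => //; have [] := hz k.
exfalso.
have dpos : (0 < dX (pr (z k)) (pr (z 0)) / 2)%R.
  have := dist_ge0 pX (pr (z k)) (pr (z 0)); rewrite le_eqVlt => /orP[/eqP/esym/(dist_eq0 pX)//|].
  lra.
have [_ _ /(_ _ dpos)[n1 h1]] := hz k; have [_ _ /(_ _ dpos)[n2 h2]] := hz 0.
pose n := maxn (T (k, n1)) (T (0, n2)).
have cl l m w : T (l, m) <= n -> H l w -> pre (S n l) (h l w) -> agree m (h l w) (f l).
  move=> hT' Hw pw i hi; have hs : i < size (S n l).
    have [t ->] := Smono _ _ l hT'; rewrite size_cat; apply: leq_trans hi _.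
    by apply: leq_trans (leq_addr _ _); exact: (hT (l, m)).
  by rewrite -(pw i hs) Sf.
apply: (nS n); apply: (@separated_ball _ k 0 (pr (z k)) (pr (z 0)) (dX (pr (z k)) (pr (z 0)) / 2)%R).
- by move=> k0; apply: nek; rewrite k0.
- lra.
- move=> _ [w [Hw pw] <-]; apply: le_lt_trans (pr_lip _ _) _; apply: h1 => //.
  by apply: cl => //; exact: leq_maxl.
- move=> _ [w [Hw pw] <-]; apply: le_lt_trans (pr_lip _ _) _; apply: h2 => //.
  by apply: cl => //; exact: leq_maxr.
Qed.

End Novikov.
End Projection.

(** * Projections with finite fibers and edge enumerations *)

Lemma konig (T : seq nat -> Prop) :
  (forall s i, T (rcons s i) -> T s) ->
  (forall s, exists N, forall i, T (rcons s i) -> i < N) ->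
  (forall n, exists2 s, size s = n & T s) -> exists f, forall n, T (mkseq f n).
Proof.
move=> Tpre Tfin Tlong.
have Tcat s t : T (s ++ t) -> T s.
  elim/last_ind: t => [|t i IH]; first by rewrite cats0.
  by rewrite -rcons_cat => /Tpre.
pose inf s := forall n, exists2 t, size t = n & T (s ++ t).
have step s : inf s -> exists i, inf (rcons s i).
  move=> infs; apply: contrapT => /forallNP h.
  have /choice[b hb] : forall i, exists n, ~ exists2 t, size t = n & T (rcons s i ++ t).
    by move=> i; have /existsNP := h i.
  have [N hN] := Tfin s.
  have [[//|i t] [st] Tt] := infs (\max_(i < N) b i).+1.
  rewrite -cat_rcons in Tt; have iN := hN i (Tcat _ _ Tt).
  apply: (hb i); exists (take (b i) t).
    by rewrite size_take_min st; apply/minn_idPl; exact: (leq_bigmax (Ordinal iN)).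
  by rewrite -(cat_take_drop (b i) t) catA in Tt; apply: Tcat Tt.
have /choice[F hF] : forall s, exists i, inf s -> inf (rcons s i).
  by move=> s; have [/step[i hi]|ns] := EM (inf s); [exists i|exists 0].
pose b := fix b n := if n is n'.+1 then rcons (b n') (F (b n')) else [::].
have ib n : inf (b n) by elim: n => [|n IH] /=; [exact: Tlong|exact: hF].
exists (fun n => F (b n)) => n; have -> : mkseq (fun n => F (b n)) n = b n.
  by elim: n => // n IH; rewrite mkseqS IH.
by have [[|//] _] := ib n 0; rewrite cats0.
Qed.

Lemma finite_bounded (T : choiceType) (A : set T) (phi : T -> nat) :
  finite_set A -> exists N, forall x, A x -> phi x < N.
Proof.
move=> /finite_seqP[s ->]; exists (\max_(i < size s) phi (tnth (in_tuple s) i)).+1 => x /= xs.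
have [i ei] : exists i, x = tnth (in_tuple s) i.
  have hi : index x s < size s by rewrite index_mem.
  by exists (Ordinal hi); rewrite (tnth_nth x) /= nth_index.
by rewrite ltnS ei; exact: (leq_bigmax i).
Qed.

Section FiniteProjection.
Context {R : realType} {d : measure_display} {X : measurableType d} (dX : X -> X -> R) (qX : nat -> X).
Hypothesis pX : polish_metric dX qX.
Hypothesis mopenX : forall U, mopen dX U -> mpred U.
Context {Z : Type} (dZ : Z -> Z -> R) (pr : Z -> X).
Hypothesis pr_lip : forall z w, (dX (pr z) (pr w) <= dZ z w)%R.

(** For fixed [s], the images of the sets [H s k] have empty intersection over [k] because fibers
    are finite. Separating them by [C s k] leaves only finitely many admissible next entries over
    each [x], and by [konig] an infinite branch exists as soon as there are branches of every
    length, a Borel condition. *)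
Lemma mpred_im (h : Z -> nat -> nat) (G : Z -> Prop) : coded_by dZ h G ->
  (forall x (phi : Z -> nat), exists N, forall z, G z -> pr z = x -> phi z < N) ->
  mpred (im pr G).
Proof.
move=> cG fG.
pose pre (s : seq nat) (z : Z) := forall i, i < size s -> nth 0 s i = h z i.
pose H s k z := [/\ G z, pre s z & k <= h z (size s)].
have cH s k : coded_by dZ h (H s k).
  move=> f fa; have [|z [Gz zf zn]] := cG f.
    by move=> n; have [w [[Gw _ _] wf]] := fa n; exists w.
  exists z; split=> //.
    have [w [[_ pw kw] wf]] := fa (size s).+1; split=> //.
      by move=> i hi; rewrite pw// zf wf// ltnS ltnW.
    by rewrite zf -wf.
  by move=> e e0; have [n hn] := zn e e0; exists n => w [Gw _ _]; exact: hn.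
have /choice[C hC] : forall s, exists C : nat -> X -> Prop,
    (forall k, mpred (C k) /\ forall x, im pr (H s k) x -> C k x) /\ forall x, exists k, ~ C k x.
  move=> s; apply: (@novikov _ _ _ dX qX pX mopenX _ dZ pr pr_lip (fun=> h)) => // x.
  have [N hN] := fG x (fun z => h z (size s)); exists N => -[z [Gz _ zk] zx].
  by have := hN z Gz zx; rewrite ltnNge zk.
(* Closeness of [x] to the image of the cylinder of [s]; along an infinite branch it forces the
   limit to project to [x]. *)
pose cl s x := forall m : nat, exists2 z, G z /\ pre s z & (dX x (pr z) < ratr (tol m))%R.
have mcl s : mpred (cl s).
  apply: mpred_all => m; apply: mopenX => x [z Pz zx].
  exists (ratr (tol m) - dX x (pr z))%R; first by rewrite subr_gt0.
  move=> w xw; exists z => //; have := dist_triangle pX w x (pr z).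
  by rewrite (dist_sym pX w x); lra.
pose T s x := forall n, n < size s ->
  (forall l, l <= nth 0 s n -> C (take n s) l x) /\ cl (take n.+1 s) x.
have mT s : mpred (T s).
  apply: mpred_all => n; apply: mpred_imp; first exact: mpred_const.
  apply: mpred_and => //; apply: mpred_all => l; apply: mpred_imp; first exact: mpred_const.
  by have [/(_ l)[]] := hC (take n s).
apply: (@mpred_ext _ _ (fun x => forall n, exists s, size s = n /\ T s x)) => [x|]; last first.
  apply: mpred_all => n; apply: mpred_ex => s; apply: mpred_and => //; exact: mpred_const.
split=> [hx|[z Gz <-] n].
  have [||| f hf] := @konig (fun s => T s x).
  - move=> s i Ts n hn; have [|h1 h2] := Ts n; first by rewrite size_rcons ltnS ltnW.
    rewrite nth_rcons hn in h1.
    have tk m : m <= size s -> take m (rcons s i) = take m s.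
      by move=> hm; rewrite -cats1 take_cat; case: ltnP => // hm';
        rewrite (eqP (_ : m == size s)) ?subnn ?cats0 ?take_size// eqn_leq hm.
    by rewrite !tk// in h1 h2; exact: ltnW.
  - move=> s; have [_ /(_ x)[l nl]] := hC s; exists l => i Ts.
    have [|h1 _] := Ts (size s); first by rewrite size_rcons.
    rewrite ltnNge; apply/negP => li; apply: nl.
    move: h1; rewrite nth_rcons ltnn eqxx -cats1 take_size_cat// => h1; exact: h1.
  - by move=> n; have [s [sn Ts]] := hx n; exists s.
  have clf n : cl (mkseq f n.+1) x.
    have [|_] := hf n.+1 n; first by rewrite size_mkseq.
    by rewrite take_oversize ?size_mkseq.
  have pref n w : pre (mkseq f n) w <-> agree n (h w) f.
    split=> hw i hi.
      by have := hw i; rewrite size_mkseq nth_mkseq// => /(_ hi).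
    by rewrite size_mkseq in hi; rewrite nth_mkseq// hw.
  have [n|z [Gz zf zn]] := cG f.
    have [w [Gw pw] _] := clf n 0; exists w; split=> //.
    by apply: agreeW (leqnSn n) _; apply/pref.
  exists z => //; apply: (near_uniq pX) => e e0.
  have [|n hn] := zn (e / 2)%R; first lra.
  have [|m hm] := @tol_lt R (e / 2)%R; first lra.
  have [w [Gw pw] xw] := clf n m; exists (pr w); split.
    have : (dZ z w < e / 2)%R.
      by apply: hn => //; apply: agreeW (leqnSn n) _; apply/pref.
    by have := pr_lip z w; lra.
  lra.
exists (mkseq (h z) n); rewrite size_mkseq; split=> // m; rewrite size_mkseq => mn.
have prez k : k <= n -> pre (take k (mkseq (h z) n)) z.
  move=> kn i; rewrite size_take_min size_mkseq (minn_idPl kn) => ik.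
  by rewrite nth_take// nth_mkseq//; lia.
split=> [l|]; last first.
  move=> k; exists z; first by split=> //; exact: prez.
  by rewrite (dist_xx pX) ltr0q invr_gt0.
rewrite nth_mkseq// => lz; have [/(_ l)[_ hl] _] := hC (take m (mkseq (h z) n)).
apply: hl; exists z => //; split=> //; first exact/prez/ltnW.
by rewrite size_take_min size_mkseq (minn_idPl (ltnW mn)).
Qed.

End FiniteProjection.

(** * Borel enumeration of neighbors *)

Section LusinNovikov.
Context {R : realType} {d : measure_display} {X : measurableType d} (dX : X -> X -> R) (qX : nat -> X).
Hypothesis pX : polish_metric dX qX.
Hypothesis borelX : @measurable d X = <<s (mopen dX : set (set X)) >>.

Lemma mpred_mopen U : mopen dX U -> mpred U.
Proof. by rewrite /mpred borelX => oU; apply: sub_sigma_algebra. Qed.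

Lemma measurable_bicoded (A : set (X * X)) : measurable A -> bicoded (dist2 dX) A.
Proof.
have pX2 := polish_metric2 pX.
have sb := sigma_algebra_bicoded pX2.
have proj (p : X * X -> X) : (forall z w, (dX (p z) (p w) <= dist2 dX z w)%R) ->
    forall B : set X, measurable B -> bicoded (dist2 dX) (p @^-1` B).
  move=> plip B; rewrite borelX; apply: (@smallest_sub _ (@sigma_algebra X setT) _
      (fun B => bicoded (dist2 dX) (p @^-1` B))).
    case: sb => s0 sC sU; split=> [|A' /sC|F hF]; first exact: s0.
      by rewrite !setTD.
    by rewrite preimage_bigcup; exact: sU.
  move=> U oU; apply: (bicoded_open pX2) => z Uz.
  have [e e0 he] := oU _ Uz; exists e => // w zw; apply: he.
  exact: le_lt_trans (plip _ _) zw.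
apply: (@smallest_sub _ (@sigma_algebra (X * X)%type setT) _ (bicoded (dist2 dX))) => //.
move=> B [] [C mC <-]; rewrite setTI; apply: proj => // z w; rewrite /dist2.
  by rewrite le_max lexx.
by rewrite le_max lexx orbT.
Qed.

Lemma separating_bball : separating (bball dX qX : nat -> set X).
Proof.
split=> [k|x y nxy].
  apply: mpred_mopen => x; rewrite /bball; case: pickle_inv => // jt hx.
  exists (ratr jt.2 - dX x (qX jt.1))%R; first by rewrite subr_gt0.
  by move=> w; have := dist_triangle pX w x (qX jt.1); rewrite (dist_sym pX w x); lra.
have d0 : (0 < dX x y / 2)%R.
  have := dist_ge0 pX x y; rewrite le_eqVlt => /orP[/eqP/esym/(dist_eq0 pX)//|].
  lra.
have [n hn] := tol_lt d0.
have [|j hj] := dist_dense pX x (e := ratr (tol n)); first by rewrite ltr0q invr_gt0.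
exists (pickle (j, tol n)); rewrite /bball pickleK_inv /=; split=> // hy.
by have := dist_triangle pX x (qX j) y; rewrite (dist_sym pX (qX j) y); lra.
Qed.

Variable G : rel X.
Hypothesis mG : measurable [set xy : X * X | G xy.1 xy.2].
Hypothesis fG : locally_finite G.

Lemma mpred_nbr (V : X -> Prop) : mpred V -> mpred (fun x => exists y, V y /\ G x y).
Proof.
move=> mV.
have mGV : measurable [set xy : X * X | G xy.1 xy.2 /\ V xy.2].
  apply: measurableI => //.
  by have := @measurable_snd _ _ X X; move=> /(_ measurableT V mV); rewrite setTI.
have [[h ch] _] := measurable_bicoded mGV.
apply: (@mpred_ext _ _ (im fst [set xy : X * X | G xy.1 xy.2 /\ V xy.2])) => [x|].
  by split=> [[[a b] /= [Gab Vb] <-]|[y [Vy Gxy]]]; [exists b|exists (x, y)].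
apply: (mpred_im pX mpred_mopen _ ch) => [z w|x phi].
  by rewrite /dist2 le_max lexx.
have [N hN] := finite_bounded (fun y => phi (x, y)) (fG x).
by exists N => -[a b] [/= Gab _] ax; subst a; exact: hN.
Qed.

Lemma lusin_novikov : exists g : nat -> X -> X, [/\ forall n, bfun (g n),
  forall n x, g n x <> x -> G x (g n x) & forall x y, G x y -> exists n, g n x = y].
Proof.
pose Bk := bball dX qX; have [mB sepB] := separating_bball.
pose PP V x := exists y, V y /\ G x y.
(* Exactly one neighbor of [x] lies in [Bk k]: there is one, and no difference of basic balls
   divides them. Only projections along [G] occur, so this is Borel. *)
pose uniq k x := PP (Bk k) x /\ ~ exists i m, (PP (fun y => Bk k y /\ (Bk i y /\ ~ Bk m y)) x /\
   PP (fun y => Bk k y /\ ~ (Bk i y /\ ~ Bk m y)) x).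
have uniqP k x y y' : uniq k x -> G x y -> Bk k y -> G x y' -> Bk k y' -> y = y'.
  move=> [_ h] Gy By Gy' By'; apply: contrapT => ne; apply: h.
  have [i [h1 h2]] := sepB _ _ ne.
  have [m [h3 h4]] := sepB _ _ (nesym ne).
  exists i, m; split; [by exists y|by exists y'; split=> //; split=> // -[]].
have mu k : mpred (uniq k).
  have mPP V : mpred V -> mpred (PP V) by exact: mpred_nbr.
  apply: mpred_and; first exact/mPP/mB.
  apply: mpred_not; apply: mpred_ex => i; apply: mpred_ex => m.
  have mim : mpred (fun y => Bk i y /\ ~ Bk m y).
    by apply: mpred_and; [exact: mB|apply: mpred_not; exact: mB].
  by apply: mpred_and; apply: mPP; apply: mpred_and; [exact: mB| |exact: mB|exact: mpred_not].
have /choice[g hg] : forall kx : nat * X, exists y, (uniq kx.1 kx.2 -> G kx.2 y /\ Bk kx.1 y) /\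
    (~ uniq kx.1 kx.2 -> y = kx.2).
  move=> [k x] /=; have [u|nu] := EM (uniq k x); last by exists x.
  by have [[y [By Gy]] _] := u; exists y.
exists (fun k x => g (k, x)); split=> [k|k x ne|x y Gxy].
- rewrite /bfun => V mV; apply: (@mpred_ext _ _ (fun x => (uniq k x /\ PP (fun y => Bk k y /\ V y) x) \/
     (~ uniq k x /\ V x))) => [x|].
    have [h1 h2] := hg (k, x); rewrite /= in h1 h2; split=> [[[u [y [[By Vy] Gy]]]|[/h2 -> //]]|].
      by have [Gg Bg] := h1 u; rewrite (uniqP k x _ _ u Gg Bg Gy By).
    have [u Vg|nu] := EM (uniq k x); [left|right]; split=> //; last by rewrite -h2.
    by have [Gg Bg] := h1 u; exists (g (k, x)).
  apply: mpred_or; apply: mpred_and => //; last exact: mpred_not.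
  by apply: mpred_nbr; apply: mpred_and => //; exact: mB.
- have [h1 h2] := hg (k, x); rewrite /= in h1 h2.
  have [u|nu] := EM (uniq k x); first by have [] := h1 u.
  by case: ne; exact: h2.
have /choice[phi hphi] : forall z, exists n, z <> y -> (ratr (tol n) < dX y z)%R.
  move=> z; have [->|ne] := EM (z = y); first by exists 0.
  have [|n hn] := @tol_lt R (dX y z); last by exists n.
  by have := dist_ge0 pX y z; rewrite le_eqVlt => /orP[/eqP/esym/(dist_eq0 pX)/esym|].
(* The finitely many other neighbors of [x] stay at distance more than [tol N] from [y], so a small
   basic ball isolates [y]. *)
have [N hN] := finite_bounded phi (fG x).
have far z : G x z -> z <> y -> (ratr (tol N) < dX y z)%R.
  move=> Gxz ne; apply: le_lt_trans (hphi z ne).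
  rewrite ler_rat /tol lef_pV2 ?posrE// ler_nat ltnS ltnW//; exact: hN.
have [|n hn] := @tol_lt R (ratr (tol N) / 2)%R.
  have : (0 < ratr (tol N) :> R)%R by rewrite ltr0q invr_gt0.
  lra.
have [|j hj] := dist_dense pX y (e := ratr (tol n)); first by rewrite ltr0q invr_gt0.
pose k := pickle (j, tol n).
have Bky : Bk k y by rewrite /Bk /bball pickleK_inv.
have only z : G x z -> Bk k z -> z = y.
  move=> Gxz; rewrite /Bk /bball pickleK_inv /= => Bz; apply: contrapT => /(far z Gxz).
  by have := dist_triangle pX y (qX j) z; rewrite (dist_sym pX (qX j) z); lra.
have u : uniq k x.
  split; first by exists y.
  move=> [i [m [[a [[Ba [a1 a2]] Ga]] [b [[Bb nb] Gb]]]]].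
  by apply: nb; rewrite (only b)// -(only a).
exists k; have [/(_ u)[Gg Bg] _] := hg (k, x); exact: only.
Qed.

End LusinNovikov.

Section PolishTopology.
Context {R : realType} {d : measure_display} {X : measurableType d}.

Lemma compatible_polish_metric (tau : Topological X) : compatible_polish R tau ->
  exists (dX : X -> X -> R) (qX : nat -> X), [/\ polish_metric dX qX,
    @measurable d X = <<s (mopen dX : set (set X)) >> &
    forall U : set X, @open (Topological.Pack tau) U <-> mopen dX U].
Proof.
move=> [[[D cD dD] [M [eM cM]]] eB].
pose T := Metric.Pack M.
pose dX : X -> X -> R := @mdist R T.
have openE (U : set X) : @open (Topological.Pack tau) U <-> mopen dX U.
  rewrite -eM; rewrite openE; split=> h z Uz.
    have := h z Uz => /nbhs_ballP[e /= e0 he]; exists e => // w zw; apply: he.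
    by rewrite ballEmdist.
  have [e e0 he] := h z Uz; apply/nbhs_ballP; exists e => // w.
  by rewrite ballEmdist; exact: he.
have : exists q : nat -> X, forall z e, (0 < e)%R -> exists j, (dX z (q j) < e)%R.
  have hD z e : (0 < e)%R -> exists2 w, D w & (dX z w < e)%R.
    move=> e0; have [||w [zw Dw]] := dD [set w | dX z w < e]%R.
    - by exists z => /=; rewrite /dX mdistxx.
    - apply/openE => w zw; exists (e - dX z w)%R; first by rewrite subr_gt0.
      by move=> v wv; have := @metric_triangle R T z w v; rewrite -/(dX _ _) => h; rewrite /= in zw wv *; move: h; rewrite -/dX; lra.
    by exists w.
  have [w0 Dw0 _] := hD point 1%R ltr01.
  have [f finj] := countable_injP _ cD.
  have /choice[q hq] : forall n, exists w, (exists2 v, D v & f v = n) -> D w /\ f w = n.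
    by move=> n; have [[v Dv fv]|h] := EM (exists2 v, D v & f v = n); [exists v|exists w0].
  exists q => z e e0; have [w Dw zw] := hD z e e0; exists (f w).
  have [|Dq fq] := hq (f w); first by exists w.
  by rewrite (finj (q (f w)) w) ?inE.
move=> [q hq]; exists dX, q; split.
- split=> //.
  + by move=> x y; exact: mdist_ge0.
  + by move=> x; exact: mdistxx.
  + by move=> x y; exact: mdist_positivity.
  + by move=> x y; exact: metric_sym.
  + by move=> x y z; exact: metric_triangle.
  move=> u cu; have [|x hx] := cM ((u : nat -> T) @ \oo)%classic _.
    apply/cauchyP => e e0; have [N hN] := cu e e0; exists (u N).
    by exists N => // n /= Nn; rewrite ballEmdist; exact: hN.
  exists x => e e0; have [N _ hN] := hx _ (nbhsx_ballx x e e0).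
  by exists N => n /hN /=; rewrite ballEmdist.
- rewrite eB; congr (<<s _ >>); apply/seteqP; split=> U /openE//.
- exact: openE.
Qed.

End PolishTopology.

(** * Ends and the core *)

Section Ends.
Context {X : choiceType} (G : rel X).
Hypothesis graphG : is_graph G.
Hypothesis locG : locally_finite G.
Hypothesis forestG : forest G.

Lemma adjC x y : G x y -> G y x.
Proof. by have [s _] := graphG; rewrite s. Qed.

Lemma adj_neq x y : G x y -> x <> y.
Proof. by have [_ i] := graphG => Gxy exy; rewrite exy i in Gxy. Qed.

Lemma reachableP (e : rel X) x y : reachable e x y <->
  exists u n, [/\ walk e u n, u 0 = x & u n = y].
Proof.
split=> [[p]|[u [n [wu <- <-]]]]; last first.
  exists (map u (iota 1 n)); first by apply: path_map_iota => i hi; apply: wu; lia.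
  by case: n {wu} => // n; rewrite -addn1 iotaD map_cat /= last_cat /= add1n addn1.
elim: p x => [|z p IH] x /=; first by move=> _ ->; exists (fun=> x), 0.
move=> /andP[xz pz] /IH[//|u [n [wu u0 un]]].
exists (fun i => if i is i'.+1 then u i' else x), n.+1; split=> // -[|i] hi.
  by rewrite u0.
exact: wu.
Qed.

Definition geodesic_ray (u : nat -> X) := (forall i, G (u i) (u i.+1)) /\ forall i, u i <> u i.+2.

(** Finite approximations of rays, which make the existence of an infinite direction a countable
    condition. *)
Fixpoint ext k x y : Prop := match k with
  | 0 => G x y
  | k.+1 => G x y /\ exists z, z <> x /\ ext k y z
  end.

(* Equivalently, by local finiteness, some ray from [x] starts with the edge from [x] to [y]. *)
Definition unbounded x y := forall k, ext k x y.

Lemma ext_adj k x y : ext k x y -> G x y.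
Proof. by case: k => [|k] // []. Qed.

Lemma ext_le k m x y : ext m x y -> k <= m -> ext k x y.
Proof.
elim: m k x y => [|m IH] [|k] x y //=; first by move=> [].
by move=> [Gxy [z [zx ez]]] km; split=> //; exists z; split=> //; exact: IH ez _.
Qed.

Lemma unbounded_adj x y : unbounded x y -> G x y.
Proof. by move=> /(_ 0). Qed.

Lemma unbounded_step x y : unbounded x y -> exists z, z <> x /\ unbounded y z.
Proof.
move=> uxy; apply: contrapT => /forallNP h.
have /choice[phi hphi] : forall z, exists k, z <> x -> ~ ext k y z.
  move=> z; have [->|zx] := EM (z = x); first by exists 0.
  have /not_andP[//|/existsNP[k hk]] := h z; by exists k.
have [N hN] := finite_bounded phi (locG y).
have [_ [z [zx ez]]] := uxy N.+1.
apply: (hphi z zx); apply: (ext_le ez); apply: ltnW; apply: hN.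
exact: ext_adj ez.
Qed.

Lemma unbounded_ray x y : unbounded x y -> exists u, [/\ u 0 = x, u 1 = y & geodesic_ray u].
Proof.
move=> uxy.
have /choice[F hF] : forall p : X * X, exists z, unbounded p.1 p.2 -> z <> p.1 /\ unbounded p.2 z.
  move=> [a b] /=; have [/unbounded_step[z hz]|n] := EM (unbounded a b); first by exists z.
  by exists a.
pose s := fix s n := if n is n'.+1 then ((s n').2, F (s n')) else (x, y).
have hs n : unbounded (s n).1 (s n).2.
  by elim: n => //= n IH; have [] := hF (s n) IH.
exists (fun n => (s n).1); split=> //; split=> i /=; first exact/unbounded_adj/hs.
by have [h _] := hF _ (hs i) => e; apply: h; rewrite e.
Qed.

Lemma ray_unbounded u : geodesic_ray u -> unbounded (u 0) (u 1).
Proof.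
move=> [wu ru] k.
have : forall i, ext k (u i) (u i.+1); last by apply.
elim: k => [|k IH] i //=; split=> //; exists (u i.+2); split=> //; exact: nesym.
Qed.

Lemma geodesic_ray_shift u n : geodesic_ray u -> geodesic_ray (fun i => u (n + i)).
Proof. by move=> [wu ru]; split=> i; rewrite !addnS; [exact: wu|exact: ru]. Qed.

Lemma geodesic_ray_inj u : geodesic_ray u -> injective u.
Proof.
move=> [wu ru] i j; apply: (reduced_walk_inj (u := u) (n := maxn i j) forestG).
- by move=> k _; exact: wu.
- by move=> k _; exact: ru.
- exact: leq_maxl.
- exact: leq_maxr.
Qed.

Lemma unbounded_back x y z : unbounded x z -> G x y -> z <> y -> unbounded y x.
Proof. by move=> xz xy zy [|k] /=; [exact: adjC|split; [exact: adjC|exists z]]. Qed.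

Definition core x := exists y z, [/\ y <> z, unbounded x y & unbounded x z].

Lemma core_other x y : core x -> exists z, z <> y /\ unbounded x z.
Proof.
move=> [a [b [ab xa xb]]]; have [e|ne] := EM (a = y); last by exists a.
by exists b; split=> // e'; apply: ab; rewrite e e'.
Qed.

Lemma core_unbounded x y : core y -> G x y -> unbounded x y.
Proof.
move=> cy xy; have [z [zx yz]] := core_other x cy.
by apply: (unbounded_back yz) => //; exact: adjC.
Qed.

Lemma unbounded_core x y : core x -> unbounded x y -> core y.
Proof.
move=> cx xy; have [z [zx yz]] := unbounded_step xy.
have [w [wy xw]] := core_other y cx.
by exists z, x; split=> //; apply: (unbounded_back xw) => //; exact: unbounded_adj.
Qed.

(** As [u n] is in the core, each step towards it is an infinite direction, by induction from the
    end; a walk starting in the core then never leaves it ([unbounded_core]). *)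
Lemma core_walk u n : walk G u n -> reduced u n -> core (u 0) -> core (u n) ->
  forall i, i <= n -> core (u i).
Proof.
move=> wu ru c0 cn.
have ub k : k < n -> unbounded (u (n - k.+1)) (u (n - k.+1).+1).
  elim: k => [|k IH] hk.
    have -> : (n - 1).+1 = n by lia.
    apply: core_unbounded => //; have {2}-> : n = (n - 1).+1 by lia.
    by apply: wu; lia.
  have e : n - k.+1 = (n - k.+2).+1 by lia.
  have := IH ltac:(lia); rewrite e => h [|m] /=; first by apply: wu; lia.
  split; first by apply: wu; lia.
  by exists (u (n - k.+2).+2); split=> //; apply/nesym/ru; lia.
elim=> [//|i IH] hi; apply: (@unbounded_core (u i)); first exact/IH/ltnW.
have := ub (n - i.+1) ltac:(lia); have -> : n - (n - i.+1).+1 = i by lia.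
exact.
Qed.

(** A shortest walk from [x] to the ray is joined to the rest of the ray; minimality makes the
    junction reduced. Up to tails, only rays issuing from [x] matter. *)
Lemma ray_from x r : ray G r -> reachable G x (r 0) -> exists rho n j,
  [/\ geodesic_ray rho, rho 0 = x & forall i, rho (n + i) = r (j + i)].
Proof.
move=> [rinj wr] /reachableP[u [n [wu u0 un]]].
have [m [[w [j [ww w0 wm]]] minm]] : exists m, (exists w j, [/\ walk G w m, w 0 = x & w m = r j]) /\
    forall k, (exists w j, [/\ walk G w k, w 0 = x & w k = r j]) -> m <= k.
  by apply: ex_least; exists n, u, 0.
have [v [k [km [wv rv v0 vk _]]]] := walk_reduce ww.
have mk : m <= k by apply: minm; exists v, j; rewrite v0 vk.
have {km mk} ? : k = m by lia. subst k.
pose rho i := if i <= m then v i else r (j + (i - m)).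
have rhoE i : rho (m + i) = r (j + i).
  rewrite /rho; case: leqP => h; last by congr r; lia.
  have -> : i = 0 by lia.
  by rewrite !addn0 vk.
exists rho, m, j; split=> //; last by rewrite /rho leq0n v0.
split=> i.
  case: (ltnP i m) => h; first by rewrite /rho h ltnW//; exact: wv.
  have -> : i = m + (i - m) by lia.
  by rewrite -addnS !rhoE addnS.
case: (ltnP i.+1 m) => h; first by rewrite /rho h ltnW 1?ltnW//; exact: rv.
have [h'|h'] := leqP m i.
  have -> : i = m + (i - m) by lia.
  by rewrite -!addnS !rhoE => /rinj; lia.
have em : m = i.+1 by lia.
have -> : i.+2 = m + 1 by lia.
rewrite rhoE /rho ifT; last lia.
move=> e; have : m <= i; last lia.
apply: minm; exists v, (j + 1); split=> //; [|by rewrite v0].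
by move=> l hl; apply: wv; lia.
Qed.

Lemma end_of_tail r u n j : (forall i, u (n + i) = r (j + i)) -> end_of G u = end_of G r.
Proof.
have half r' u' n' j' v : (forall i, u' (n' + i) = r' (j' + i)) -> end_equiv G u' v -> end_equiv G r' v.
  move=> e h S fS; have [N hN] := h S fS; exists (N + n' + j') => a b ha hb.
  have -> : a = j' + (a - j') by lia.
  by rewrite -e; apply: hN; lia.
move=> e; apply/seteqP; split=> v [rv ev]; split=> //; first exact: half e ev.
by apply: (half u r j n _ _ ev) => i; rewrite e.
Qed.

Lemma ray_end_of u : geodesic_ray u -> end_of G u u.
Proof.
move=> gu; have [wu ru] := gu; have iu := geodesic_ray_inj gu; split; first by split.
move=> S fS.
have /choice[phi hphi] : forall x, exists n, forall k, x = u k -> k = n.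
  move=> x; have [[k ->]|h] := EM (exists k, x = u k); first by exists k => l /iu.
  by exists 0 => k e; case: h; exists k.
have [N hN] := finite_bounded phi fS.
have out n : N <= n -> (~` S) (u n).
  by move=> Nn Su; have := hN _ Su; rewrite -(hphi _ n erefl) ltnNge Nn.
have ind n : N <= n -> Defs.induced G (~` S) (u n) (u n.+1).
  move=> Nn; rewrite /Defs.induced wu !andbT.
  by apply/andP; split; rewrite inE; apply: out => //; exact: leqW.
have indC n : N <= n -> Defs.induced G (~` S) (u n.+1) (u n).
  by move=> /ind /and3P[h1 h2 h3]; apply/and3P; split=> //; exact: adjC.
exists N => m n hm hn; split; [exact: out|exact: out|apply/reachableP].
case: (leqP m n) => mn.
  exists (fun i => u (m + i)), (n - m); split; rewrite ?addn0 ?subnKC// => i hi.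
  by rewrite addnS; apply: ind; lia.
exists (fun i => u (m - i)), (m - n); split; rewrite ?subn0//; last by congr u; lia.
move=> i hi; have -> : m - i = (m - i.+1).+1 by lia.
by apply: indC; lia.
Qed.

(** Away from [x], at most one infinite direction continues a ray, so its first step determines it.
    The two ends differ because the reduced walk between the two rays passes [x]. *)
Lemma ends_of_line x a b : unbounded x a -> unbounded x b -> a <> b ->
  (forall y p q r, reachable G x y -> unbounded y p -> unbounded y q -> unbounded y r ->
     [\/ p = q, p = r | q = r]) ->
  exists E F, ends_of G (component G x) = [set E; F] /\ E <> F.
Proof.
move=> xa xb ab no3.
have [u [u0 u1 gu]] := unbounded_ray xa; have [w [w0 w1 gw]] := unbounded_ray xb.
have rch v : v 0 = x -> geodesic_ray v -> forall i, reachable G x (v i).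
  move=> v0 [wv _] i; apply/reachableP; exists v, i; split=> // k _; exact: wv.
have follow v rho : v 0 = x -> rho 0 = x -> rho 1 = v 1 -> geodesic_ray v -> geodesic_ray rho ->
    (exists c, c <> v 1 /\ unbounded x c) -> forall i, rho i = v i.
  move=> v0 r0 r1 gv gr [c [cv xc]].
  have sh n := ray_unbounded (geodesic_ray_shift n gv).
  have sh' n := ray_unbounded (geodesic_ray_shift n gr).
  have back i : unbounded (v i.+1) (v i).
    elim: i => [|i IH].
      by apply: (@unbounded_back (v 0) _ c); rewrite ?v0 -?v0//; [rewrite v0|case: gv].
    apply: (unbounded_back IH); first by case: gv.
    by case: gv.
  suff H i : rho i = v i /\ rho i.+1 = v i.+1 by move=> i; have [] := H i.
  elim: i => [|i [e1 e2]]; first by rewrite r0 v0 r1.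
  split=> //.
  have h1 := sh i.+1; have h2 := sh' i.+1; rewrite !addn0 !addn1 e2 in h1 h2.
  have [e|e|//] := no3 (v i.+1) (v i) (v i.+2) (rho i.+2) (rch v v0 gv i.+1) (back i) h1 h2.
    by have [_ /(_ i)] := gv.
  by have [_ /(_ i)] := gr; rewrite e1.
have end_uw r : ray G r -> reachable G x (r 0) -> end_of G r = end_of G u \/ end_of G r = end_of G w.
  move=> ryr xr; have [rho [n [j [gr r0 re]]]] := ray_from ryr xr.
  have xr1 : unbounded x (rho 1) by rewrite -r0; exact: ray_unbounded.
  have rch0 : reachable G x x by exists [::].
  have [//|e|e] := no3 x a b (rho 1) rch0 xa xb xr1.
    left; rewrite -(end_of_tail re); congr end_of; apply/funext.
    by apply: (follow u) => //; [rewrite u1|exists b; rewrite u1; split=> // /esym].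
  right; rewrite -(end_of_tail re); congr end_of; apply/funext.
  by apply: (follow w) => //; [rewrite w1|exists a; rewrite w1].
have ends_ray v : v 0 = x -> geodesic_ray v -> ends_of G (component G x) (end_of G v).
  move=> v0 gv; exists v; split=> //; last exact: rch.
  by split; [exact: geodesic_ray_inj|case: gv].
exists (end_of G u), (end_of G w); split.
  apply/seteqP; split=> [E [r [ryr cr ->]]|E [->|->]]; [|exact: ends_ray|exact: ends_ray].
  by have [->|->] := end_uw r ryr (cr 0); [left|right].
move=> e; have := ray_end_of gw; rewrite -e => -[_ /(_ [set x] (finite_set1 x))[N hN]].
have [_ _ /reachableP[v [n [wv v0 vn]]]] := hN N.+1 N.+1 (leqnSn N) (leqnSn N).
have wvG : walk G v n by move=> i /wv /and3P[].
have [t [k [kn [wt rt t0 tk ti]]]] := walk_reduce wvG.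
pose m := N.+1.
pose s i := if i <= m then u (m - i) else w (i - m).
have [gu1 gu2] := gu; have [gw1 gw2] := gw.
have ws : walk G s (m + m).
  move=> i hi; rewrite /s; case: (leqP i m) => h1; case: (leqP i.+1 m) => h2; try lia.
  - have -> : m - i = (m - i.+1).+1 by lia.
    exact/adjC/gu1.
  - have -> : i = m by lia.
    by rewrite subnn u0 -w0 subSnn.
  - by rewrite subSn; [exact: gw1|lia].
have rs : reduced s (m + m).
  move=> i hi; rewrite /s; case: (leqP i m) => h1; case: (leqP i.+2 m) => h2; try lia.
  - have -> : m - i = (m - i.+2).+2 by lia.
    exact/nesym/gu2.
  - have [?|?] : i = m \/ i.+1 = m by lia.
      have -> : m - i = 0 by lia.
      have -> : i.+2 - m = 2 by lia.
      by rewrite u0 -w0; exact: gw2.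
    have -> : m - i = 1 by lia.
    have -> : i.+2 - m = 1 by lia.
    by rewrite u1 w1.
  - have -> : i.+2 - m = (i - m).+2 by lia.
    exact: gw2.
have [||ek h] := reduced_walk_unique adjC forestG wt rt ws rs.
- by rewrite t0 v0 /s leq0n subn0.
- by rewrite tk vn /s ifN ?addnK//; rewrite -ltnNge /m; lia.
have tx : t m = x by rewrite h ?ek ?leq_addr// /s leqnn subnn.
have [|j jn vj] := ti m; first by rewrite ek /m; lia.
have /and3P[] := wv j ltac:(lia).
by rewrite inE -vj tx => /(_ erefl).
Qed.

Hypothesis ends0 : forall x, ~ (ends_of G (component G x) #= `I_0)%card.
Hypothesis ends2 : forall x, ~ (ends_of G (component G x) #= `I_2)%card.

Lemma unbounded_ex x : exists y, unbounded x y.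
Proof.
have [[E [r [ryr cr _]]]|h] := EM (ends_of G (component G x) !=set0).
  have [rho [n [j [gr r0 _]]]] := ray_from ryr (cr 0).
  by exists (rho 1); rewrite -r0; exact: ray_unbounded.
case: (@ends0 x); have -> : ends_of G (component G x) = set0.
  by apply/seteqP; split=> // E hE; apply: h; exists E.
by have -> : `I_0 = set0 :> set nat by apply/seteqP; split.
Qed.

(** Without a third infinite direction anywhere, [ends_of_line] would give exactly two ends;
    [core_walk] keeps the walk inside the core. *)
Lemma core_branch x : core x -> exists u n y z t, [/\ walk G u n, u 0 = x,
  forall i, i <= n -> core (u i), [/\ y <> z, y <> t & z <> t] &
  [/\ unbounded (u n) y, unbounded (u n) z & unbounded (u n) t]].
Proof.
move=> cx; have [a [b [ab xa xb]]] := cx.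
have [[y [p [q [r [/reachableP[u [n [wu u0 un]]] yp yq yr [pq [pr qr]]]]]]]|h] := EM (exists y p q r,
   [/\ reachable G x y, unbounded y p, unbounded y q, unbounded y r & p <> q /\ p <> r /\ q <> r]).
  have [v [m [_ [wv rv v0 vm _]]]] := walk_reduce wu.
  exists v, m, p, q, r; rewrite vm un; split=> //; first by rewrite v0.
  apply: core_walk => //; first by rewrite v0 u0.
  by rewrite vm un; exists p, q.
have [y p q r ry yp yq yr|E [F [eEF nEF]]] := ends_of_line xa xb ab.
  apply: contrapT => n; apply: h; exists y, p, q, r; split=> //.
  by split=> [e|]; [apply: n; apply: Or31|split=> e; apply: n; [apply: Or32|apply: Or33]].
case: (@ends2 x); rewrite eEF; apply/eq_cardSP; exists E; first by left.
have -> : [set E; F] `\ E = [set F]; last exact: card_set1.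
apply/seteqP; split=> [H [[->|->] nE]|H ->]; [by case: nE|by []|].
by split; [right|exact: nesym].
Qed.

End Ends.

(** * The corner graph *)

Section PairNat.
Context {d : measure_display} {X : measurableType d}.

Lemma bfun_measurable d' d'' (S : measurableType d') (T : measurableType d'') (f : S -> T) :
  bfun f <-> measurable_fun setT f.
Proof.
split=> [h _ B mB|h P mP]; first by rewrite setTI; exact: (h B mB).
by have := h measurableT P mP; rewrite setTI.
Qed.

Lemma mpred_pair_nat (P : X * nat -> Prop) : mpred P <-> forall n, mpred (fun v => P (v, n)).
Proof.
split=> [mP n|mP].
  have : bfun (fun v : X => (v, n)) by apply/bfun_measurable; exact: measurable_fun_pair.
  exact.
apply: (@mpred_ext _ _ (fun y => exists n, y.2 = n /\ P (y.1, n))) => [[v n]|].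
  by split=> [[m [/= <-]] //|Pvn]; exists n.
apply: mpred_ex => n; apply: mpred_and.
  have : bfun (@snd X nat) by apply/bfun_measurable; exact: measurable_snd.
  by move=> /(_ (fun m => m = n)); apply.
have : bfun (@fst X nat) by apply/bfun_measurable; exact: measurable_fst.
by move=> /(_ _ (mP n)).
Qed.

Lemma separating_pair_nat (O : nat -> set X) : separating O -> exists O' : nat -> set (X * nat), separating O'.
Proof.
move=> [mO sO]; exists (fun k y => match unpickle k : option (nat + nat) with
  | Some (inl i) => O i y.1 | Some (inr m) => y.2 = m | None => False end); split=> [k|[v n] [w m] ne].
  apply/mpred_pair_nat => n; case: unpickle => [[i|m]|].
  - exact: mO.
  - exact: (mpred_const (n = m)).
  - exact: (mpred_const False).
have [e|nvw] := EM (v = w); last first.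
  by have [k hk] := sO _ _ nvw; exists (pickle (inl k : nat + nat)); rewrite pickleK.
exists (pickle (inr n : nat + nat)); rewrite pickleK; split=> // e'.
by apply: ne; rewrite e; congr pair; rewrite /= in e'.
Qed.

End PairNat.

Section Corners.
Context {d : measure_display} {X : measurableType d} (G : rel X) (g : nat -> X -> X) (O : nat -> set X).
Hypothesis graphG : is_graph G.
Hypothesis locG : locally_finite G.
Hypothesis forestG : forest G.
Hypothesis bg : forall n, bfun (g n).
Hypothesis gG : forall n x, g n x <> x -> G x (g n x).
Hypothesis Gg : forall x y, G x y -> exists n, g n x = y.
Hypothesis sepO : separating O.

Lemma mpred_edge (f h : X -> X) : bfun f -> bfun h -> mpred (fun x => G (f x) (h x)).
Proof.
move=> bf bh; apply: (@mpred_ext _ _ (fun x => exists n, g n (f x) = h x /\ g n (f x) <> f x)) => [x|].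
  split=> [[n [<- /gG]]//|Gfh]; have [n e] := Gg Gfh; exists n; split=> //.
  by rewrite e; exact/nesym/(adj_neq graphG).
apply: mpred_ex => n; have bgf : bfun (fun x => g n (f x)) := bfun_comp bf (bg n).
by apply: mpred_and; [|apply: mpred_not]; apply: (mpred_eq sepO).
Qed.

Lemma mpred_unbounded (f h : X -> X) : bfun f -> bfun h -> mpred (fun x => unbounded G (f x) (h x)).
Proof.
move=> bf bh; apply: mpred_all => k; elim: k f h bf bh => [|k IH] f h bf bh /=.
  exact: mpred_edge.
apply: mpred_and; first exact: mpred_edge.
apply: (@mpred_ext _ _ (fun x => exists n, g n (h x) <> f x /\ ext G k (h x) (g n (h x)))) => [x|].
  split=> [[n ?]|[z [zf ez]]]; first by exists (g n (h x)).
  by have [n en] := Gg (ext_adj ez); exists n; rewrite en.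
apply: mpred_ex => n; have bgh : bfun (fun x => g n (h x)) := bfun_comp bh (bg n).
apply: mpred_and; last exact: IH.
by apply: mpred_not; apply: (mpred_eq sepO).
Qed.

Lemma mpred_core : mpred (core G).
Proof.
apply: (@mpred_ext _ _ (fun x => exists n m, g n x <> g m x /\ (unbounded G x (g n x) /\ unbounded G x (g m x)))) => [x|].
  split=> [[n [m [? [? ?]]]]|[y [z [yz xy xz]]]]; first by exists (g n x), (g m x).
  have [n en] := Gg (unbounded_adj xy); have [m em] := Gg (unbounded_adj xz).
  by exists n, m; rewrite en em.
apply: mpred_ex => n; apply: mpred_ex => m; apply: mpred_and.
  by apply: mpred_not; apply: (mpred_eq sepO).
by apply: mpred_and; apply: mpred_unbounded.
Qed.

(** Stands for the edge from [v] to [g n v] inside the core; minimality of [n] gives each such edge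
    a single corner at [v]. *)
Definition corner v n := [/\ core G v, core G (g n v), g n v <> v & forall m, m < n -> g m v <> g n v].

Definition cornerset (y : X * nat) := corner y.1 y.2.

Lemma mpred_corner n : mpred (fun v => corner v n).
Proof.
apply: (@mpred_ext _ _ (fun v => (core G v /\ core G (g n v)) /\ (g n v <> v /\ forall m, m < n -> g m v <> g n v))) => [v|].
  by split=> [[[? ?] []]|[]].
have mc := mpred_core.
apply: mpred_and; apply: mpred_and => //; first exact: (bg n).
  by apply: mpred_not; apply: (mpred_eq sepO).
apply: mpred_all => m; apply: mpred_imp; first exact: mpred_const.
by apply: mpred_not; apply: (mpred_eq sepO).
Qed.

Lemma corner_inj v n m : corner v n -> corner v m -> g n v = g m v -> n = m.
Proof.
move=> [_ _ _ hn] [_ _ _ hm] e; case: (ltngtP n m) => // l.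
  by case: (hm _ l).
by case: (hn _ l).
Qed.

Lemma corner_ex v w : core G v -> core G w -> G v w -> exists n, corner v n /\ g n v = w.
Proof.
move=> cv cw vw; have [n [en mn]] := ex_least (Gg vw); exists n; split=> //; split=> //.
- by rewrite en.
- by rewrite en; exact/nesym/(adj_neq graphG).
- by move=> m mn'; rewrite en => /mn; rewrite leqNgt mn'.
Qed.

Lemma corner_adj v n : corner v n -> G v (g n v).
Proof. by move=> [_ _ /gG]. Qed.

Definition swp (y z : X * nat) := [/\ cornerset y, cornerset z, g y.2 y.1 = z.1 & g z.2 z.1 = y.1].

Definition nxt v n m := [/\ corner v n, corner v m, n < m & forall k, n < k < m -> ~ corner v k].

(** A vertex becomes the path of its corners in increasing order, and an edge joins its two corners;
    hence degree at most 3. *)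
Definition cadj (y z : X * nat) := swp y z \/ (y.1 = z.1 /\ (nxt y.1 y.2 z.2 \/ nxt y.1 z.2 y.2)).

Lemma swp_sym y z : swp y z -> swp z y. Proof. by case. Qed.

Lemma swp_ex v n : corner v n -> exists m, swp (v, n) (g n v, m).
Proof.
move=> c; have [cv cw _ _] := c; have [m [cm em]] := corner_ex cw cv (adjC graphG (corner_adj c)).
by exists m; split.
Qed.

Lemma swp_det y z z' : swp y z -> swp y z' -> z = z'.
Proof.
move: z z' => [w m] [w' m'] [_ cz /= ew e] [_ cz' /= ew' e']; subst w w'; congr pair.
by apply: (@corner_inj _ _ _ cz cz'); rewrite /= e e'.
Qed.

Lemma cadj_sym y z : cadj y z -> cadj z y.
Proof.
move=> [/swp_sym|[e h]]; first by left.
by right; rewrite -e; split=> //; case: h; [right|left].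
Qed.

Lemma nxt_injl v a a' m : nxt v a m -> nxt v a' m -> a = a'.
Proof.
move=> [ca _ am ha] [ca' _ am' ha']; case: (ltngtP a a') => // l.
  by case: (ha a'); rewrite ?l.
by case: (ha' a); rewrite ?l.
Qed.

Lemma nxt_injr v a m m' : nxt v a m -> nxt v a m' -> m = m'.
Proof.
move=> [_ ca am ha] [_ ca' am' ha']; case: (ltngtP m m') => // l.
  by case: (ha' m); rewrite ?l ?am.
by case: (ha m'); rewrite ?l ?am'.
Qed.

Lemma nxt_up v n m : corner v n -> corner v m -> n < m -> exists k, nxt v n k.
Proof.
move=> cn cm nm; have [|k [[nk ck] mk]] := @ex_least (fun k => n < k /\ corner v k).
  by exists m.
by exists k; split=> // l /andP[nl lk] cl; have := mk l (conj nl cl); rewrite leqNgt lk.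
Qed.

Lemma nxt_down v n m : corner v n -> corner v m -> m < n -> exists k, nxt v k n.
Proof.
move=> cn cm mn; have [|l [[ln cl] ml]] := @ex_least (fun l => l < n /\ corner v (n - l.+1)).
  by exists (n - m.+1); split; [lia|have -> : n - (n - m.+1).+1 = m by lia].
exists (n - l.+1); split=> //; first lia.
move=> k hk ck; have := ml (n - k.+1); have -> : n - (n - k.+1).+1 = k by lia.
have h : n - k.+1 < n by lia.
by move=> /(_ (conj h ck)); lia.
Qed.

Lemma cadj_ne y z : cadj y z -> y <> z.
Proof.
move=> [[_ [_ _ h _] e _]|[_ h]] eyz; subst z; first by case: h.
by case: h => -[_ _]; rewrite ltnn.
Qed.

(* Corners project to the walk [p] of vertices visited so far; [b] is the corner
   through which the current vertex was entered. *)
Let track (u : nat -> X * nat) i := exists p k b,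
  [/\ walk G p k, reduced p k, p 0 = (u 0).1, p k = (u i).1 &
   [/\ k = 0 -> b = (u 0).2, 0 < k -> g b (u i).1 = p k.-1 /\ corner (u i).1 b &
    [\/ (u i).2 = b /\ (i = 0 /\ k = 0 \/ exists i', [/\ i = i'.+1, 0 < k & swp (u i') (u i)]),
        b < (u i).2 /\ exists i', [/\ i = i'.+1, (u i').1 = (u i).1 & nxt (u i).1 (u i').2 (u i).2] |
        (u i).2 < b /\ exists i', [/\ i = i'.+1, (u i').1 = (u i).1 & nxt (u i).1 (u i).2 (u i').2]]]].

(** Within one vertex a reduced walk runs along the path of corners in one direction, so it leaves
    through another edge than the one it came by, and its projection is reduced. *)
Lemma track_walk u n : walk cadj u n -> reduced u n -> forall i, i <= n -> track u i.
Proof.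
move=> wu ru; elim=> [_|i IH hi].
  exists (fun=> (u 0).1), 0, (u 0).2; split=> //; split=> //.
  by apply: Or31; split=> //; left.
have [p [k [b [wp rp p0 pk [k0 kpos st]]]]] := IH (ltnW hi).
have nback i' : i = i'.+1 -> u i' <> u i.+1 by move=> ei; rewrite ei; apply: ru; rewrite -ei.
have [sw|[ev nx]] := wu i hi.
  have [ci cS e1 e2] := sw.
  have kb : 0 < k -> (u i).2 <> b.
    move=> kp; case: st => [[_ [[_ k00]|[i' [ei _ sw']]]]|[lt _]|[lt _]].
    - by rewrite k00 in kp.
    - by case: (nback _ ei); apply: swp_det (swp_sym sw') sw.
    - lia.
    - lia.
  exists (fun j => if j <= k then p j else (u i.+1).1), k.+1, (u i.+1).2; split.
  - move=> j; rewrite ltnS => hj; rewrite hj; case: ltnP => hjk; first exact: wp.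
    have -> : j = k by lia.
    by rewrite pk -e1; exact: corner_adj.
  - move=> j hj; rewrite (_ : j <= k); last lia.
    case: ltnP => hjk; first exact: rp.
    have ej : j = k.-1 by lia.
    have kp : 0 < k by lia.
    have [gb cb] := kpos kp; rewrite ej -gb -e1 => eg.
    by apply: (kb kp); apply: (corner_inj ci cb); rewrite eg.
  - by rewrite leq0n.
  - by rewrite ltnn.
  split=> // [_|]; first by rewrite leqnn pk.
  by apply: Or31; split=> //; right; exists i.
exists p, k, b; rewrite -ev; split=> //; split=> //.
case: nx => nx; have [c1 c2 lt _] := nx.
  case: st => [[eb _]|[ltb _]|[ltb [i' [ei ei' nx']]]].
  - by apply: Or32; rewrite -eb; split=> //; exists i; split.
  - by apply: Or32; split; [lia|exists i; split].
  - case: (nback _ ei); rewrite [u i']surjective_pairing [u i.+1]surjective_pairing.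
    by rewrite ei' ev (nxt_injr nx' nx) -ev.
case: st => [[eb _]|[ltb [i' [ei ei' nx']]]|[ltb _]].
- by apply: Or33; rewrite -eb; split=> //; exists i; split.
- case: (nback _ ei); rewrite [u i']surjective_pairing [u i.+1]surjective_pairing.
  by rewrite ei' ev (nxt_injl nx' nx) -ev.
- by apply: Or33; split; [lia|exists i; split].
Qed.

(** Either the projection is a closed reduced walk of [G], or the walk stays at one vertex and its
    index moves strictly to one side. *)
Lemma forest_cadj : forest cadj.
Proof.
move=> u n n0 wu ru e; have [p [k [b [wp rp p0 pk [k0 kpos st]]]]] := track_walk wu ru (leqnn n).
have [kz|kp] := posnP k; last by apply: (forestG kp wp rp); rewrite p0 pk e.
case: st => [[_ [[n00 _]|[i' [_ kp _]]]]|[]|[]].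
- by rewrite n00 in n0.
- by rewrite kz in kp.
- by rewrite (k0 kz) e ltnn.
- by rewrite (k0 kz) e ltnn.
Qed.


Lemma mpred_nxt n m : mpred (fun v => nxt v n m).
Proof.
apply: (@mpred_ext _ _ (fun v => corner v n /\ (corner v m /\ (n < m /\ forall k, n < k < m -> ~ corner v k)))) => [v|].
  by split=> [[? [? []]]|[]].
apply: mpred_and; first exact: mpred_corner.
apply: mpred_and; first exact: mpred_corner.
apply: mpred_and; first exact: mpred_const.
apply: mpred_all => k; apply: mpred_imp; first exact: mpred_const.
by apply: mpred_not; exact: mpred_corner.
Qed.

Lemma mpred_swp n m : mpred (fun v => swp (v, n) (g n v, m)).
Proof.
apply: (@mpred_ext _ _ (fun v => corner v n /\ (corner (g n v) m /\ g m (g n v) = v))) => [v|].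
  by split=> [[? []]|[]].
apply: mpred_and; first exact: mpred_corner.
apply: mpred_and; first exact: (bg n (mpred_corner m)).
have bgg : bfun (fun v => g m (g n v)) := bfun_comp (bg n) (bg m).
exact: (mpred_eq sepO).
Qed.

Lemma bfun_pair_nat (F : nat -> X -> X) (J : nat -> X -> nat) (C : nat -> X -> Prop) :
  (forall n, bfun (F n)) -> (forall n m, mpred (fun v => J n v = m)) -> (forall n, mpred (C n)) ->
  bfun (fun y : X * nat => if pselect (C y.2 y.1) then (F y.2 y.1, J y.2 y.1) else y).
Proof.
move=> bF mJ mC; rewrite /bfun => P /mpred_pair_nat mP; apply/mpred_pair_nat => n.
apply: (@mpred_ext _ _ (fun v => (C n v /\ exists m, J n v = m /\ P (F n v, m)) \/ (~ C n v /\ P (v, n)))) => [v|].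
  rewrite /=; case: pselect => c; split.
  - by move=> [[_ [m [-> //]]]|[]].
  - by move=> Pv; left; split=> //; exists (J n v).
  - by move=> [[]|[]].
  - by right.
apply: mpred_or; apply: mpred_and => //; last exact: mpred_not.
apply: mpred_ex => m; apply: mpred_and => //; exact: (bF n _ (mP m)).
Qed.

Lemma corner_moves : exists e : 'I_3 -> X * nat -> X * nat,
  (forall j, bfun (e j)) /\ forall y z, adj e y z <-> cadj y z.
Proof.
have sel (P : nat -> nat -> X -> Prop) : (forall n m, mpred (P n m)) -> exists J : nat -> X -> nat,
    (forall n m, mpred (fun v => J n v = m)) /\ forall n v, (exists m, P n m v) -> P n (J n v) v.
  move=> mP; have /choice[J hJ] : forall n, exists J : X -> nat, (forall m, mpred (fun v => J v = m)) /\
      forall v, (exists m, P n m v) -> P n (J v) v.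
    by move=> n; exact: (mselect 0 (mP n)).
  by exists J; split=> n; have [] := hJ n.
have [J0 [mJ0 J0P]] := sel (fun n m v => swp (v, n) (g n v, m)) mpred_swp.
have [J1 [mJ1 J1P]] := sel (fun n m v => nxt v n m) mpred_nxt.
have [J2 [mJ2 J2P]] := sel (fun n m v => nxt v m n) (fun n m => mpred_nxt m n).
pose C1 n v := exists m, nxt v n m.
pose C2 n v := exists m, nxt v m n.
have mC1 n : mpred (C1 n) by apply: (@mpred_ex _ _ _ (fun m v => nxt v n m)) => m; exact: mpred_nxt.
have mC2 n : mpred (C2 n) by apply: (@mpred_ex _ _ _ (fun m v => nxt v m n)) => m; exact: mpred_nxt.
pose e0 (y : X * nat) := if pselect (corner y.1 y.2) then (g y.2 y.1, J0 y.2 y.1) else y.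
pose e1 (y : X * nat) := if pselect (C1 y.2 y.1) then (y.1, J1 y.2 y.1) else y.
pose e2 (y : X * nat) := if pselect (C2 y.2 y.1) then (y.1, J2 y.2 y.1) else y.
exists (fun j => match val j with 0 => e0 | 1 => e1 | _ => e2 end); split.
  have b0 : bfun e0 by apply: (bfun_pair_nat bg mJ0 mpred_corner).
  have b1 : bfun e1.
    apply: (bfun_pair_nat (F := fun _ => id) (C := C1) _ mJ1) => n; [by move=> P|exact: mC1].
  have b2 : bfun e2.
    apply: (bfun_pair_nat (F := fun _ => id) (C := C2) _ mJ2) => n; [by move=> P|exact: mC2].
  by case=> -[|[|]].
have e0P v n w m : cadj (v, n) (w, m) <-> [\/ swp (v, n) (w, m), v = w /\ nxt v n m | v = w /\ nxt v m n].
  split; first by move=> [?|[/= e [?|?]]]; [apply: Or31|apply: Or32|apply: Or33].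
  by case=> [?|[? ?]|[? ?]]; [left|right; split=> //; left|right; split=> //; right].
move=> [v n] [w m]; split.
  move=> [ne [[i hj]]]; case: i hj => [|[|[|a]]] hj //=.
  - rewrite /e0 /=; case: pselect => // c [ew em]; left; have := J0P n v (swp_ex c).
    by rewrite ew em.
  - rewrite /e1 /=; case: pselect => // c [ew em]; right; split=> //; left.
    by have := J1P n v c; rewrite em.
  - rewrite /e2 /=; case: pselect => // c [ew em]; right; split=> //; right.
    by have := J2P n v c; rewrite em.
move=> c; split; first exact: cadj_ne c.
have /e0P[s|[ev nx]|[ev nx]] := c.
- exists (@Ordinal 3 0 isT); rewrite /= /e0 /=; have [cv _ /= gw _] := s.
  case: pselect => // cc; apply: (swp_det (y := (v, n))) => //; apply: J0P.
  by exists m; rewrite gw.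
- exists (@Ordinal 3 1 isT); rewrite /= /e1 /=; case: pselect => [cc|[]]; last by exists m.
  by rewrite -ev (nxt_injr (J1P n v cc) nx).
- exists (@Ordinal 3 2 isT); rewrite /= /e2 /=; case: pselect => [cc|[]]; last by exists m.
  by rewrite -ev (nxt_injl (J2P n v cc) nx).
Qed.

Hypothesis ends0 : forall x, ~ (ends_of G (component G x) #= `I_0)%card.
Hypothesis ends2 : forall x, ~ (ends_of G (component G x) #= `I_2)%card.

Section Moves.
Variable e : 'I_3 -> X * nat -> X * nat.
Hypothesis eP : forall y z, adj e y z <-> cadj y z.

Let reach y z := exists k, rch e k cornerset (eq z) y.

Lemma reach_refl y : reach y y. Proof. by exists 0. Qed.

Lemma reach_trans x y z : reach x y -> reach y z -> reach x z.
Proof. by move=> [k rk]; exact: rch_via rk. Qed.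

Lemma reach_adj y z : cornerset y -> cadj y z -> reach y z.
Proof. by move=> cy /eP[ne [j ej]]; exists 1; split=> //; exists j; rewrite ej; split=> //; exact: nesym. Qed.

Lemma reach_inner v n m : corner v n -> corner v m -> reach (v, n) (v, m).
Proof.
have H k a b : corner v a -> corner v b -> `|a - b|%N < k -> reach (v, a) (v, b).
  elim: k a b => // k IH a b ca cb.
  case: (ltngtP a b) => [l|l|-> _]; last exact: reach_refl.
    move=> hk; have [c nc] := nxt_up ca cb l; have [_ cc ac hc] := nc.
    apply: (@reach_trans _ (v, c)); first by apply: reach_adj => //; right; split=> //; left.
    have cb' : c <= b by rewrite leqNgt; apply/negP => h; apply: (hc b); rewrite ?l.
    by apply: IH => //; lia.
  move=> hk; have [c nc] := nxt_down ca cb l; have [cc _ ac hc] := nc.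
  apply: (@reach_trans _ (v, c)); first by apply: reach_adj => //; right; split=> //; right.
  have cb' : b <= c by rewrite leqNgt; apply/negP => h; apply: (hc b); rewrite ?l ?h.
  by apply: IH => //; lia.
by move=> cn cm; exact: (H _ n m cn cm (ltnSn _)).
Qed.

Lemma reach_walk u k n : walk G u k -> (forall i, i <= k -> core G (u i)) -> corner (u 0) n ->
  exists m, corner (u k) m /\ reach (u 0, n) (u k, m).
Proof.
elim: k => [|k IH] wu cu cn; first by exists n; split=> //; exact: reach_refl.
have [||//|m [cm rm]] := IH.
- by move=> i hi; apply: wu; exact: ltnW.
- by move=> i hi; apply: cu; exact: ltnW.
have [m' [cm' em']] := corner_ex (cu k (leqnSn k)) (cu k.+1 (leqnn _)) (wu k (ltnSn k)).
have [l sl] := swp_ex cm'; rewrite em' in sl; exists l; split; first by case: sl.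
apply: reach_trans rm _; apply: (reach_trans (reach_inner cm cm')).
by apply: reach_adj => //; left.
Qed.

Lemma good_corners : good e cornerset.
Proof.
split.
- by apply/mpred_pair_nat => n; exact: mpred_corner.
- move=> [v n] c; have [m sw] := swp_ex c; have [cv _ _ _] := c.
  have [_ cw _ _] := sw.
  have [w [nw vw]] := core_other (g n v) cv.
  have [k [ck ek]] := corner_ex cv (unbounded_core graphG locG cv vw) (unbounded_adj vw).
  have nk : n <> k by move=> h; apply: nw; rewrite h ek.
  have [l [nx cl]] : exists l, cadj (v, n) (v, l) /\ corner v l.
    case: (ltngtP n k) => // h.
      by have [l nl] := nxt_up c ck h; exists l; split; [right; split=> //; left|case: nl].
    by have [l nl] := nxt_down c ck h; exists l; split; [right; split=> //; right|case: nl].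
  exists (g n v, m), (v, l); split=> //; [|by apply/eP; left|exact/eP].
  by move=> [h _]; have [_ _ h' _] := c.
move=> [v n] c; have [cv _ _ _] := c.
have [u [k [y [z [t [wu u0 cu [yz yt zt] [uy uz ut]]]]]]] := core_branch graphG locG forestG ends2 cv.
have [m [cm rm]] := reach_walk wu cu (n := n) (eq_ind_r (fun x => corner x n) c u0).
have cuk := cu k (leqnn k).
have idx w : unbounded G (u k) w -> exists i, corner (u k) i /\ g i (u k) = w.
  by move=> uw; apply: corner_ex => //; [exact: (unbounded_core graphG locG cuk uw)|exact: unbounded_adj].
have [i [ci gi]] := idx _ uy; have [j [cj gj]] := idx _ uz; have [l [cl gl]] := idx _ ut.
have ij : i <> j by move=> h; apply: yz; rewrite -gi -gj h.
have il : i <> l by move=> h; apply: yt; rewrite -gi -gl h.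
have jl : j <> l by move=> h; apply: zt; rewrite -gj -gl h.
(* The middle one of three corners has a corner on either side; with the other end of its edge it
   has degree 3. *)
have [a [b [c' [ca cb cc' ab bc]]]] : exists a b c', [/\ corner (u k) a, corner (u k) b,
    corner (u k) c', a < b & b < c'].
  case: (ltngtP i j) => // h1; case: (ltngtP i l) => // h2; case: (ltngtP j l) => // h3; try lia.
  - by exists i, j, l.
  - by exists i, l, j.
  - by exists l, i, j.
  - by exists j, i, l.
  - by exists j, l, i.
  - by exists l, j, i.
have [q nq] := nxt_up cb cc' bc; have [p np] := nxt_down cb ca ab.
have [r sr] := swp_ex cb.
have [N rN] := reach_trans rm (reach_inner cm cb).
rewrite u0 in rN; exists N; apply: rch_sub rN => // _ <-.
have [_ cq bq _] := nq; have [cp _ pb _] := np; have [_ cr _ _] := sr.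
apply: (@three_branch _ _ e cornerset (u k, b) (u k, p) (u k, q) (g b (u k), r)) => //.
- by apply/eP; right; split=> //; right.
- by apply/eP; right; split=> //; left.
- by apply/eP; left.
- by move=> [h]; lia.
- by move=> [h _]; have [_ _ h' _] := cb; apply: h'.
- by move=> [h _]; have [_ _ h' _] := cb; apply: h'.
Qed.

End Moves.
End Corners.

(** * Iteration and descent from corners to vertices *)

Section Iterate.
Context {d : measure_display} {Y : measurableType d} (e : 'I_3 -> Y -> Y) (O : nat -> set Y).
Hypothesis me : forall j, bfun (e j).
Hypothesis sepO : separating O.
Hypothesis symadj : forall x y, adj e x y -> adj e y x.
Hypothesis fadj : forest (adj e).

(** The criterion for choosing among the [rounds] possible deletions at stage [n], to be
    instantiated by a loss of measure or of category. *)
Variable select : nat -> (Y -> Prop) -> (Y -> Prop) -> Prop.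
Hypothesis selectP : forall n A (A' : 'I_rounds -> Y -> Prop), mpred A ->
  (forall i, mpred (A' i) /\ forall x, A' i x -> A x) ->
  (forall x, A x -> exists i, ~ A' i x) -> exists i, select n A (A' i).

Lemma iterate_removal A0 : good e A0 -> exists (A : nat -> Y -> Prop) (J : nat -> Y -> 'I_3),
  A 0 = A0 /\ forall n, [/\ mpred (A n), forall x, A n.+1 x -> A n x,
    onto e (A n) (A n.+1) (J n) & select n (A n) (A n.+1)].
Proof.
move=> gA0.
have /choice[F hF] : forall nA : nat * (Y -> Prop), exists A'J : (Y -> Prop) * (Y -> 'I_3),
    good e nA.2 -> [/\ good e A'J.1, forall x, A'J.1 x -> nA.2 x, onto e nA.2 A'J.1 A'J.2 &
      select nA.1 nA.2 A'J.1].
  move=> [n A] /=; have [gA|ngA] := EM (good e A); last by exists (A, fun=> ord0).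
  have mA : mpred A by case: gA.
  have [A' [J [h1 h2]]] := good_removal me sepO symadj fadj mA gA.
  have [|i si] := @selectP n A A' mA _ h2.
    by move=> i; have [[mA' _ _] sA' _] := h1 i.
  by exists (A' i, J i) => _; have [] := h1 i.
pose A := fix A n := if n is n'.+1 then (F (n', A n')).1 else A0.
have gA n : good e (A n).
  by elim: n => //= n IH; have [] := hF (n, A n) IH.
exists A, (fun n => (F (n, A n)).2); split=> // n.
have [_ h1 h2 h3] := hF (n, A n) (gA n); split=> //.
by have [] := gA n.
Qed.

(** The map of stage [n] has its values in [A n], so along a backward orbit the stage of deletion
    never increases. Once it is constant, the orbit contradicts one-endedness of that stage. *)
Lemma assemble (A : nat -> Y -> Prop) (J : nat -> Y -> 'I_3) :
  (forall n, [/\ mpred (A n), forall x, A n.+1 x -> A n x & onto e (A n) (A n.+1) (J n)]) ->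
  exists J' : Y -> 'I_3, onto e (A 0) (fun x => forall n, A n x) J'.
Proof.
move=> hA.
have mono n m x : n <= m -> A m x -> A n x.
  move=> /subnK <-; elim: (m - n) => //= k IH; rewrite addSn.
  by have [_ h _] := hA (k + n) => /h /IH.
pose P j x := exists n, (A n x /\ ~ A n.+1 x) /\ J n x = j.
have mP j : mpred (P j).
  apply: mpred_ex => n; have [mA _ [mJ _ _]] := hA n; have [mA' _ _] := hA n.+1.
  by apply: mpred_and => //; apply: mpred_and => //; exact: mpred_not.
have [J' [mJ' J'P]] := mselect ord0 mP.
have lev x : A 0 x -> ~ (forall n, A n x) -> exists n, A n x /\ ~ A n.+1 x.
  move=> A0x /existsNP[n nA]; have [[|k] [nk mk]] := @ex_least (fun n => ~ A n x) (ex_intro _ n nA) => //.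
  exists k; split=> //; apply: contrapT => nAk; have := mk k nAk; lia.
have uniq x n m : A n x -> ~ A n.+1 x -> A m x -> ~ A m.+1 x -> n = m.
  move=> h1 h2 h3 h4; case: (ltngtP n m) => // l.
    by case: h2; apply: mono h3.
  by case: h4; apply: mono h1.
have J'E x n : A n x -> ~ A n.+1 x -> J' x = J n x.
  move=> h1 h2; have [m [[h3 h4] <-]] : P (J' x) x by apply: J'P; exists (J n x), n.
  by rewrite (uniq x n m).
exists J'; split=> // [x A0x /(lev x A0x)[n [h1 h2]]|[u hu]].
  have [_ _ [_ h _]] := hA n; rewrite (J'E x n)//; have [ne An] := h x h1 h2.
  by split=> //; exact: mono An.
have /choice[L hL] : forall i, exists n, A n (u i.+1) /\ ~ A n.+1 (u i.+1).
  by move=> i; apply: lev; have [[]] := hu i.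
have Ldec i : L i.+1 <= L i.
  have [h1 h2] := hL i.+1; have [h3 h4] := hL i.
  have [_ eu] := hu i.+1; have [_ _ [_ h _]] := hA (L i.+1).
  have [_] := h _ h1 h2; rewrite -(J'E _ _ h1 h2) eu => h5.
  rewrite leqNgt; apply/negP => l; apply: h4; exact: mono h5.
have [l [[i ei] ml]] := @ex_least (fun l => exists i, L i = l) (ex_intro _ (L 0) (ex_intro _ 0 erefl)).
have Lc k : L (i + k) = l.
  apply/eqP; rewrite eqn_leq; apply/andP; split; last by apply: ml; exists (i + k).
  by elim: k => [|k IH]; [rewrite addn0 ei|rewrite addnS; apply: leq_trans IH].
have [_ _ [_ _ noc]] := hA l; apply: noc; exists (fun k => u (i + k).+1) => k.
have [h1 h2] := hL (i + k.+1); rewrite Lc in h1 h2.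
have [_ eu] := hu (i + k.+1); rewrite addnS in h1 h2 eu *; split=> //.
by rewrite -(J'E _ _ h1 h2).
Qed.

End Iterate.

(** * Descent of a one-ended function from corners to vertices *)

Section PushDown.
Context {d : measure_display} {X : measurableType d} (G : rel X) (g : nat -> X -> X) (O : nat -> set X).
Hypothesis graphG : is_graph G.
Hypothesis locG : locally_finite G.
Hypothesis bg : forall n, bfun (g n).
Hypothesis gG : forall n x, g n x <> x -> G x (g n x).
Hypothesis Gg : forall x y, G x y -> exists n, g n x = y.
Hypothesis sepO : separating O.
Hypothesis ends0 : forall x, ~ (ends_of G (component G x) #= `I_0)%card.
Variable e : 'I_3 -> X * nat -> X * nat.
Hypothesis be : forall j, bfun (e j).
Hypothesis eP : forall y z, adj e y z <-> cadj G g y z.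
Variables (Ainf : X * nat -> Prop) (J : X * nat -> 'I_3).
Hypothesis mAinf : mpred Ainf.
Hypothesis ontoJ : onto e (cornerset G g) Ainf J.

Let F y := e (J y) y.
Let dom y := cornerset G g y /\ ~ Ainf y.

Let back := fix back k y : Prop := if k is k'.+1 then
  exists j, [/\ e j y <> y, dom (e j y), F (e j y) = y & back k' (e j y)] else True.

Lemma dom_F y : dom y -> adj e y (F y).
Proof. by move=> [cy nA]; have [_ /(_ y cy nA)[ne _] _] := ontoJ; exact: adj_e. Qed.

Lemma back_le k m y : back m y -> k <= m -> back k y.
Proof.
elim: m k y => [|m IH] [|k] y //= [j [h1 h2 h3 h4]] km.
by exists j; split=> //; exact: IH h4 km.
Qed.

Lemma back_F k y : dom y -> back k y -> back k.+1 (F y).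
Proof.
move=> dy bk; have [ne [j ej]] := (eP _ _).2 (cadj_sym ((eP _ _).1 (dom_F dy))).
by exists j; rewrite ej; split=> //; exact: nesym.
Qed.

(** Preimages are found among three moves, so by compactness arbitrarily long chains would give an
    infinite one, against one-endedness. *)
Lemma back_fin y : exists k, ~ back k y.
Proof.
apply: contrapT => /forallNP h.
have hb k : back k y by apply: contrapT; exact: h.
have step z : (forall k, back k z) -> exists j, [/\ dom (e j z), F (e j z) = z & forall k, back k (e j z)].
  move=> bz; apply: contrapT => /forallNP n.
  have /choice[K hK] : forall j, exists k, ~ (dom (e j z) /\ F (e j z) = z /\ back k (e j z)).
    move=> j; apply: contrapT => /forallNP n'; apply: (n j).
    have n2 k : dom (e j z) /\ F (e j z) = z /\ back k (e j z) by apply: contrapT; exact: n'.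
    by have [? [? _]] := n2 0; split=> // k; have [_ []] := n2 k.
  have [j [_ h2 h3 h4]] := bz (\max_j K j).+1.
  by apply: (hK j); split=> //; split=> //; apply: back_le h4 _; exact: leq_bigmax.
have /choice[N hN] : forall z, exists z', (forall k, back k z) -> [/\ dom z', F z' = z & forall k, back k z'].
  by move=> z; have [/step[j hj]|n] := EM (forall k, back k z); [exists (e j z)|exists z].
pose u := fix u n := if n is n'.+1 then N (u n') else y.
have hu n : forall k, back k (u n) by elim: n => //= n IH; have [] := hN (u n) IH.
have [_ _ noc] := ontoJ; apply: noc; exists u => i.
by have [] := hN (u i) (hu i).
Qed.

Lemma mpred_back k : mpred (back k).
Proof.
have md : mpred dom.
  apply: mpred_and; last exact: mpred_not.
  by apply/mpred_pair_nat => n; apply: (mpred_corner graphG bg gG Gg sepO).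
have [Oy sOy] := separating_pair_nat sepO.
have bF : bfun F.
  rewrite /bfun => P mP; apply: (@mpred_ext _ _ (fun y => exists j, J y = j /\ P (e j y))) => [y|].
    by split=> [[j [<- //]]|h]; exists (J y).
  apply: mpred_ex => j; have [mJ _ _] := ontoJ; apply: mpred_and; [exact: mJ|exact: be].
elim: k => [|k IH] /=; first exact: mpred_const.
apply: mpred_ex => j.
apply: (@mpred_ext _ _ (fun y => (e j y <> y /\ dom (e j y)) /\ (F (e j y) = y /\ back k (e j y)))) => [y|].
  by split=> [[[? ?] []]|[]].
apply: mpred_and; apply: mpred_and.
- by apply: mpred_not; apply: (mpred_eq sOy).
- exact: (be j).
- by apply: (mpred_eq sOy (f := fun y => F (e j y)) (g := id)) => //; exact: (bfun_comp (be j) bF).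
- exact: (be j).
Qed.

Let best n v := corner G g v n /\ forall m, corner G g v m -> forall k, back k (v, m) -> back k (v, n).

Lemma corner_bound v : exists N, forall n, corner G g v n -> n < N.
Proof.
have /choice[phi hphi] : forall w, exists n, forall m, corner G g v m -> g m v = w -> m = n.
  move=> w; have [[n [cn en]]|h] := EM (exists n, corner G g v n /\ g n v = w).
    by exists n => m cm em; apply: (corner_inj cm cn); rewrite em en.
  by exists 0 => m cm em; case: h; exists m.
have [N hN] := finite_bounded phi (locG v); exists N => n cn.
by rewrite (hphi (g n v) n cn erefl); apply: hN; exact: (corner_adj gG cn).
Qed.

Lemma best_ex v : core G v -> exists n K, [/\ best n v, back K (v, n) &
  forall m, corner G g v m -> ~ back K.+1 (v, m)].
Proof.
move=> cv; have [N hN] := corner_bound v.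
have /choice[r hr] : forall m, exists k, ~ back k (v, m) by move=> m; exact: back_fin.
have [|[|K] [hK mK]] := @ex_least (fun K => forall m, corner G g v m -> ~ back K (v, m)).
- exists (\max_(i < N) r i) => m cm bm; apply: (hr m); apply: back_le bm _.
  exact: (leq_bigmax (Ordinal (hN m cm))).
- have [w [_ vw]] := core_other v cv.
  have [m [cm _]] := corner_ex graphG Gg cv (unbounded_core graphG locG cv vw) (unbounded_adj vw).
  by case: (hK m cm).
have [[n [cn bn]]|h] := EM (exists n, corner G g v n /\ back K (v, n)).
  exists n, K; split=> //; split=> // m cm k bm; apply: (back_le bn).
  by rewrite leqNgt; apply/negP => Kk; apply: (hK m cm); exact: back_le bm Kk.
by have := mK K (fun m cm bm => h (ex_intro _ m (conj cm bm))); rewrite ltnn.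
Qed.

Let B v := forall n, corner G g v n -> ~ Ainf (v, n).

(** From the corner with the longest chain [F] must leave [v], since a next corner at [v] would have
    a longer chain. So an infinite backward orbit of [f] in the core would put arbitrarily long
    chains at a single vertex. Outside the core a backward orbit is a ray, which gives its vertices
    a second infinite direction. *)
Lemma push_down : exists f : X -> X, [/\ mpred B, bfun f, one_ended B f & graph_contained G B f].
Proof.
have mcorner := mpred_corner graphG bg gG Gg sepO.
have mA n : mpred (fun v => Ainf (v, n)) := (mpred_pair_nat Ainf).1 mAinf n.
have mB : mpred B.
  by apply: mpred_all => n; apply: mpred_imp; [exact: mcorner|exact: mpred_not].
pose P n v := (core G v /\ best n v) \/ (~ core G v /\ unbounded G v (g n v)).
have mcore := mpred_core graphG bg gG Gg sepO.
have mP n : mpred (P n).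
  apply: mpred_or; apply: mpred_and => //.
  - apply: mpred_and => //; apply: mpred_all => m; apply: mpred_imp => //.
    by apply: mpred_all => k; apply: mpred_imp;
      [exact: (mpred_pair_nat _).1 (mpred_back k) m|exact: (mpred_pair_nat _).1 (mpred_back k) n].
  - exact: mpred_not.
  - exact: (mpred_unbounded graphG bg gG Gg sepO (f := id) (h := g n)).
have [s [ms sP]] := mselect 0 mP.
pose f v := g (s v) v.
have fnc v : ~ core G v -> unbounded G v (f v).
  move=> nc; have [w vw] := unbounded_ex ends0 v.
  have [n en] := Gg (unbounded_adj vw).
  have /sP : exists n, P n v by exists n; right; rewrite en.
  by case=> -[].
have fc v : core G v -> B v -> [/\ best (s v) v, swp G g (v, s v) (F (v, s v)) & dom (v, s v)].
  move=> cv Bv; have [n [K [bn bK nK]]] := best_ex cv.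
  have bs : best (s v) v.
    have /sP : exists n, P n v by exists n; left.
    by case=> -[].
  have [cs hs] := bs.
  have ds : dom (v, s v) by split=> //; exact: Bv.
  split=> //; have /eP[//|[ev h]] := dom_F ds.
  have bK' : back K (v, s v) by case: bn => cn _; exact: hs bK.
  have := back_F ds bK'; rewrite [F _]surjective_pairing -ev /= => bF.
  case: (nK (F (v, s v)).2) => //.
  by case: h => -[]; rewrite /= => ? ? _ _.
have fcore v : core G v -> B v -> core G (f v).
  by move=> cv /(fc v cv)[[[]]].
exists f; split=> //.
- rewrite /bfun => Q mQ; apply: (@mpred_ext _ _ (fun v => exists n, s v = n /\ Q (g n v))) => [v|].
    by split=> [[n [<-]]|h]//; exists (s v).
  by apply: mpred_ex => n; apply: mpred_and => //; exact: (bg n).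
- move=> [u hu].
  have [hc|/existsNP[i0 nc0]] := EM (forall i, core G (u i.+1)).
    have H k i : exists n, corner G g (u i.+1) n /\ back k (u i.+1, n).
      elim: k i => [|k IH] i.
        by have [n [K [[cn _] _ _]]] := best_ex (hc i); exists n.
      have [m [cm bm]] := IH i.+1; have [Bu eu] := hu i.+1.
      have [[_ hs] sw ds] := fc _ (hc i.+1) Bu.
      have := back_F ds (hs m cm k bm); have [_ cF /= e1 _] := sw.
      rewrite -/(f _) eu in e1.
      rewrite [F _]surjective_pairing -e1 => bF.
      by exists (F (u i.+2, s (u i.+2))).2; split=> //; rewrite e1.
    have [n [K [_ _ nK]]] := best_ex (hc 0).
    by have [m [cm bm]] := H K.+1 0; exact: (nK m cm).
  (* [f] maps core vertices of [B] into the core, so preimages of a vertex outside the core are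
     outside too. *)
  have nc i : ~ core G (u (i0 + i).+1).
    elim: i => [|i IH]; first by rewrite addn0.
    rewrite addnS => c; apply: IH; have [Bu <-] := hu (i0 + i).+1; exact: fcore.
  pose w i := u (i0 + i).+1.
  have wu i : unbounded G (w i.+1) (w i).
    have := fnc _ (nc i.+1); rewrite /w; have [_ <-] := hu (i0 + i).+1; by rewrite addnS.
  have one i a b : unbounded G (w i) a -> unbounded G (w i) b -> a = b.
    by move=> ha hb; apply: contrapT => ab; apply: (nc i); exists a, b.
  have nb i : w i <> w i.+2.
    move=> ei; have := wu i.+1; rewrite -ei => /(unbounded_step locG)[z [ze uz]].
    by apply: ze; apply: (one i.+1).
  have gw : geodesic_ray G w.
    by split=> // i; apply: (adjC graphG); exact: unbounded_adj (wu i).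
  have := ray_unbounded (geodesic_ray_shift 1 gw); rewrite addn0 addn1 => w12.
  by apply: (nb 0); apply: (one 1).
move=> v Bv; have [cv|ncv] := EM (core G v).
  by have [[cs _] _ _] := fc v cv Bv; exact: (corner_adj gG cs).
exact: unbounded_adj (fnc v ncv).
Qed.

End PushDown.

(** * Measure and category *)

Section Category.
Context {R : realType} {d : measure_display} {X : measurableType d} (dX : X -> X -> R) (qX : nat -> X).
Hypothesis pX : polish_metric dX qX.
Hypothesis borelX : @measurable d X = <<s (mopen dX : set (set X)) >>.
Local Open Scope ring_scope.

Definition nwd (F : X -> Prop) := forall x (r : R), 0 < r -> exists y s, 0 < s /\
  forall z, dX y z < s -> dX x z < r /\ ~ F z.

(** Meagerness up to subsets; [thin_meager] returns to the equality required by [meager]. *)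
Definition thin (S : X -> Prop) := exists F : nat -> X -> Prop,
  (forall n, nwd (F n)) /\ forall x, S x -> exists n, F n x.

Lemma thin_sub (S T : X -> Prop) : (forall x, S x -> T x) -> thin T -> thin S.
Proof. by move=> ST [F [nF hF]]; exists F; split=> // x /ST /hF. Qed.

Lemma thin_cup (I : countType) (S : I -> X -> Prop) : (forall i, thin (S i)) -> thin (fun x => exists i, S i x).
Proof.
move=> /choice[F hF].
exists (fun n x => if (unpickle n : option (I * nat)) is Some im then F im.1 im.2 x else False); split.
  move=> n; case: unpickle => [[i m]|]; first by have [h _] := hF i; exact: h.
  by move=> x r r0; exists x, r; split=> // z xz; split.
move=> x [i Sx]; have [_ /(_ x Sx)[m Fm]] := hF i.
by exists (pickle (i, m)); rewrite pickleK.
Qed.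

Lemma thin_or (S T : X -> Prop) : thin S -> thin T -> thin (fun x => S x \/ T x).
Proof.
move=> hS hT; apply: (@thin_sub _ (fun x => exists b : bool, if b then S x else T x)).
  by move=> x [?|?]; [exists true|exists false].
by apply: (@thin_cup bool (fun b x => if b then S x else T x)) => -[].
Qed.

Lemma thin0 (S : X -> Prop) : (forall x, ~ S x) -> thin S.
Proof. by move=> S0; exists (fun _ _ => False); split=> [n x r r0|x /S0 //]; exists x, r; split=> // z xz; split. Qed.

Lemma thin_ball x r : 0 < r -> ~ thin (fun z => dX x z < r).
Proof.
move=> r0 [F [nF hF]].
(* Nested balls for Baire's theorem: halving the radius fits closed balls into open ones, and the
   bound by [tol] makes the centers Cauchy. *)
have /choice[N hN] : forall xrn : X * R * nat, exists ys : X * R, 0 < xrn.1.2 ->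
    [/\ 0 < ys.2, ys.2 <= ratr (tol xrn.2) / 2 &
     forall z, dX ys.1 z <= ys.2 -> dX xrn.1.1 z < xrn.1.2 /\ ~ F xrn.2 z].
  move=> [[a ra] n] /=; have [ra0|] := EM (0 < ra); last by exists (a, 0).
  have [y [s [s0 hs]]] := nF n a ra ra0.
  have t0 : 0 < ratr (tol n) :> R by rewrite ltr0q invr_gt0.
  exists (y, Num.min s (ratr (tol n)) / 2) => _ /=; split.
  - by rewrite divr_gt0// lt_min s0 t0.
  - by rewrite ler_pM2r ?invr_gt0// ge_min lexx orbT.
  move=> z hz; apply: hs; apply: (le_lt_trans hz).
  have : Num.min s (ratr (tol n)) <= s by rewrite ge_min lexx.
  lra.
pose b := fix b n : X * R := if n is n'.+1 then N (b n', n') else (x, r).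
have b0 n : 0 < (b n).2 by elim: n => //= n IH; have [] := hN (b n, n) IH.
have bN n := hN (b n, n) (b0 n).
have nest n k z : dX (b (n + k)%N).1 z < (b (n + k)%N).2 -> dX (b n).1 z < (b n).2.
  elim: k => [|k IH]; first by rewrite addn0.
  rewrite addnS /= => h; apply: IH; have [_ _ /(_ z (ltW h))[]//] := bN (n + k)%N.
have cen n k : dX (b n).1 (b (n + k)%N).1 < (b n).2.
  by apply: (nest n k); rewrite (dist_xx pX).
have close n m : (n.+1 <= m)%N -> dX (b n.+1).1 (b m).1 <= ratr (tol n) / 2.
  move=> nm; have [_ h _] := bN n; apply: le_trans h.
  by have := cen n.+1 (m - n.+1)%N; rewrite subnKC// => /ltW.
have [z hz] : exists z, forall e, 0 < e -> exists M, forall n, (M <= n)%N -> dX z (b n).1 < e.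
  apply: (dist_complete pX (u := fun n => (b n).1)) => e e0.
  have [n hn] := @tol_lt R e e0; exists n.+1 => m l hm hl.
  have := close n m hm; have := close n l hl.
  have := dist_triangle pX (b m).1 (b n.+1).1 (b l).1.
  by rewrite (dist_sym pX (b m).1 (b n.+1).1); lra.
have lim n : dX (b n.+1).1 z <= (b n.+1).2.
  rewrite leNgt; apply/negP => h.
  have [|M hM] := hz (dX (b n.+1).1 z - (b n.+1).2); first by rewrite subr_gt0.
  have := hM (n.+1 + M)%N (leq_addl _ _); have := cen n.+1 M.
  have := dist_triangle pX (b n.+1).1 (b (n.+1 + M)%N).1 z.
  by rewrite (dist_sym pX (b (n.+1 + M)%N).1 z); lra.
have [n Fz] : exists n, F n z by apply: hF; have [_ _ /(_ z (lim 0%N))[]] := bN 0%N.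
by have [_ _ /(_ z (lim n))[_]] := bN n; apply.
Qed.

Definition baire_property (S : set X) := exists U, [/\ mopen dX U,
  thin (fun x => S x /\ ~ U x) & thin (fun x => U x /\ ~ S x)].

Lemma sigma_algebra_baire : sigma_algebra setT baire_property.
Proof.
split.
- by exists (fun=> False); split=> //; apply: thin0 => x [].
- move=> S [U [oU hS hU]]; rewrite setTD.
  (* The interior of the complement of [U]; what it misses is the boundary of [U], which is nowhere
     dense. *)
  pose V x := exists2 r, 0 < r & forall w, dX x w < r -> ~ U w.
  have VU x : V x -> ~ U x by move=> [r r0 h]; apply: h; rewrite (dist_xx pX).
  have sub x y r (s := r - dX x y) z : dX y z < s -> dX x z < r.
    by have := dist_triangle pX x y z; rewrite /s; lra.
  exists V; split.
  + move=> x [r r0 hr]; exists r => // y xy; exists (r - dX x y); first by rewrite subr_gt0.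
    by move=> w yw; apply: hr; exact: sub yw.
  + apply: (@thin_sub _ (fun x => (U x /\ ~ S x) \/ (~ U x /\ ~ V x))).
      by move=> x [nS nV]; have [Ux|nU] := EM (U x); [left|right].
    apply: thin_or => //; exists (fun _ x => ~ U x /\ ~ V x); split; last by move=> x h; exists 0%N.
    move=> _ x r r0; have [[y [xy Uy]]|h] := EM (exists y, dX x y < r /\ U y).
      have [s s0 hs] := oU y Uy; exists y, (Num.min s (r - dX x y)).
      split; first by rewrite lt_min s0 subr_gt0.
      move=> z; rewrite lt_min => /andP[z1 z2]; split; first exact: sub z2.
      by move=> [nU _]; apply: nU; exact: hs.
    exists x, r; split=> // z xz; split=> // -[_ nV]; apply: nV.
    exists (r - dX x z); first by rewrite subr_gt0.
    by move=> w zw Uw; apply: h; exists w; split=> //; exact: sub zw.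
  + apply: thin_sub hS => x [Vx nS]; split; last exact: VU.
    by apply: contrapT.
- move=> F /choice[U hU]; exists (fun x => exists n, U n x); split.
  + move=> x [n Ux]; have [oU _ _] := hU n; have [r r0 hr] := oU x Ux.
    by exists r => // w /hr; exists n.
  + apply: (@thin_sub _ (fun x => exists n, F n x /\ ~ U n x)).
      by move=> x [[n _ Fx] nU]; exists n; split=> // Ux; apply: nU; exists n.
    by apply: thin_cup => n; have [] := hU n.
  + apply: (@thin_sub _ (fun x => exists n, U n x /\ ~ F n x)).
      by move=> x [[n Ux] nF]; exists n; split=> // Fx; apply: nF; exists n.
    by apply: thin_cup => n; have [] := hU n.
Qed.

Lemma measurable_baire (S : set X) : measurable S -> baire_property S.
Proof.
rewrite borelX; apply: smallest_sub; first exact: sigma_algebra_baire.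
by move=> U oU; exists U; split=> //; apply: thin0 => x [].
Qed.

(** By the Baire property a Borel set that is not thin contains some basic ball up to a thin set,
    and there both alternatives fail by [thin_ball]. *)
Lemma thin_localized (S : set X) : measurable S ->
  (forall j, thin (fun x => S x /\ bball dX qX j x) \/ ~ thin (fun x => bball dX qX j x /\ ~ S x)) ->
  thin S.
Proof.
move=> /measurable_baire[U [oU hS hU]] loc; apply: contrapT => nS.
have [[x Ux]|e] := EM (exists x, U x); last first.
  by apply: nS; apply: thin_sub hS => x Sx; split=> // Ux; apply: e; exists x.
have [r r0 hr] := oU x Ux; have [|n hn] := @tol_lt R (r / 2); first lra.
have t0 : 0 < ratr (tol n) :> R by rewrite ltr0q invr_gt0.
have [j hj] := dist_dense pX x t0.
pose k := pickle (j, tol n).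
have kE w : bball dX qX k w <-> dX w (qX j) < ratr (tol n) by rewrite /bball pickleK_inv.
have kU w : bball dX qX k w -> U w.
  move=> /kE hw; apply: hr; have := dist_triangle pX x (qX j) w.
  by rewrite (dist_sym pX (qX j) w); lra.
have thk : thin (fun x => bball dX qX k x /\ ~ S x).
  by apply: thin_sub hU => w [/kU].
have [hk|//] := loc k.
apply: (@thin_ball (qX j) _ t0); apply: thin_sub (thin_or hk thk) => w hw.
have bw : bball dX qX k w by apply/kE; rewrite (dist_sym pX).
by have [Sw|nw] := EM (S w); [left|right].
Qed.

Lemma thin_meager (tau : Topological X) (S : set X) :
  (forall U : set X, @open (Topological.Pack tau) U <-> mopen dX U) -> thin S ->
  @meager (Topological.Pack tau) S.
Proof.
move=> openE [F [nF hF]]; exists (fun n => [set x | F n x /\ S x]); last first.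
  by apply/seteqP; split=> [x Sx|x [n _ []//]]; have [n Fx] := hF x Sx; exists n.
move=> n; apply/seteqP; split=> // x.
rewrite /interior nbhsE => -[U [oU Ux] hU]; move/openE : oU => oU.
have [r r0 hr] := oU x Ux; have [y [s [s0 hs]]] := nF n x r r0.
have Uy : U y by apply: hr; apply: (hs y _).1; rewrite (dist_xx pX).
have /(_ [set z | dX y z < s]) := hU y Uy; case.
  apply: (@open_nbhs_nbhs (Topological.Pack tau)); split; last by rewrite /= (dist_xx pX).
  apply/openE => z yz; exists (s - dX y z); first by rewrite subr_gt0.
  by move=> w zw; have := dist_triangle pX y z w; rewrite /= in yz *; lra.
by move=> z [[Fz _] yz]; have [] := hs z yz.
Qed.

End Category.

(** * Assembly, and the choice of deletions for measure and for category *)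

Section OneEndedOff.
Context {R : realType} {d : measure_display} {X : measurableType d} (G : rel X).
Hypothesis stdX : standard_borel R X.
Hypothesis borelG : borel_graph G.
Hypothesis locG : locally_finite G.
Hypothesis acyclicG : acyclic G.
Hypothesis endsG : forall x, ~ (ends_of G (component G x) #= `I_0)%card
              /\ ~ (ends_of G (component G x) #= `I_2)%card.

Lemma one_ended_off (select : nat -> (X * nat -> Prop) -> (X * nat -> Prop) -> Prop) :
  (forall n A (A' : 'I_rounds -> X * nat -> Prop), mpred A ->
     (forall i, mpred (A' i) /\ forall x, A' i x -> A x) ->
     (forall x, A x -> exists i, ~ A' i x) -> exists i, select n A (A' i)) ->
  exists (A : nat -> X * nat -> Prop) (f : X -> X),
    (forall n, [/\ mpred (A n), forall y, A n.+1 y -> A n y & select n (A n) (A n.+1)]) /\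
    let B v := ~ exists k, forall n, A n (v, k) in
    [/\ mpred B, bfun f, one_ended B f & graph_contained G B f].
Proof.
move=> selectP; have [graphG mG] := borelG.
have [tau ctau] := stdX.
have [dX [qX [pX bX _]]] := compatible_polish_metric ctau.
have [g [bg gG Gg]] := lusin_novikov pX bX mG locG.
have sepO := separating_bball pX bX.
have forestG := acyclic_forest graphG acyclicG.
have ends0 x := (endsG x).1; have ends2 x := (endsG x).2.
have [e [be eP]] := corner_moves graphG bg gG Gg sepO.
have sym x y : adj e x y -> adj e y x by move=> /eP h; apply/eP/cadj_sym.
have fadj : forest (adj e).
  move=> u n n0 wu ru; apply: (forest_cadj forestG gG n0 _ ru) => i hi.
  exact/eP/wu.
have gA := good_corners graphG locG forestG bg gG Gg sepO ends2 eP.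
have [Oy sOy] := separating_pair_nat sepO.
have [A [J [A0 hA]]] := iterate_removal be sOy sym fadj selectP gA.
have [|J' oJ'] := @assemble _ _ e A J; first by move=> n; have [] := hA n.
rewrite A0 in oJ'.
have mAinf : mpred (fun y => forall n, A n y) by apply: mpred_all => n; have [] := hA n.
have [f [mB bf oB cB]] := push_down graphG locG bg gG Gg sepO ends0 be eP mAinf oJ'.
exists A, f; split; first by move=> n; have [] := hA n.
have eB : (fun v => forall n, corner G g v n -> ~ forall n0, A n0 (v, n)) =
    (fun v => ~ exists k, forall n, A n (v, k)).
  apply/funext => v; apply/propext; split=> [h [k Ak]|h k _ Ak]; last by apply: h; exists k.
  by apply: (h k) => //; have := Ak 0; rewrite A0.
by rewrite /= -eB; split.
Qed.

Section Measure.
Variable mu : probability X R.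
Local Open Scope ring_scope.

Let m (S : set X) : R := fine (mu S).

(** The deleted parts cover the slice, so one of them has at least the fraction [1 / rounds] of its
    measure. Slices are treated separately because [mu] lives on [X], not on corners. *)
Lemma select_measure (k : nat) (A : X * nat -> Prop) (A' : 'I_rounds -> X * nat -> Prop) : mpred A ->
  (forall i, mpred (A' i) /\ forall x, A' i x -> A x) ->
  (forall x, A x -> exists i, ~ A' i x) ->
  exists i, m [set v | A (v, k)] <= rounds%:R * (m [set v | A (v, k)] - m [set v | A' i (v, k)]).
Proof.
move=> /mpred_pair_nat /(_ k) mA hA' cov; apply: contrapT => /forallNP h.
pose S := [set v | A (v, k)]; pose T i := [set v | A' i (v, k)].
have mT i : measurable (T i) by have [/mpred_pair_nat /(_ k)] := hA' i.
have fin U : measurable U -> mu U \is a fin_num by exact: fin_num_measure.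
have mD i : m (S `\` T i) = m S - m (T i).
  rewrite /m measureD//; last by rewrite ltey_eq fin.
  have -> : S `&` T i = T i by apply: setIidr => v; have [_] := hA' i; apply.
  by rewrite fineB ?fin.
have sub : (mu S <= \sum_(i < rounds) mu (S `\` T (inord i)))%E.
  apply: (@content_subadditive _ _ _ mu S (fun i : nat => S `\` T (inord i)) rounds).
  - by move=> i _; exact: measurableD.
  - exact: mA.
  move=> v Sv; have [i nA] := cov _ Sv; rewrite -(@bigcup_mkord _ rounds (fun i : nat => S `\` T (inord i))); exists i => /=; first exact: ltn_ord.
  by split=> //; rewrite inord_val.
have : m S <= \sum_(i < rounds) (m S - m (T i)).
  rewrite -lee_fin fineK ?fin//; apply: (le_trans sub).
  rewrite -sumEFin; apply: lee_sum => i _; rewrite inord_val -mD fineK ?fin//.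
  exact: measurableD.
rewrite leNgt => /negP; apply.
have r0 : (0 : R) < rounds%:R by rewrite ltr0n.
apply: (@lt_le_trans _ _ (\sum_(i < rounds) m S / rounds%:R)).
  apply: ltr_sum; last by move=> i _; rewrite ltr_pdivlMr// mulrC ltNge; apply/negP/h.
  by apply/hasP; exists ord0; rewrite ?mem_index_enum.
by rewrite sumr_const card_ord -(mulr_natr (m S / rounds%:R)) divfK ?lt0r_neq0.
Qed.

Lemma one_ended_conull : exists (B : set X) (f : X -> X),
  [/\ measurable B, mu (~` B) = 0%E, measurable_fun B f, one_ended B f & graph_contained G B f].
Proof.
have [phi hphi] := schedule 0%N.
have [A [f [hA [mB bf oB cB]]]] := one_ended_off (select := fun n A A' =>
  m [set v | A (v, phi n)] <= rounds%:R * (m [set v | A (v, phi n)] - m [set v | A' (v, phi n)]))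
  (fun n => @select_measure (phi n)).
exists (fun v => ~ exists k, forall n, A n (v, k)), f; split=> //; last first.
  have /bfun_measurable h := bf; apply: (measurable_funS measurableT) h => //.
have r0 : (0 : R) < rounds%:R by rewrite ltr0n.
have mA k n : measurable [set v | A n (v, k)].
  by have [/mpred_pair_nat /(_ k)] := hA n.
have mAi k : measurable [set v | forall n, A n (v, k)].
  by apply: mpred_all => n; exact: mA.
have -> : ~` (fun v => ~ exists k, forall n, A n (v, k)) = \bigcup_k [set v | forall n, A n (v, k)].
  by apply/seteqP; split=> [v /contrapT[k hk]|v [k _ hk] h]; [exists k|apply: h; exists k].
apply: measure_negligible; first exact: bigcupT_measurable.
apply: negligible_bigcup => k; apply/negligibleP => //.
have fin U : measurable U -> mu U \is a fin_num by exact: fin_num_measure.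
have le U V : measurable U -> measurable V -> U `<=` V -> m U <= m V.
  by move=> mU mV UV; apply: fine_le; rewrite ?fin// le_measure ?inE.
have mono n l : (n <= l)%N -> [set v | A l (v, k)] `<=` [set v | A n (v, k)].
  move=> /subnK <-; elim: (l - n)%N => //= j IH v; rewrite addSn.
  by have [_ h _] := hA (j + n)%N => /= /h /IH.
pose c := m [set v | forall n, A n (v, k)].
have c0 : 0 <= c by apply: fine_ge0; exact: measure_ge0.
suff c00 : c = 0.
  by have h := fineK (fin _ (mAi k)); rewrite -[fine _]/c c00 in h; exact: esym h.
apply/eqP; rewrite eq_le c0 andbT leNgt; apply/negP => cpos.
(* Each visit to slice [k] removes at least [c / rounds], where [c] is the measure that remains in
   the end. *)
have drop j : exists n, m [set v | A n (v, k)] <= 1 - j%:R * (c / rounds%:R).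
  elim: j => [|j [n hn]].
    exists 0%N; rewrite mul0r subr0 -lee_fin fineK ?fin//; exact: probability_le1.
  have [n' nn' pn'] := hphi k n; exists n'.+1.
  have [_ _ /=] := hA n'; rewrite pn' => h.
  have h1 : c <= m [set v | A n' (v, k)] by apply: le => // v; exact.
  have h2 := le _ _ (mA k n') (mA k n) (mono _ _ nn').
  have h3 : c / rounds%:R <= m [set v | A n' (v, k)] - m [set v | A n'.+1 (v, k)].
    by rewrite ler_pdivrMr// mulrC; exact: le_trans h.
  by rewrite -natr1 mulrDl mul1r; lra.
have cr0 : 0 < c / rounds%:R by rewrite divr_gt0.
have [n] := drop (Num.truncn (c / rounds%:R)^-1).+1.
have : 0 <= m [set v | A n (v, k)] by apply: fine_ge0; exact: measure_ge0.
have /andP[_] := Num.Theory.truncn_itv (ltW (etrans (invr_gt0 _) cr0)).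
rewrite invf_plt ?posrE ?ltr0n// => h; rewrite invf_plt ?posrE ?ltr0n// in h.
have : 1 < (Num.truncn (c / rounds%:R)^-1).+1%:R * (c / rounds%:R).
  by rewrite -ltr_pdivrMr// div1r invf_plt ?posrE ?ltr0n// -[X in _ < X]invrK ltf_pV2 ?posrE ?invr_gt0 ?ltr0n//.
lra.
Qed.

End Measure.

Lemma one_ended_comeager (tau : Topological X) : compatible_polish R tau ->
  exists (B : set X) (f : X -> X), [/\ measurable B, @comeager (Topological.Pack tau) B,
    measurable_fun B f, one_ended B f & graph_contained G B f].
Proof.
move=> ctau; have [dX [qX [pX bX openE]]] := compatible_polish_metric ctau.
have [phi hphi] := schedule (0, 0).
(* Stage [n] treats one slice inside one basic ball: if the slice is not thin there, some deletion
   removes a part that is not thin. *)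
pose S n (A : X * nat -> Prop) v := A (v, (phi n).1) /\ bball dX qX (phi n).2 v.
have [|A [f [hA [mB bf oB cB]]]] := one_ended_off (select := fun n A A' =>
  thin dX (S n A) \/ ~ thin dX (fun v => S n A v /\ ~ A' (v, (phi n).1))).
  move=> n A A' _ _ cov; have [h|h] := EM (thin dX (S n A)); first by exists ord0; left.
  apply: contrapT => /forallNP h'; apply: h.
  apply: (@thin_sub _ _ _ _ _ (fun v => exists i, S n A v /\ ~ A' i (v, (phi n).1))).
    by move=> v [Av bv]; have [i ni] := cov _ Av; exists i.
  by apply: thin_cup => i; apply: contrapT => nt; apply: (h' i); right.
exists (fun v => ~ exists k, forall n, A n (v, k)), f; split=> //; last first.
  have /bfun_measurable h := bf; exact: (measurable_funS measurableT).
apply: (thin_meager pX) => //.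
apply: (@thin_sub _ _ _ _ _ (fun v => exists k, forall n, A n (v, k))).
  by move=> v /contrapT.
apply: thin_cup => k; apply: (thin_localized pX bX).
  by apply: mpred_all => n; have [/mpred_pair_nat /(_ k)] := hA n.
move=> j; have [n _ en] := hphi (k, j) 0.
have [_ _] := hA n; rewrite /S en /= => -[h|h]; [left|right].
  by apply: thin_sub h => v [Av bv].
by move=> h'; apply: h; apply: thin_sub h' => v [[_ bv] nA]; split=> // Av; exact/nA.
Qed.
End OneEndedOff.

Local Open Scope ring_scope.
Local Open Scope card_scope.

Theorem theorem1p5 (R : realType) (d : measure_display)
    (X : measurableType d) (G : rel X) :
  standard_borel R X ->
  borel_graph G -> locally_finite G -> acyclic G ->
  (forall x : X, ~ (ends_of G (component G x) #= `I_0)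
              /\ ~ (ends_of G (component G x) #= `I_2)) ->
  (forall mu : probability X R,
     exists (B : set X) (f : X -> X),
       [/\ measurable B, mu (~` B) = 0%E, measurable_fun B f,
           one_ended B f & graph_contained G B f])
  /\
  (forall tau : Topological X, compatible_polish R tau ->
     exists (B : set X) (f : X -> X),
       [/\ measurable B, @comeager (Topological.Pack tau) B,
           measurable_fun B f, one_ended B f & graph_contained G B f]).
Proof.
move=> stdX bG lG aG endsG; split=> [mu|tau ctau].
  exact: (one_ended_conull stdX bG lG aG endsG mu).
exact: (one_ended_comeager stdX bG lG aG endsG ctau).
Qed.
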